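(* Let $k\ge 1$ and let $x$ be real. For complex $w$ set $$f(x,w) := 1-\int_x^\infty \Bigl(\frac1{1-\mathbf{A}_x}C_w\Bigr)(\xi)\,\mathrm{Ai}(\xi)\,d\xi .$$ For distinct complex numbers $w_1,\dots,w_k$, $$F_k(x;w_1,\dots,w_k)=F_0(x)\cdot\frac{\det\bigl((w_m+D_x)^{n-1}f(x,w_m)\bigr)_{1\le m,n\le k}}{\prod_{1\le m<n\le k}(w_n-w_m)},$$ where $D_x=\frac{\partial}{\partial x}$. When some of the $w_j$'s coincide, the formula still holds with the right-hand side evaluated by l'Hôpital's rule, i.e. as the limit of the right-hand side as distinct tuples tend to $(w_1,\dots,w_k)$.
   Context: All contour integrals below are over a curve in the complex plane from $\infty e^{5i\pi/6}$ to $\infty e^{i\pi/6}$. The Airy function is $\mathrm{Ai}(\xi)=\frac1{2\pi}\int e^{i(\xi a+\frac13a^3)}da$. The Airy kernel is $\mathbf{A}(\xi,\eta)=\int_0^\infty \mathrm{Ai}(\xi+z)\mathrm{Ai}(z+\eta)\,dz$; $\mathbf{A}_x$ denotes the operator on $L^2((x,\infty))$ with kernel $\mathbf{A}(\xi,\eta)$. It is known that $1-\mathbf{A}_x$ is invertible. Set $F_0(x)=\det(1-\mathbf{A}_x)$ (Fredholm determinant). For complex $w$: $C_w(\xi)=\frac1{2\pi}\int e^{i(\frac13a^3+\xi a)}\frac1{w+ia}\,da$, the contour being such that the pole $a=iw$ lies above it. For $m\ge1$ and complex $w_1,w_2,\dots$: $$s^{(m)}(\xi;w_1,\dots,w_m)=\frac1{2\pi}\int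 e^{\frac13ia^3+i\xi a}\prod_{j=1}^m\frac1{w_j+ia}\,da,$$ where the poles $a=iw_1,\dots,iw_m$ lie above the contour, and $$t^{(m)}(\xi;w_1,\dots,w_{m-1})=\frac1{2\pi}\int e^{\frac13ib^3+i\xi b}\prod_{j=1}^{m-1}(w_j-ib)\,db$$ (empty products equal $1$). Define $$F_k(x;w_1,\dots,w_k)=F_0(x)\cdot\det\Bigl(\delta_{mn}-\Bigl\langle\frac1{1-\mathbf{A}_x}s^{(m)}(\cdot;w_1,\dots,w_m),\,t^{(n)}(\cdot;w_1,\dots,w_{n-1})\Bigr\rangle\Bigr)_{1\le m,n\le k},$$ where $\langle h,g\rangle=\int_x^\infty h(\xi)g(\xi)\,d\xi$ is the real (bilinear) inner product on $(x,\infty)$. Convention: $s^{(m)}$ and $C_w$ grow at most exponentially at $+\infty$ but need not lie in $L^2((x,\infty))$ (when some $\mathrm{Re}\,w_j\le0$); for such $h$, $\frac1{1-\mathbf{A}_x}h$ means $h+(1-\mathbf{A}_x)^{-1}\mathbf{A}_xh$, where $(\mathbf{A}_xh)(\xi)=\int_x^\infty\mathbf{A}(\xi,\eta)h(\eta)\,d\eta\in L^2((x,\infty))$. *)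

(* Defs.v *)
From HB Require Import structures.
From mathcomp Require Import all_boot all_order all_algebra.
From mathcomp Require Import complex ring lra.
From mathcomp Require Import all_classical all_reals all_analysis.

Set Implicit Arguments.
Unset Strict Implicit.
Unset Printing Implicit Defensive.

Import Order.TTheory GRing.Theory Num.Theory numFieldNormedType.Exports.

Local Open Scope classical_set_scope.
Local Open Scope ring_scope.
Local Open Scope complex_scope.

(* The usual topology of the complex plane on R[i]. *)
HB.instance Definition _ (R : rcfType) := NormedModule.copy R[i] R[i]^o.

Section Airy.
Variable R : realType.
Local Notation C := R[i].
Local Notation Re := (@complex.Re R).
Local Notation Im := (@complex.Im R).
Local Notation mu := (@lebesgue_measure R).

Definition cexp (z : C) : C :=
  (expR (Re z) * cos (Im z)) +i* (expR (Re z) * sin (Im z)).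

(* Lebesgue integral and derivative of a complex-valued function of a real
   variable, taken componentwise. *)
Definition cint (D : set R) (f : R -> C) : C :=
  (\int[mu]_(u in D) Re (f u)) +i* (\int[mu]_(u in D) Im (f u)).

Definition cderive (f : R -> C) (y : R) : C :=
  derive1 (Re \o f) y +i* derive1 (Im \o f) y.

(* The wedge-shaped curve with vertex i c: since e^{i pi/6} = (sqrt 3 + i)/2 and
   e^{5 i pi/6} = (- sqrt 3 + i)/2, it is i c + u e^{i pi/6} for u >= 0 and
   i c + |u| e^{5 i pi/6} for u <= 0. *)
Definition contour (c u : R) : C :=
  (Num.sqrt 3 / 2 * u) +i* (c + `|u| / 2).

Definition dcontour (u : R) : C :=
  (Num.sqrt 3 / 2) +i* (Num.sg u / 2).

Definition contour_int (c : R) (phi : C -> C) : C :=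
  cint setT (fun u => phi (contour c u) * dcontour u).

(* A vertex so low that every pole i w, w in ws, lies above the curve
   (see contour_below_poles); by Cauchy's theorem the integrals below do not
   depend on the choice of such a vertex. *)
Definition vertex (ws : seq C) : R :=
  \big[Num.min/0]_(w <- ws) (Re w - `|Im w| / Num.sqrt 3) - 1.

Lemma contour_below_poles (ws : seq C) (w : C) (u : R) : w \in ws ->
  Re (contour (vertex ws) u) = Re ('i * w) ->
  Im (contour (vertex ws) u) < Im ('i * w).
Proof.
move=> wws; case: w wws => a b wws /=.
rewrite !mul0r !mul1r ?add0r ?sub0r => ub.
have s3 : 0 < Num.sqrt 3 :> R by rewrite sqrtr_gt0.
have -> : `|u| / 2 = `|b| / Num.sqrt 3.
  rewrite -[b]opprK normrN -ub normrM gtr0_norm ?divr_gt0//.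
  by field; rewrite gt_eqF.
have : \big[Num.min/0]_(w <- ws) (Re w - `|Im w| / Num.sqrt 3)
       <= a - `|b| / Num.sqrt 3.
  elim: ws wws => // v ws IH; rewrite inE big_cons => /predU1P[<-|/IH h] /=.
    by rewrite ge_min lexx.
  by rewrite ge_min h orbT.
rewrite /vertex => h; lra.
Qed.

Definition Ai (xi : R) : C :=
  (2 * pi)^-1%:C *
  contour_int 0 (fun a => cexp ('i * (xi%:C * a + a ^+ 3 / 3))).

Definition Cfun (w : C) (xi : R) : C :=
  (2 * pi)^-1%:C *
  contour_int (vertex [:: w])
    (fun a => cexp ('i * (a ^+ 3 / 3 + xi%:C * a)) / (w + 'i * a)).

(* s^{(m)}(.; w_1, ..., w_m) for ws = [:: w_1; ...; w_m], and
   t^{(m)}(.; w_1, ..., w_{m-1}) for ws = [:: w_1; ...; w_{m-1}]. *)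
Definition sfun (ws : seq C) (xi : R) : C :=
  (2 * pi)^-1%:C *
  contour_int (vertex ws)
    (fun a => cexp ('i * (a ^+ 3 / 3) + 'i * (xi%:C * a)) *
              \prod_(w <- ws) (w + 'i * a)^-1).

Definition tfun (ws : seq C) (xi : R) : C :=
  (2 * pi)^-1%:C *
  contour_int 0
    (fun b => cexp ('i * (b ^+ 3 / 3) + 'i * (xi%:C * b)) *
              \prod_(w <- ws) (w - 'i * b)).

Definition airy_kernel (xi eta : R) : C :=
  cint `[0, +oo[ (fun z => Ai (xi + z) * Ai (z + eta)).

Definition airy_op (x : R) (h : R -> C) (xi : R) : C :=
  cint `]x, +oo[ (fun eta => airy_kernel xi eta * h eta).

Definition pairing (x : R) (h g : R -> C) : C :=
  cint `]x, +oo[ (fun xi => h xi * g xi).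

(* Fredholm determinant of 1 - A_x as the Fredholm series
   \sum_n (-1)^n/n! \int_{(x,oo)^n} det(A(xi_i, xi_j)) d xi_1 ... d xi_n;
   the n-dimensional integral is iterated. *)
Fixpoint iterated_int (n : nat) (D : set R) (G : seq R -> C) : C :=
  if n is n'.+1 then cint D (fun xi => iterated_int n' D (fun s => G (xi :: s)))
  else G [::].

Definition fredholm_term (x : R) (n : nat) : C :=
  (-1) ^+ n / n`!%:R *
  iterated_int n `]x, +oo[
    (fun s => \det (\matrix_(i < n, j < n) airy_kernel s`_i s`_j)).

Definition F0 (x : R) : C := limn (series (fredholm_term x)).

(* Representatives of elements of the complex space L^2((x,oo)). *)
Definition L2 (x : R) (h : R -> C) : Prop :=
  [/\ measurable_fun `]x, +oo[ (Re \o h),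
      measurable_fun `]x, +oo[ (Im \o h) &
      (\int[mu]_(xi in `]x, +oo[)
         ((Re (h xi)) ^+ 2 + (Im (h xi)) ^+ 2)%:E < +oo)%E].

(* (1 - A_x)^{-1} g for g in L^2((x,oo)): the h in L^2((x,oo)) such that
   h - A_x h = g, which is unique up to a.e. equality since 1 - A_x is
   invertible. *)
Definition inv_1A (x : R) (g : R -> C) : R -> C :=
  xget (fun=> 0) [set h | L2 x h /\
    {ae mu, forall xi, x < xi -> h xi - airy_op x h xi = g xi}].

(* Agrees with (1 - A_x)^{-1} h when h is in L^2((x,oo)), and extends it to h
   growing at most exponentially, for which A_x h is still in L^2((x,oo)). *)
Definition resolvent (x : R) (h : R -> C) (xi : R) : C :=
  h xi + inv_1A x (airy_op x h) xi.

Definition Fk (k : nat) (x : R) (w : 'rV[C]_k) : C :=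
  let ws := [seq w 0 j | j <- enum 'I_k] in
  F0 x * \det (\matrix_(m < k, n < k)
    ((m == n)%:R -
     pairing x (resolvent x (sfun (take m.+1 ws))) (tfun (take n ws)))).

Definition f_airy (x : R) (w : C) : C :=
  1 - cint `]x, +oo[ (fun xi => resolvent x (Cfun w) xi * Ai xi).

Definition w_plus_D (w : C) (g : R -> C) (y : R) : C := w * g y + cderive g y.

Definition distinct (k : nat) (w : 'rV[C]_k) : Prop := injective (w 0).

Definition Fk_formula (k : nat) (x : R) (w : 'rV[C]_k) : C :=
  F0 x *
  (\det (\matrix_(m < k, n < k)
     iter n (w_plus_D (w 0 m)) (fun y => f_airy y (w 0 m)) x) /
   \prod_(m < k) \prod_(n < k | (m < n)%N) (w 0 n - w 0 m)).

End Airy.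

(* Main.v *)
(* Suppose F_0(x) <> 0, both sides being 0 otherwise.  Fredholm's minors then
   invert 1 - A_x, not only on L^2 but also on functions growing like e^{B xi};
   for B large this space contains all C_w and s^(m).

   Put f_n(x, w) = w^n - <(1 - A_x)^{-1} C_w, Ai^(n)>, so that f_0 = f.  After
   translation to (0, oo) the kernel A(x + s, x + t) has x-derivative
   - Ai(x + s) Ai(x + t), and C_w' = Ai - w C_w, whence
     (w + D) f_n = f_{n+1} - q_n f_0,   q_n = <(1 - A_x)^{-1} Ai, Ai^(n)>.
   As q_n does not depend on w, (w + D)^n f is f_n plus a combination of
   f_0, ..., f_{n-1} with coefficients independent of w, and
   det((w_m + D)^{n-1} f(x, w_m)) = det(f_{n-1}(x, w_m)).

   Newton's interpolation formula gives
     C_{w_m} = \sum_r \prod_{j < r} (w_j - w_m) s^(r),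
   a triangular change of basis, and t^(n) = \prod_{j < n} (w_j - d/dxi) Ai is
   triangular in the Ai^(j).  These row and column operations turn F_k / F_0 into
   det(f_{n-1}(x, w_m)) up to the Vandermonde factor.

   For coinciding nodes, F_k is continuous in (w_1, ..., w_k): on one contour
   below all poles the integrands of s^(m) converge uniformly. *)
Require Import Defs.
From mathcomp Require Import all_boot all_order all_algebra.
From mathcomp Require Import complex ring lra.
From mathcomp Require Import all_classical all_reals all_analysis measurable_realfun.
Set Implicit Arguments.
Unset Strict Implicit.
Unset Printing Implicit Defensive.
Import Order.TTheory GRing.Theory Num.Theory numFieldNormedType.Exports.
Local Open Scope classical_set_scope.
Local Open Scope ring_scope.
Local Open Scope complex_scope.


(** The resolvent of the statement is a choice among L^2 solutions, known only almost everywhere,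
    and it acts on functions outside L^2. Calculations are therefore made with pointwise solutions
    in sup-norm spaces on a half-line, with weight [e^{B s}] for the functions acted on and
    [e^{-(B+1) s}] for kernel rows and Airy functions; the product [e^{-s}] has integral 1, so
    operator bounds multiply. A weighted L^1 space containing both kinds of solution identifies the
    two. Both weights come from the height of the contour vertex: the vertex [i c] yields a bound
    [e^{-xi c}], where every [c] is possible for Airy functions and [c = - B] is used below poles.
    Derivatives in [x] come from Taylor estimates with remainder [d ^+ 2], which pass through
    integrals and resolvents by norm bounds. Iterated derivatives need the formulas near [x]; the
    Neumann series makes solvability an open condition, so [F_0 <> 0] is used at [x] alone. Cauchy's
    theorem is replaced by differentiating a contour integral in the height of its vertex. *)

(** * Complex numbers with the l1 norm *)

Section ComplexNorm.
Variable R : realType.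
Local Notation C := R[i].
Local Notation Re := (@complex.Re R).
Local Notation Im := (@complex.Im R).

(* The l1 norm is real-valued and satisfies nrm (cint D f) <= int nrm f with
   constant 1. *)
Definition nrm (z : C) : R := `|Re z| + `|Im z|.

Lemma ReM (z w : C) : Re (z * w) = Re z * Re w - Im z * Im w.
Proof. by case: z w => [a b] [c d]. Qed.

Lemma ImM (z w : C) : Im (z * w) = Re z * Im w + Im z * Re w.
Proof. by case: z w => [a b] [c d]. Qed.

Lemma ReD (z w : C) : Re (z + w) = Re z + Re w.
Proof. by case: z w => [a b] [c d]. Qed.

Lemma ImD (z w : C) : Im (z + w) = Im z + Im w.
Proof. by case: z w => [a b] [c d]. Qed.

Lemma ReN (z : C) : Re (- z) = - Re z.
Proof. by case: z. Qed.

Lemma ImN (z : C) : Im (- z) = - Im z.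
Proof. by case: z. Qed.

Definition ReImE := (ReM, ImM, ReD, ImD, ReN, ImN).

Lemma complexP (z w : C) : Re z = Re w -> Im z = Im w -> z = w.
Proof. by case: z w => [a b] [c d] /= -> ->. Qed.

Lemma nrm_ge0 z : 0 <= nrm z.
Proof. by rewrite addr_ge0. Qed.

Lemma nrm0 : nrm 0 = 0.
Proof. by rewrite /nrm /= normr0 addr0. Qed.

Lemma nrm1 : nrm 1 = 1.
Proof. by rewrite /nrm /= normr0 normr1 addr0. Qed.

Lemma nrm_le0 z : nrm z <= 0 -> z = 0.
Proof.
rewrite /nrm => h; have := normr_ge0 (Re z); have := normr_ge0 (Im z) => hI hR.
by apply: complexP; apply/eqP; rewrite -normr_le0 /=; lra.
Qed.

Lemma nrmN z : nrm (- z) = nrm z.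
Proof. by rewrite /nrm ReN ImN !normrN. Qed.

Lemma nrmD z w : nrm (z + w) <= nrm z + nrm w.
Proof.
rewrite /nrm ReD ImD.
have := ler_normD (Re z) (Re w); have := ler_normD (Im z) (Im w); lra.
Qed.

Lemma nrmB z w : nrm (z - w) <= nrm z + nrm w.
Proof. by rewrite -(nrmN w) nrmD. Qed.

Lemma nrmM z w : nrm (z * w) <= nrm z * nrm w.
Proof.
rewrite /nrm ReM ImM.
have := ler_normB (Re z * Re w) (Im z * Im w).
have := ler_normD (Re z * Im w) (Im z * Re w).
rewrite !normrM; lra.
Qed.

Lemma nrm_real (a : R) : nrm a%:C = `|a|.
Proof. by rewrite /nrm /= normr0 addr0. Qed.

Lemma nrmMr (a : R) z : nrm (a%:C * z) = `|a| * nrm z.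
Proof. by rewrite /nrm ReM ImM /= !mul0r subr0 addr0 !normrM mulrDr. Qed.

Lemma nrmMi z : nrm ('i * z) = nrm z.
Proof. by rewrite /nrm ReM ImM /= !mul0r !mul1r !add0r normrN addrC. Qed.

Lemma nrm_sqr_le z : nrm z ^+ 2 <= 2 * (Re z ^+ 2 + Im z ^+ 2).
Proof.
rewrite /nrm -(real_normK (num_real (Re z))) -(real_normK (num_real (Im z))).
by have := sqr_ge0 (`|Re z| - `|Im z|); rewrite sqrrB sqrrD; lra.
Qed.

(** [nrm z^-1] is [nrm z] divided by the squared modulus of [z], which is at least [nrm z ^+ 2 / 2]:
    hence the 2. *)
Lemma nrmV z : z != 0 -> nrm z^-1 <= 2 / nrm z.
Proof.
move=> z0; have nz : 0 < nrm z.
  by rewrite lt_neqAle nrm_ge0 andbT eq_sym; apply: contra_neq z0 => h; apply: nrm_le0; rewrite h.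
have q0 : 0 < Re z ^+ 2 + Im z ^+ 2.
  have := nrm_sqr_le z; have : 0 < nrm z ^+ 2 by rewrite exprn_gt0.
  lra.
have -> : nrm z^-1 = nrm z / (Re z ^+ 2 + Im z ^+ 2).
  case: z z0 nz q0 => a b z0 nz /= q0; rewrite /nrm /= normrM normrN normrM.
  by rewrite -mulrDl [X in _ * X]ger0_norm // invr_ge0 ltW.
rewrite ler_pdivrMr // mulrAC ler_pdivlMr //.
by rewrite -expr2 nrm_sqr_le.
Qed.

Lemma Re_le_nrm z : `|Re z| <= nrm z.
Proof. by rewrite /nrm lerDl. Qed.

Lemma Im_le_nrm z : `|Im z| <= nrm z.
Proof. by rewrite /nrm lerDr. Qed.

Lemma cexpD (z w : C) : cexp (z + w) = cexp z * cexp w.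
Proof.
case: z w => [a b] [c d]; apply: complexP; rewrite ?ReM ?ImM /=.
  by rewrite expRD cosD; ring.
by rewrite expRD sinD; ring.
Qed.

Lemma cexp0 : cexp 0 = 1 :> C.
Proof. by rewrite /cexp /= expR0 cos0 sin0 mulr1 mulr0. Qed.

Lemma nrm_cexp (z : C) : nrm (cexp z) <= 2 * expR (Re z).
Proof.
rewrite /nrm /= !normrM (ger0_norm (expR_ge0 _)).
have c1 : `|cos (Im z)| <= 1 by rewrite ler_norml cos_geN1 cos_le1.
have s1 : `|sin (Im z)| <= 1 by rewrite ler_norml sin_geN1 sin_le1.
have e0 := expR_ge0 (Re z).
have := ler_wpM2l e0 c1; have := ler_wpM2l e0 s1; lra.
Qed.

End ComplexNorm.

(** * Measurability of complex-valued functions *)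

Section ComplexMeasurability.
Variable R : realType.
Local Notation C := R[i].
Local Notation mu := (@lebesgue_measure R).
Local Notation Re := (@complex.Re R).
Local Notation Im := (@complex.Im R).

(** The source is an arbitrary measurable space, so that functions of one variable, of a pair or of
    a further parameter are covered alike; the restriction to a domain is made only inside
    integrals. *)
Definition cmeas d (T : measurableType d) (f : T -> C) :=
  measurable_fun setT (fun t => Re (f t)) /\ measurable_fun setT (fun t => Im (f t)).

Section generic.
Context d (T : measurableType d).
Implicit Types f g : T -> C.

Lemma cmeas_cst z : cmeas (fun _ : T => z).
Proof. by split; exact: measurable_cst. Qed.

Lemma cmeasD f g : cmeas f -> cmeas g -> cmeas (fun t => f t + g t).
Proof.
move=> [f1 f2] [g1 g2]; split.
  by under eq_fun do rewrite ReD; exact: measurable_funD.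
by under eq_fun do rewrite ImD; exact: measurable_funD.
Qed.

Lemma cmeasN f : cmeas f -> cmeas (fun t => - f t).
Proof.
move=> [f1 f2]; split.
  by under eq_fun do rewrite ReN; exact: measurableT_comp.
by under eq_fun do rewrite ImN; exact: measurableT_comp.
Qed.

Lemma cmeasB f g : cmeas f -> cmeas g -> cmeas (fun t => f t - g t).
Proof. by move=> mf mg; apply: cmeasD => //; exact: cmeasN. Qed.

Lemma cmeasM f g : cmeas f -> cmeas g -> cmeas (fun t => f t * g t).
Proof.
move=> [f1 f2] [g1 g2]; split.
  by under eq_fun do rewrite ReM; apply: measurable_funB; exact: measurable_funM.
by under eq_fun do rewrite ImM; apply: measurable_funD; exact: measurable_funM.
Qed.

Lemma cmeas_sum (I : Type) (r : seq I) (F : I -> T -> C) :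
  (forall i, cmeas (F i)) -> cmeas (fun t => \sum_(i <- r) F i t).
Proof.
move=> mF; elim: r => [|i r IH].
  by under eq_fun do rewrite big_nil; exact: cmeas_cst.
by under eq_fun do rewrite big_cons; exact: cmeasD.
Qed.

Lemma cmeas_prod (I : Type) (r : seq I) (F : I -> T -> C) :
  (forall i, cmeas (F i)) -> cmeas (fun t => \prod_(i <- r) F i t).
Proof.
move=> mF; elim: r => [|i r IH].
  by under eq_fun do rewrite big_nil; exact: cmeas_cst.
by under eq_fun do rewrite big_cons; exact: cmeasM.
Qed.

Lemma cmeasX f n : cmeas f -> cmeas (fun t => f t ^+ n).
Proof.
move=> mf; elim: n => [|n IH].
  by under eq_fun do rewrite expr0; exact: cmeas_cst.
by under eq_fun do rewrite exprS; exact: cmeasM.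
Qed.

Lemma cmeas_mk (a b : T -> R) : measurable_fun setT a -> measurable_fun setT b ->
  cmeas (fun t => a t +i* b t).
Proof. by []. Qed.

Lemma cmeas_real (a : T -> R) : measurable_fun setT a -> cmeas (fun t => (a t)%:C).
Proof. by move=> ma; split => //=; exact: measurable_cst. Qed.

Lemma cmeas_exp f : cmeas f -> cmeas (fun t => cexp (f t)).
Proof.
move=> [f1 f2]; split => /=; apply: measurable_funM.
- exact: (measurableT_comp (@measurable_expR R)).
- apply: (measurableT_comp _ f2); apply: continuous_measurable_fun.
  exact: continuous_cos.
- exact: (measurableT_comp (@measurable_expR R)).
- apply: (measurableT_comp _ f2); apply: continuous_measurable_fun.
  exact: continuous_sin.
Qed.

Lemma cmeas_inv f : cmeas f -> cmeas (fun t => (f t)^-1).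
Proof.
move=> [f1 f2].
have mq : measurable_fun setT (fun t => (Re (f t) ^+ 2 + Im (f t) ^+ 2)^-1).
  (* The squared modulus is nonnegative, so its inverse is its real power with exponent -1, a
     measurable function of it, zeros included. *)
  have -> : (fun t => (Re (f t) ^+ 2 + Im (f t) ^+ 2)^-1) =
            (fun t => (Re (f t) ^+ 2 + Im (f t) ^+ 2) `^ (-1)).
    by apply/funext => t; rewrite powR_inv1 // addr_ge0 // sqr_ge0.
  apply: (measurableT_comp (measurable_powR _)).
  by apply: measurable_funD; exact: measurable_funX.
suff -> : (fun t => (f t)^-1) =
    (fun t => (Re (f t) * (Re (f t) ^+ 2 + Im (f t) ^+ 2)^-1) +i*
              (- Im (f t) * (Re (f t) ^+ 2 + Im (f t) ^+ 2)^-1)).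
  apply: cmeas_mk; apply: measurable_funM => //.
  exact: measurableT_comp.
by apply/funext => t; case: (f t) => a b; apply: complexP => /=; rewrite ?mulNr.
Qed.

End generic.

Lemma cmeas_comp d d' (T : measurableType d) (T' : measurableType d')
  (f : T -> C) (g : T' -> T) : cmeas f -> measurable_fun setT g ->
  cmeas (fun t => f (g t)).
Proof.
by move=> [f1 f2] mg; split; [exact: (measurableT_comp f1)|exact: (measurableT_comp f2)].
Qed.

(** Tonelli's theorem makes the integrals of the positive and negative parts measurable in the
    parameter, and [fine] of their difference stays measurable even where one of them is
    infinite. *)
Lemma measurable_Rintegral_param d (T : measurableType d) (D : set R)
    (f : T * R -> R) : measurable D -> measurable_fun setT f ->
  measurable_fun setT (fun t => \int[mu]_(u in D) f (t, u)).
Proof.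
move=> mD mf.
have mD' : measurable_fun setT (fun p : T * R => \1_D p.2 : R).
  apply: (measurableT_comp (f := (\1_D : R -> R))) => //.
have pos (g : T * R -> \bar R) : measurable_fun setT g -> (forall p, 0 <= g p)%E ->
    measurable_fun setT (fun t => \int[mu]_(u in D) g (t, u))%E.
  move=> mg g0.
  have -> : (fun t => \int[mu]_(u in D) g (t, u))%E =
            fubini_F mu (fun p : T * R => g p * (\1_D p.2)%:E)%E.
    apply/funext => t; rewrite /fubini_F [LHS]integral_mkcond; apply: eq_integral => u _.
    rewrite patchE indicE; case: ifP => h; rewrite ?mule1 ?mule0 //.
  apply: measurable_fun_fubini_tonelli_F.
    by apply: emeasurable_funM => //; exact/measurable_EFinP.
  by move=> p; rewrite mule_ge0 // lee_fin indicE.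
rewrite /Rintegral; apply: (measurableT_comp (f := fine)) => //.
have -> : (fun t => \int[mu]_(u in D) (f (t, u))%:E)%E =
  (fun t => \int[mu]_(u in D) ((EFin \o f)^\+ (t, u)) -
            \int[mu]_(u in D) ((EFin \o f)^\- (t, u)))%E.
  apply/funext => t; rewrite [LHS]integralE; congr (_ - _)%E; apply: eq_integral => u _.
    by rewrite !funeposE.
  by rewrite !funenegE.
apply: emeasurable_funB.
  by apply: pos => //; apply: measurable_funepos; exact/measurable_EFinP.
by apply: pos => //; apply: measurable_funeneg; exact/measurable_EFinP.
Qed.

Lemma cmeas_cint d (T : measurableType d) (D : set R) (f : T * R -> C) :
  measurable D -> cmeas f -> cmeas (fun t => cint D (fun u => f (t, u))).
Proof.
move=> mD [f1 f2]; split => /=.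
  exact: (@measurable_Rintegral_param _ _ _ (fun p => Re (f p))).
exact: (@measurable_Rintegral_param _ _ _ (fun p => Im (f p))).
Qed.

End ComplexMeasurability.

(** * Integrals of complex-valued functions and Fubini's theorem *)

Section ComplexIntegral.
Variable R : realType.
Local Notation C := R[i].
Local Notation Re := (@complex.Re R).
Local Notation Im := (@complex.Im R).
Local Notation mu := (@lebesgue_measure R).
Implicit Types (D : set R) (f g : R -> C) (G : R -> R).

Definition cintegrable D f :=
  mu.-integrable D (fun u => (Re (f u))%:E) /\ mu.-integrable D (fun u => (Im (f u))%:E).

Definition rintegrable D G := mu.-integrable D (fun u => (G u)%:E).

Lemma rintegralE D G : measurable D -> rintegrable D G ->
  (\int[mu]_(u in D) (G u)%:E)%E = (\int[mu]_(u in D) G u)%:E.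
Proof. by move=> mD iG; rewrite /Rintegral fineK //; exact: integrable_fin_num. Qed.

Lemma rintegrableD D G H : measurable D -> rintegrable D G -> rintegrable D H ->
  rintegrable D (fun u => G u + H u).
Proof.
move=> mD iG iH; rewrite /rintegrable; under eq_fun do rewrite EFinD.
exact: integrableD.
Qed.

Lemma rintegrableZ D G a : measurable D -> rintegrable D G ->
  rintegrable D (fun u => a * G u).
Proof.
move=> mD iG; rewrite /rintegrable; under eq_fun do rewrite EFinM.
exact: integrableZl.
Qed.

Lemma rintegrable_le D G H : measurable D -> measurable_fun D G ->
  rintegrable D H -> (forall u, D u -> `|G u| <= H u) -> rintegrable D G.
Proof.
move=> mD mG iH le; rewrite /rintegrable; apply: le_integrable iH => //; first exact/measurable_EFinP.
by move=> u Du; rewrite /= lee_fin (le_trans (le u Du)) // ler_norm.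
Qed.

Lemma dom_cintegrable D f G : measurable D -> cmeas f -> rintegrable D G ->
  (forall u, D u -> nrm (f u) <= G u) -> cintegrable D f.
Proof.
move=> mD [f1 f2] iG le; split; apply: rintegrable_le iG _ => //.
- exact: measurable_funS f1.
- by move=> u Du; apply: le_trans (le u Du); exact: Re_le_nrm.
- exact: measurable_funS f2.
- by move=> u Du; apply: le_trans (le u Du); exact: Im_le_nrm.
Qed.

Lemma le_rint D G H : measurable D -> rintegrable D G -> rintegrable D H ->
  (forall u, D u -> G u <= H u) ->
  \int[mu]_(u in D) G u <= \int[mu]_(u in D) H u.
Proof. by move=> mD iG iH le; apply: le_Rintegral. Qed.

Lemma nrm_cint_le D f G : measurable D -> cintegrable D f -> rintegrable D G ->
  (forall u, D u -> nrm (f u) <= G u) ->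
  nrm (cint D f) <= \int[mu]_(u in D) G u.
Proof.
move=> mD [f1 f2] iG le; rewrite /nrm /cint /=.
have n1 : rintegrable D (fun u => `|Re (f u)|) by exact: (integrable_norm f1).
have n2 : rintegrable D (fun u => `|Im (f u)|) by exact: (integrable_norm f2).
apply: (@le_trans _ _ (\int[mu]_(u in D) `|Re (f u)| + \int[mu]_(u in D) `|Im (f u)|)).
  by apply: lerD; exact: le_normr_Rintegral.
rewrite -RintegralD //; apply: le_rint => //.
exact: rintegrableD.
Qed.

Lemma eq_cint D f g : (forall u, D u -> f u = g u) -> cint D f = cint D g.
Proof.
move=> e; rewrite /cint; congr (_ +i* _); apply: eq_Rintegral => u /set_mem Du;
  by rewrite e.
Qed.

Lemma cintegrableD D f g : measurable D -> cintegrable D f -> cintegrable D g ->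
  cintegrable D (fun u => f u + g u).
Proof.
move=> mD [f1 f2] [g1 g2]; split.
  by under eq_fun do rewrite ReD; exact: (rintegrableD mD f1 g1).
by under eq_fun do rewrite ImD; exact: (rintegrableD mD f2 g2).
Qed.

Lemma cintegrableZ D f z : measurable D -> cintegrable D f ->
  cintegrable D (fun u => z * f u).
Proof.
move=> mD [f1 f2]; split.
  under eq_fun do rewrite ReM -mulNr.
  by apply: (rintegrableD mD); exact: rintegrableZ.
under eq_fun do rewrite ImM.
by apply: (rintegrableD mD); exact: rintegrableZ.
Qed.

Lemma cintegrableN D f : measurable D -> cintegrable D f ->
  cintegrable D (fun u => - f u).
Proof.
by move=> mD fi; under eq_fun do rewrite -mulN1r; exact: cintegrableZ.
Qed.

Lemma cintegrableB D f g : measurable D -> cintegrable D f -> cintegrable D g ->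
  cintegrable D (fun u => f u - g u).
Proof. by move=> mD fi gi; apply: cintegrableD => //; exact: cintegrableN. Qed.

Lemma cintD D f g : measurable D -> cintegrable D f -> cintegrable D g ->
  cint D (fun u => f u + g u) = cint D f + cint D g.
Proof.
move=> mD [f1 f2] [g1 g2]; apply: complexP; rewrite ?ReD ?ImD /=.
  by rewrite -RintegralD //; apply: eq_Rintegral => u _; rewrite ReD.
by rewrite -RintegralD //; apply: eq_Rintegral => u _; rewrite ImD.
Qed.

Lemma cintZ D f z : measurable D -> cintegrable D f ->
  cint D (fun u => z * f u) = z * cint D f.
Proof.
move=> mD [f1 f2]; apply: complexP; rewrite ?ReM ?ImM /=.
  rewrite -!RintegralZl // -RintegralB //; first by apply: eq_Rintegral => u _; rewrite ReM.
  - exact: rintegrableZ.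
  - exact: rintegrableZ.
rewrite -!RintegralZl // -RintegralD //; first by apply: eq_Rintegral => u _; rewrite ImM.
- exact: rintegrableZ.
- exact: rintegrableZ.
Qed.

Lemma cintN D f : measurable D -> cintegrable D f ->
  cint D (fun u => - f u) = - cint D f.
Proof.
by move=> mD fi; rewrite -mulN1r -cintZ //; apply: eq_cint => u _; rewrite mulN1r.
Qed.

Lemma cintB D f g : measurable D -> cintegrable D f -> cintegrable D g ->
  cint D (fun u => f u - g u) = cint D f - cint D g.
Proof. by move=> mD fi gi; rewrite cintD ?cintN //; exact: cintegrableN. Qed.

Lemma cint0 D : cint D (fun _ => 0) = 0 :> C.
Proof. by rewrite /cint /= /Rintegral integral0. Qed.

Lemma cintegrable0 D : cintegrable D (fun _ => 0).
Proof. by split; exact: integrable0. Qed.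

Lemma cintegrable_sum (I : Type) (r : seq I) D (F : I -> R -> C) : measurable D ->
  (forall i, cintegrable D (F i)) -> cintegrable D (fun u => \sum_(i <- r) F i u).
Proof.
move=> mD iF; elim: r => [|i r IH].
  by under eq_fun do rewrite big_nil; exact: cintegrable0.
by under eq_fun do rewrite big_cons; exact: cintegrableD.
Qed.

Lemma cint_sum (I : Type) (r : seq I) D (F : I -> R -> C) : measurable D ->
  (forall i, cintegrable D (F i)) ->
  cint D (fun u => \sum_(i <- r) F i u) = \sum_(i <- r) cint D (F i).
Proof.
move=> mD iF; elim: r => [|i r IH].
  by rewrite big_nil -[RHS](cint0 D); apply: eq_cint => u _; rewrite big_nil.
rewrite big_cons -IH -cintD //; last exact: cintegrable_sum.
by apply: eq_cint => u _; rewrite big_cons.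
Qed.

Lemma Rintegral_fubini D (f : R * R -> R) G M : measurable D ->
  measurable_fun setT f -> rintegrable D G -> (forall u, D u -> 0 <= G u) -> 0 <= M ->
  (forall u v, D u -> D v -> `|f (u, v)| <= M * (G u * G v)) ->
  \int[mu]_(u in D) (\int[mu]_(v in D) f (u, v)) =
  \int[mu]_(v in D) (\int[mu]_(u in D) f (u, v)).
Proof.
move=> mD mf iG G0 M0 le.
(* Extended by 0 outside [D x D], because Fubini's theorem is applied on the whole plane; domination
   by a multiple of [G u * G v] gives integrability there. *)
pose h (p : R * R) : \bar R := (f p * \1_D p.1 * \1_D p.2)%:E.
have m1 : measurable_fun setT (fun p : R * R => \1_D p.1 : R).
  exact: (measurableT_comp (f := (\1_D : R -> R))).
have m2 : measurable_fun setT (fun p : R * R => \1_D p.2 : R).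
  exact: (measurableT_comp (f := (\1_D : R -> R))).
have mh : measurable_fun setT h.
  by apply/measurable_EFinP; apply: measurable_funM => //; apply: measurable_funM.
have ind x : D x -> \1_D x = 1 :> R by move=> Dx; rewrite indicE mem_set.
have indN x : ~ D x -> \1_D x = 0 :> R by move=> Dx; rewrite indicE memNset.
have in1 u : D u -> rintegrable D (fun v => f (u, v)).
  move=> Du; apply: (rintegrable_le mD _ (rintegrableZ (M * G u) mD iG)).
    apply: measurable_funTS; apply: (measurableT_comp mf).
    exact: pair1_measurable.
  by move=> v Dv; rewrite -mulrA; exact: le.
have in2 v : D v -> rintegrable D (fun u => f (u, v)).
  move=> Dv; apply: (rintegrable_le mD _ (rintegrableZ (M * G v) mD iG)).
    apply: measurable_funTS; apply: (measurableT_comp mf).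
    exact: pair2_measurable.
  by move=> u Du; rewrite -mulrA (mulrC (G v)); exact: le.
have E1 u : (\int[mu]_v h (u, v))%E =
    ((\1_D u) * \int[mu]_(v in D) f (u, v))%:E.
  have [Du|nDu] := pselect (D u).
    rewrite ind // mul1r -(rintegralE mD (in1 u Du)).
    rewrite [RHS]integral_mkcond; apply: eq_integral => v _.
    rewrite /h /= patchE ind // mulr1 indicE; case: ifP => _; by rewrite ?mulr1 ?mulr0.
  rewrite indN // mul0r integral0_eq // => v _; by rewrite /h /= indN // mulr0 mul0r.
have E2 v : (\int[mu]_u h (u, v))%E =
    ((\1_D v) * \int[mu]_(u in D) f (u, v))%:E.
  have [Dv|nDv] := pselect (D v).
    rewrite ind // mul1r -(rintegralE mD (in2 v Dv)).
    rewrite [RHS]integral_mkcond; apply: eq_integral => u _.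
    rewrite /h /= patchE (ind v) // mulr1 indicE; case: ifP => _; by rewrite ?mulr1 ?mulr0.
  rewrite indN // mul0r integral0_eq // => u _; by rewrite /h /= (indN v) // mulr0.
have ih : (mu \x mu)%E.-integrable setT h.
  apply/integrable12ltyP => //.
  pose I := \int[mu]_(v in D) G v.
  have I0 : 0 <= I by apply: Rintegral_ge0.
  apply: (@le_lt_trans _ _ (\int[mu]_u ((\1_D u) * (M * G u * I))%:E)%E).
    apply: ge0_le_integral => //.
    - by move=> u _; apply: integral_ge0.
    - have := @measurable_fun_fubini_tonelli_F _ _ _ _ _ mu (fun p : R * R => `|h p|%E).
      by apply => //; exact: measurableT_comp.
    - have -> : (fun u => (\1_D u * (M * G u * I))%:E) =
                ((fun u => (I * M * G u)%:E) \_ D).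
        apply/funext => u; rewrite patchE indicE; case: ifP => _.
          by rewrite mul1r; congr (_%:E); ring.
        by rewrite mul0r.
      apply/(measurable_restrictT _ mD).
      by have /integrableP[] := rintegrableZ (I * M) mD iG.
    - move=> u _; have [Du|nDu] := pselect (D u); last first.
        rewrite indN // mul0r integral0_eq // => v _.
        by rewrite /h /= indN // mulr0 mul0r normr0.
      rewrite ind // mul1r.
      have -> : (M * G u * I)%:E = (\int[mu]_(v in D) (M * G u * G v)%:E)%E.
        by rewrite rintegralE ?RintegralZl //; exact: rintegrableZ.
      rewrite [leRHS]integral_mkcond; apply: ge0_le_integral => //.
      + apply/measurable_EFinP/measurableT_comp => //.
        apply/measurable_EFinP; apply: (measurableT_comp mh).
        exact: pair1_measurable.
      + apply/(measurable_restrictT _ mD).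
        by have /integrableP[] := rintegrableZ (M * G u) mD iG.
      + move=> v _.
        rewrite patchE /h /= ind // mulr1 indicE.
        case: ifPn => [/set_mem Dv|_]; last by rewrite mulr0 normr0.
        by rewrite lee_fin mulr1 -mulrA; exact: le.
  rewrite (_ : (\int[mu]_u _)%E = (\int[mu]_(u in D) (I * M * G u)%:E)%E); last first.
    rewrite [RHS]integral_mkcond; apply: eq_integral => u _.
    rewrite patchE indicE; case: ifP => _; last by rewrite mul0r.
    by rewrite mul1r; congr (_%:E); ring.
  by rewrite rintegralE ?ltry //; exact: rintegrableZ.
have FF : (\int[mu]_u (\1_D u * \int[mu]_(v in D) f (u, v))%:E =
           \int[mu]_v (\1_D v * \int[mu]_(u in D) f (u, v))%:E)%E.
  transitivity (\int[mu]_u \int[mu]_v h (u, v))%E.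
    by apply: eq_integral => u _; rewrite E1.
  by rewrite Fubini //; apply: eq_integral => v _; rewrite E2.
have tr (k : R -> R) : \int[mu]_(u in D) k u = fine (\int[mu]_u ((\1_D u * k u)%:E))%E.
  rewrite /Rintegral integral_mkcond; congr fine; apply: eq_integral => u _.
  by rewrite patchE indicE; case: ifP => _; rewrite ?mul1r ?mul0r.
by rewrite tr FF -tr.
Qed.

End ComplexIntegral.

(** * Translation and exponential integrals on half-lines *)

Section IntegralTools.
Variable R : realType.
Local Notation C := R[i].
Local Notation Re := (@complex.Re R).
Local Notation Im := (@complex.Im R).
Local Notation mu := (@lebesgue_measure R).
Implicit Types (D : set R) (f g : R -> C) (G : R -> R).

Lemma cint_fubini D (f : R * R -> C) G M : measurable D -> cmeas f ->
  rintegrable D G -> (forall u, D u -> 0 <= G u) -> 0 <= M ->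
  (forall u v, D u -> D v -> nrm (f (u, v)) <= M * (G u * G v)) ->
  cint D (fun u => cint D (fun v => f (u, v))) =
  cint D (fun v => cint D (fun u => f (u, v))).
Proof.
move=> mD [f1 f2] iG G0 M0 le; apply: complexP.
  apply: (@Rintegral_fubini _ _ (fun p => Re (f p)) G M) => // u v Du Dv.
  by apply: le_trans (le u v Du Dv); exact: Re_le_nrm.
apply: (@Rintegral_fubini _ _ (fun p => Im (f p)) G M) => // u v Du Dv.
by apply: le_trans (le u v Du Dv); exact: Im_le_nrm.
Qed.

Definition translation (x : R) : measurableTypeR R -> measurableTypeR R := fun s => x + s.

Lemma measurable_translation x : measurable_fun setT (translation x).
Proof. exact: measurable_funD. Qed.

(** Lebesgue measure is determined by its values on half-open intervals, and translation preserves
    their lengths. *)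
Lemma pushforward_translation (x : R) (A : set (measurableTypeR R)) : measurable A ->
  mu A = pushforward mu (translation x) A.
Proof.
have mphi := measurable_translation x.
apply: (@lebesgue_measure_unique R (pushforward mu (translation x))) => // X [[a b] /= _ <-].
rewrite /pushforward.
have -> : translation x @^-1` `]a, b]%classic = `]a - x, b - x]%classic.
  by apply/seteqP; split => s /=; rewrite !in_itv /= ltrBlDl lerBrDl.
rewrite !lebesgue_measure_itv /= !lte_fin ltrD2r; case: ifP => // _.
by rewrite -!EFinB; congr (_%:E); ring.
Qed.

Lemma ge0_integral_shift (x : R) (f : R -> \bar R) :
  measurable_fun `]x, +oo[ f -> (forall u, (0 <= f u)%E) ->
  (\int[mu]_(u in `]x, +oo[) f u = \int[mu]_(s in `]0%R, +oo[) f (x + s)%R)%E.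
Proof.
move=> mf f0.
have mphi := measurable_translation x.
have e (A : set (measurableTypeR R)) : measurable A -> A `<=` `]x, +oo[ ->
    pushforward mu (translation x) A = mu A.
  by move=> mA _; apply/esym/pushforward_translation.
rewrite -(eq_measure_integral _ e) // ge0_integral_pushforward //.
congr (integral mu _ _).
by apply/seteqP; split => s /=; rewrite !in_itv /= !andbT ltrDl.
Qed.

Lemma Rintegral_shift (x : R) (f : R -> R) : measurable_fun `]x, +oo[ f ->
  \int[mu]_(u in `]x, +oo[) f u = \int[mu]_(s in `]0%R, +oo[) f (x + s).
Proof.
move=> mf; rewrite /Rintegral; congr fine.
rewrite [LHS]integralE [RHS]integralE; congr (_ - _)%E.
  rewrite ge0_integral_shift //.
    by apply: eq_integral => s _; rewrite !funeposE.
  by apply: measurable_funepos; exact/measurable_EFinP.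
rewrite ge0_integral_shift //.
  by apply: eq_integral => s _; rewrite !funenegE.
by apply: measurable_funeneg; exact/measurable_EFinP.
Qed.

Lemma cint_shift (x : R) f : measurable_fun `]x, +oo[ (Re \o f) ->
  measurable_fun `]x, +oo[ (Im \o f) ->
  cint `]x, +oo[ f = cint `]0%R, +oo[ (fun s => f (x + s)).
Proof. by move=> f1 f2; apply: complexP; exact: Rintegral_shift. Qed.

Lemma expN_continuous : continuous (fun u : R => expR (- u)).
Proof.
move=> u; apply: (@continuous_comp _ _ _ -%R); first exact: opp_continuous.
exact: continuous_expR.
Qed.

Lemma expN_cvgy : (fun u : R => expR (- u)) @ +oo%R --> (0 : R).
Proof. exact: cvgr_expR. Qed.

Lemma is_derive_expN (u : R) : is_derive u 1 (fun u : R => - expR (- u)) (expR (- u)).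
Proof.
have h : is_derive u 1 (fun v : R => expR (- v)) (- expR (- u)).
  have := @is_derive1_comp _ (@expR R) -%R u (expR (- u)) (-1).
  by rewrite mulrN1; apply; exact: is_derive_expR.
have := is_deriveN h.
by rewrite opprK.
Qed.

Lemma integral_expN :
  (\int[mu]_(u in `[0%R, +oo[) (expR (- u))%:E)%E = 1%:E.
Proof.
rewrite (@ge0_continuous_FTC2y _ _ (fun u => - expR (- u)) 0 0).
- by rewrite oppr0 expR0 sub0e -EFinN opprK.
- by move=> u _; exact: expR_ge0.
- by apply: continuous_subspaceT; exact: expN_continuous.
- by rewrite -[X in _ --> X]oppr0; apply: cvgN; exact: expN_cvgy.
- by move=> u _; have [] := is_derive_expN u.
- apply: cvg_at_right_filter; apply: cvgN; exact: expN_continuous.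
- by move=> u _; rewrite derive1E; have [_ ->] := is_derive_expN u.
Qed.

Lemma rintegrable_expN_c : rintegrable `[0%R, +oo[ (fun u : R => expR (- u)).
Proof.
apply/integrableP; split.
  apply/measurable_EFinP; apply: measurable_funTS.
  exact: continuous_measurable_fun expN_continuous.
rewrite (_ : (\int[mu]_(u in _) _)%E = 1%:E) ?ltry // -integral_expN.
by apply: eq_integral => u _; rewrite gee0_abs // lee_fin expR_ge0.
Qed.

Lemma rintegrable_expN : rintegrable `]0%R, +oo[ (fun u : R => expR (- u)).
Proof.
apply: (integrableS _ _ _ rintegrable_expN_c) => //.
by move=> u /=; rewrite !in_itv /= !andbT => /ltW.
Qed.

Lemma Rintegral_expN : \int[mu]_(u in `]0%R, +oo[) expR (- u) = 1.
Proof.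
rewrite Rintegral_itv_obnd_cbnd; first by rewrite /Rintegral integral_expN.
exact: rintegrable_expN.
Qed.

End IntegralTools.

(** * Derivatives in a real variable and the fundamental theorem on a half-line *)

Section ComplexDerivative.
Variable R : realType.
Local Notation C := R[i].
Local Notation Re := (@complex.Re R).
Local Notation Im := (@complex.Im R).
Local Notation mu := (@lebesgue_measure R).

Definition cder (F : R -> C) (u : R) (l : C) :=
  is_derive u 1 (fun v => Re (F v)) (Re l) /\ is_derive u 1 (fun v => Im (F v)) (Im l).

Lemma cder_eq F u l l' : cder F u l -> l = l' -> cder F u l'.
Proof. by move=> h <-. Qed.

Lemma cder_cst z u : cder (fun=> z) u 0.
Proof. by split => /=; exact: is_derive_cst. Qed.

Lemma cder_real (u : R) : cder (fun v => v%:C) u 1.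
Proof. by split => /=; [exact: is_derive_id|exact: is_derive_cst]. Qed.

Lemma cderD F G u l m : cder F u l -> cder G u m -> cder (fun v => F v + G v) u (l + m).
Proof.
move=> [f1 f2] [g1 g2]; split.
  under eq_fun do rewrite ReD; rewrite ReD; exact: is_deriveD f1 g1.
under eq_fun do rewrite ImD; rewrite ImD; exact: is_deriveD f2 g2.
Qed.

Lemma cderM F G u l m : cder F u l -> cder G u m ->
  cder (fun v => F v * G v) u (l * G u + F u * m).
Proof.
move=> [f1 f2] [g1 g2]; split.
  under eq_fun do rewrite ReM.
  apply: is_derive_eq (is_deriveB (is_deriveM f1 g1) (is_deriveM f2 g2)) _.
  by rewrite ReD !ReM /GRing.scale /=; ring.
under eq_fun do rewrite ImM.
apply: is_derive_eq (is_deriveD (is_deriveM f1 g2) (is_deriveM f2 g1)) _.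
by rewrite ImD !ImM /GRing.scale /=; ring.
Qed.

Lemma cderZ F u l z : cder F u l -> cder (fun v => z * F v) u (z * l).
Proof. by move=> h; apply: cder_eq (cderM (cder_cst z u) h) _; rewrite mul0r add0r. Qed.

Lemma cderN F u l : cder F u l -> cder (fun v => - F v) u (- l).
Proof.
move=> h; have := cderZ (-1) h; rewrite mulN1r.
by under eq_fun do rewrite mulN1r.
Qed.

Lemma cderB F G u l m : cder F u l -> cder G u m -> cder (fun v => F v - G v) u (l - m).
Proof. by move=> hF hG; apply: cderD => //; exact: cderN. Qed.

Lemma cderX F u l n : cder F u l ->
  cder (fun v => F v ^+ n) u (n%:R * F u ^+ n.-1 * l).
Proof.
move=> h; elim: n => [|n IH].
  by under eq_fun do rewrite expr0; rewrite !mul0r; exact: cder_cst.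
under eq_fun do rewrite exprS.
apply: cder_eq (cderM h IH) _.
by case: n {IH} => [|n] /=; rewrite ?expr0 -?natr1 ?exprS; ring.
Qed.

Lemma cder_exp F u l : cder F u l -> cder (fun v => cexp (F v)) u (l * cexp (F u)).
Proof.
move=> [f1 f2].
have e1 : is_derive u 1 (fun v => expR (Re (F v))) (Re l * expR (Re (F u))).
  rewrite mulrC.
  exact: (@is_derive1_comp _ (@expR R) (fun v => Re (F v)) u _ _ (is_derive_expR _) f1).
have e2 : is_derive u 1 (fun v => cos (Im (F v))) (- sin (Im (F u)) * Im l).
  exact: (@is_derive1_comp _ (@cos R) (fun v => Im (F v)) u _ _ (is_derive_cos _) f2).
have e3 : is_derive u 1 (fun v => sin (Im (F v))) (cos (Im (F u)) * Im l).
  exact: (@is_derive1_comp _ (@sin R) (fun v => Im (F v)) u _ _ (is_derive_sin _) f2).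
split => /=.
  apply: is_derive_eq (is_deriveM e1 e2) _.
  by rewrite ReM /GRing.scale /=; ring.
apply: is_derive_eq (is_deriveM e1 e3) _.
by rewrite ImM /GRing.scale /=; ring.
Qed.

Lemma sqr_abs_gt0 (z : C) : z != 0 -> 0 < Re z ^+ 2 + Im z ^+ 2.
Proof.
move=> z0; rewrite lt_neqAle addr_ge0 ?sqr_ge0 // andbT eq_sym.
rewrite paddr_eq0 ?sqr_ge0 // !sqrf_eq0; apply: contraNN z0 => /andP[/eqP a /eqP b].
by apply/eqP; exact: complexP.
Qed.

Lemma cder_inv F u l : F u != 0 -> cder F u l -> cder (fun v => (F v)^-1) u (- l / F u ^+ 2).
Proof.
move=> F0 [f1 f2].
have q0 := sqr_abs_gt0 F0.
pose q v := Re (F v) ^+ 2 + Im (F v) ^+ 2.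
have qd : is_derive u 1 q (2 * Re (F u) * Re l + 2 * Im (F u) * Im l).
  apply: is_derive_eq (is_deriveD (is_deriveX 2 f1) (is_deriveX 2 f2)) _.
  by rewrite /GRing.scale /= !expr1; ring.
have iq : is_derive u 1 (fun v => (q v)^-1) (- (q u) ^- 2 * (2 * Re (F u) * Re l + 2 * Im (F u) * Im l)).
  by have := is_deriveV _ qd; apply; rewrite gt_eqF.
have -> : (fun v => (F v)^-1) = (fun v => (Re (F v) * (q v)^-1) +i* (- Im (F v) * (q v)^-1)).
  by apply/funext => v; rewrite /q; case: (F v) => a b; apply: complexP => /=; rewrite ?mulNr.
split => /=.
  apply: is_derive_eq (is_deriveM f1 iq) _.
  rewrite -[in RHS]exprVn /q; case: (F u) F0 q0 => a b F0 /= q0; case: l {f1 f2 qd iq} => c d.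
  by rewrite /GRing.scale /=; field; rewrite gt_eqF.
have n2 : is_derive u 1 (fun v => - Im (F v)) (- Im l) by exact: is_deriveN.
apply: is_derive_eq (is_deriveM n2 iq) _.
rewrite -[in RHS]exprVn /q; case: (F u) F0 q0 => a b F0 /= q0; case: l {f1 f2 qd iq n2} => c d.
by rewrite /GRing.scale /=; field; rewrite gt_eqF.
Qed.

Lemma cder_cvg F u l : cder F u l ->
  {for u, continuous (fun v => Re (F v))} /\ {for u, continuous (fun v => Im (F v))}.
Proof.
by move=> [[d1 _] [d2 _]]; split; apply: differentiable_continuous; exact/derivable1_diffP.
Qed.

Lemma real_MVT_le (f df : R -> R) (a b M : R) : a <= b ->
  (forall u, a <= u -> u <= b -> is_derive u 1 f (df u)) ->
  (forall u, a <= u -> u <= b -> `|df u| <= M) -> `|f b - f a| <= M * (b - a).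
Proof.
move=> ab df1 le.
have dfi u : u \in `]a, b[ -> is_derive u 1 f (df u).
  by rewrite in_itv /= => /andP[/ltW h1 /ltW h2]; exact: df1.
have [|c cab ->] := @MVT_segment R f df a b ab dfi.
  apply: derivable_within_continuous => u; rewrite in_itv /= => /andP[h1 h2].
  by have [] := df1 u h1 h2.
rewrite normrM (ger0_norm (_ : 0 <= b - a)) ?subr_ge0 //.
rewrite ler_wpM2r ?subr_ge0 //; apply: le; move: cab; rewrite in_itv /= => /andP[].
all: by [].
Qed.

(** The mean value theorem holds for each component separately, and the two bounds add up in [nrm]:
    hence the factor 2. *)
Lemma cMVT (F dF : R -> C) (a b M : R) : a <= b ->
  (forall u, a <= u -> u <= b -> cder F u (dF u)) ->
  (forall u, a <= u -> u <= b -> nrm (dF u) <= M) -> nrm (F b - F a) <= 2 * M * (b - a).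
Proof.
move=> ab hd le; rewrite /nrm !(ReImE).
have h1 : `|Re (F b) - Re (F a)| <= M * (b - a).
  apply: (@real_MVT_le (fun u => Re (F u)) (fun u => Re (dF u))) => // u au ub.
    by have [] := hd u au ub.
  by apply: le_trans (le u au ub); exact: Re_le_nrm.
have h2 : `|Im (F b) - Im (F a)| <= M * (b - a).
  apply: (@real_MVT_le (fun u => Im (F u)) (fun u => Im (dF u))) => // u au ub.
    by have [] := hd u au ub.
  by apply: le_trans (le u au ub); exact: Im_le_nrm.
lra.
Qed.

(* Adding M e^{-u} makes the integrand nonnegative, as the library FTC on a
   half-line requires. *)
Lemma Rintegral_FTCy (F f : R -> R) M :
  (forall u : R, 0 <= u -> is_derive u 1 F (f u)) ->
  (forall u : R, 0 <= u -> {for u, continuous f}) ->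
  (forall u : R, 0 <= u -> `|F u| <= M * expR (- u)) ->
  (forall u : R, 0 <= u -> `|f u| <= M * expR (- u)) ->
  \int[mu]_(u in `]0%R, +oo[) f u = - F 0.
Proof.
move=> dF cf Fle fle.
have iE := @rintegrable_expN R.
have mD : measurable (`]0%R, +oo[ : set R) by [].
have mf : measurable_fun (`]0%R, +oo[ : set R) f.
  apply: open_continuous_measurable_fun => // u; rewrite inE /= in_itv /= andbT => u0.
  by apply: cf; exact: ltW.
have fi : rintegrable (`]0%R, +oo[ : set R) f.
  apply: (rintegrable_le mD mf (rintegrableZ M mD iE)) => u /=; rewrite in_itv /= andbT => u0.
  by apply: fle; exact: ltW.
have dG (u : R) : 0 <= u -> is_derive u 1 (fun v => F v + M * - expR (- v)) (f u + M * expR (- u)).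
  move=> u0; apply: is_derive_eq (is_deriveD (dF u u0) (is_deriveZ M (is_derive_expN u))) _.
  by [].
have key : \int[mu]_(u in `[0%R, +oo[) (f u + M * expR (- u)) = 0 - (F 0 + M * - expR (- 0)).
  apply: (@Rintegral_ge0_continuous_FTC2y _ _ (fun v => F v + M * - expR (- v))).
  - by move=> u u0; have := fle u u0; rewrite ler_norml => /andP[]; lra.
  - apply: continuous_in_subspaceT => u; rewrite inE /= in_itv /= andbT => u0.
    have c : {for (u : R), continuous (fun x : R => f x + M * expR (- x))}.
      apply: (@continuousD _ _ _ f (fun x : R => M * expR (- x))); first exact: cf.
      apply: (@continuousM _ _ (fun=> M) (fun x : R => expR (- x))); first exact: cst_continuous.
      exact: expN_continuous.
    exact: c.
  - have e0 : (fun u : R => M * expR (- u)) @ +oo%R --> (0 : R).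
      by rewrite -[X in _ --> X](mulr0 M); apply: cvgM; [exact: cvg_cst|exact: expN_cvgy].
    have F0 : F @ +oo%R --> (0 : R).
      apply: norm_cvg0; apply: squeeze_cvgr e0; last exact: cvg_cst.
      by near=> u; rewrite normr_ge0 /= Fle //; near: u; apply: nbhs_pinfty_ge; rewrite num_real.
    rewrite -[X in _ --> X]addr0; apply: cvgD => //.
    rewrite (_ : (fun v => M * - expR (- v)) = (fun v => - (M * expR (- v)))); last first.
      by apply/funext => v; rewrite mulrN.
    by rewrite -[X in _ --> X]oppr0; apply: cvgN.
  - by move=> u u0; have [] := dG u (ltW u0).
  - apply: cvg_at_right_filter.
    have [d _] := dG 0 (lexx _).
    have c : {for (0 : R), continuous (fun v => F v + M * - expR (- v))}.
      by apply: differentiable_continuous; exact/derivable1_diffP.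
    exact: c.
  - move=> u; rewrite in_itv /= andbT => u0; rewrite derive1E.
    by have [_ ->] := dG u (ltW u0).
rewrite -Rintegral_itv_obnd_cbnd in key; last exact: rintegrableD (rintegrableZ _ _ _).
rewrite RintegralD // in key; last exact: rintegrableZ.
rewrite RintegralZl // Rintegral_expN oppr0 expR0 in key.
lra.
Unshelve. all: by end_near.
Qed.

(** Differentiability of [f] stands for the continuity required by [Rintegral_FTCy]; wherever this
    is applied, a derivative of [f] is at hand. *)
Lemma cint_FTCy (F f : R -> C) M :
  (forall u : R, 0 <= u -> cder F u (f u)) ->
  (forall u : R, 0 <= u -> exists l, cder f u l) ->
  (forall u : R, 0 <= u -> nrm (F u) <= M * expR (- u)) ->
  (forall u : R, 0 <= u -> nrm (f u) <= M * expR (- u)) ->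
  cint `]0%R, +oo[ f = - F 0.
Proof.
move=> dF df Fle fle; apply: complexP; rewrite ?ReN ?ImN /=.
  apply: (@Rintegral_FTCy (fun u => Re (F u)) _ M) => u u0.
  - by have [] := dF u u0.
  - by have [l /cder_cvg[]] := df u u0.
  - by apply: le_trans (Fle u u0); exact: Re_le_nrm.
  - by apply: le_trans (fle u u0); exact: Re_le_nrm.
apply: (@Rintegral_FTCy (fun u => Im (F u)) _ M) => u u0.
- by have [] := dF u u0.
- by have [l /cder_cvg[]] := df u u0.
- by apply: le_trans (Fle u u0); exact: Im_le_nrm.
- by apply: le_trans (fle u u0); exact: Im_le_nrm.
Qed.

End ComplexDerivative.

(** * Series with geometric bounds *)

Section GeometricSeries.
Variable R : realType.
Local Notation C := R[i].
Local Notation Re := (@complex.Re R).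
Local Notation Im := (@complex.Im R).

Lemma geometric_sum_le (u : nat -> R) M m n : 0 <= M ->
  (forall i, `|u i| <= M * 2^-1 ^+ i) ->
  `|\sum_(m <= i < m + n) u i| <= 2 * M * 2^-1 ^+ m.
Proof.
move=> M0 le.
(* The missing tail of the geometric series is subtracted, so that the induction on [n] closes. *)
suff H : `|\sum_(m <= i < m + n) u i| <= 2 * M * 2^-1 ^+ m - 2 * M * 2^-1 ^+ (m + n).
  apply: le_trans H _; rewrite gerBl mulr_ge0 // ?mulr_ge0 // exprn_ge0 //.
elim: n => [|n IH]; first by rewrite addn0 big_geq // normr0 subrr.
rewrite addnS big_nat_recr ?leq_addr //=; apply: le_trans (ler_normD _ _) _.
by have := le (m + n)%N; rewrite exprS; lra.
Qed.

Lemma geometric_cvg (u : nat -> R) M : 0 <= M ->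
  (forall i, `|u i| <= M * 2^-1 ^+ i) ->
  exists2 l, series u @ \oo --> l &
    forall n, `|l - \sum_(0 <= i < n) u i| <= 2 * M * 2^-1 ^+ n.
Proof.
move=> M0 le.
have cu : cvgn (series u).
  apply: normed_cvg; apply: (@series_le_cvg _ _ (geometric M 2^-1)).
  - by move=> n /=.
  - by move=> n /=; rewrite mulr_ge0 // exprn_ge0.
  - by [].
  - by apply: is_cvg_geometric_series; rewrite ger0_norm // invf_lt1 // ltr1n.
exists (limn (series u)) => // n.
have c2 : (fun m => `|series u m - \sum_(0 <= i < n) u i|) @ \oo -->
          `|limn (series u) - \sum_(0 <= i < n) u i|.
  by apply: cvg_norm; apply: cvgB => //; exact: cvg_cst.
apply: (cvgr_to_le c2).
near=> m.
have nm : (n <= m)%N by near: m; exact: nbhs_infty_ge.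
rewrite /series /= (big_cat_nat (leq0n n) nm) /= addrAC subrr add0r.
by rewrite -(subnKC nm); exact: geometric_sum_le.
Unshelve. all: by end_near.
Qed.

(** Infinite sums of functions are all produced here, and a sum is known through its remainder
    estimate rather than as a limit. The factor 4 is 2 for a geometric tail times 2 for the two
    components. *)
Lemma csum_exists (D : set R) (u : nat -> R -> C) (w : R -> R) M : measurable D -> 0 <= M -> (forall s : R, D s -> 0 <= w s) ->
  (forall n, cmeas (u n)) ->
  (forall n (s : R), D s -> nrm (u n s) <= M * 2^-1 ^+ n * w s) ->
  exists2 U, cmeas U &
    forall n (s : R), D s -> nrm (U s - \sum_(0 <= i < n) u i s) <= 4 * M * 2^-1 ^+ n * w s.
Proof.
move=> mD M0 w0 mu_ le.
(* The terms are cut off outside [D], where no bound is known, so that the series converges at every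
   real [s] and its sum is measurable on the whole line. *)
pose w' s := \1_D s * w s.
pose v n s : C := (\1_D s)%:C * u n s.
have mv n : cmeas (v n).
  by apply: cmeasM => //; apply: cmeas_real; exact: measurable_indic.
have vE n (s : R) : D s -> v n s = u n s.
  by move=> Ds; rewrite /v indicE mem_set ?mul1r.
have wE (s : R) : D s -> w' s = w s by move=> Ds; rewrite /w' indicE mem_set ?mul1r.
have w'0 s : 0 <= w' s.
  have [Ds|nDs] := pselect (D s); first by rewrite wE // w0.
  by rewrite /w' indicE memNset // mul0r.
have vle n (s : R) : nrm (v n s) <= M * w' s * 2^-1 ^+ n.
  have [Ds|nDs] := pselect (D s); first by rewrite vE // wE // mulrAC; exact: le.
  by rewrite /v indicE memNset // mul0r nrm0 mulr_ge0 ?exprn_ge0 // mulr_ge0.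
have Mw s : 0 <= M * w' s by rewrite mulr_ge0.
have hr s := geometric_cvg (Mw s) (fun i => le_trans (Re_le_nrm (v i s)) (vle i s)).
have hi s := geometric_cvg (Mw s) (fun i => le_trans (Im_le_nrm (v i s)) (vle i s)).
have [fr /all_and2 [fr1 fr2]] : {fr & forall s, (series (fun i => Re (v i s)) @ \oo --> fr s) /\
    forall n, `|fr s - \sum_(0 <= i < n) Re (v i s)| <= 2 * (M * w' s) * 2^-1 ^+ n}.
  by apply: (@choice _ _ (fun s l => (series (fun i => Re (v i s)) @ \oo --> l) /\
    forall n, `|l - \sum_(0 <= i < n) Re (v i s)| <= 2 * (M * w' s) * 2^-1 ^+ n)) => s;
    have [l ? ?] := hr s; exists l.
have [fi /all_and2 [fi1 fi2]] : {fi & forall s, (series (fun i => Im (v i s)) @ \oo --> fi s) /\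
    forall n, `|fi s - \sum_(0 <= i < n) Im (v i s)| <= 2 * (M * w' s) * 2^-1 ^+ n}.
  by apply: (@choice _ _ (fun s l => (series (fun i => Im (v i s)) @ \oo --> l) /\
    forall n, `|l - \sum_(0 <= i < n) Im (v i s)| <= 2 * (M * w' s) * 2^-1 ^+ n)) => s;
    have [l ? ?] := hi s; exists l.
exists (fun s => fr s +i* fi s).
  split => /=.
    apply: (@measurable_fun_cvg _ _ _ _ (fun n s => series (fun i => Re (v i s)) n)) => //.
    by move=> n; apply: measurable_sum => i; have [] := mv i.
  apply: (@measurable_fun_cvg _ _ _ _ (fun n s => series (fun i => Im (v i s)) n)) => //.
  by move=> n; apply: measurable_sum => i; have [] := mv i.
move=> n s Ds; rewrite -wE // /nrm !ReImE.
have -> : Re (\sum_(0 <= i < n) u i s) = \sum_(0 <= i < n) Re (v i s).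
  by rewrite raddf_sum; apply: eq_bigr => i _; rewrite vE //.
have -> : Im (\sum_(0 <= i < n) u i s) = \sum_(0 <= i < n) Im (v i s).
  by rewrite raddf_sum; apply: eq_bigr => i _; rewrite vE //.
by have := fr2 s n; have := fi2 s n; rewrite /=; lra.
Qed.

End GeometricSeries.

(** * Contour integrals and Airy functions *)

Section Reflection.
Variable R : realType.
Local Notation C := R[i].
Local Notation Re := (@complex.Re R).
Local Notation Im := (@complex.Im R).
Local Notation mu := (@lebesgue_measure R).

Definition reflection : measurableTypeR R -> measurableTypeR R := fun s => - s.

Lemma measurable_reflection : measurable_fun setT reflection.
Proof. by apply: continuous_measurable_fun; exact: opp_continuous. Qed.

Lemma pushforward_reflection (A : set (measurableTypeR R)) : measurable A ->
  mu A = pushforward mu reflection A.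
Proof.
have mphi := measurable_reflection.
apply: (@lebesgue_measure_unique R (pushforward mu reflection)) => // X [[a b] /= _ <-].
rewrite /pushforward.
have -> : reflection @^-1` `]a, b]%classic = `[- b, - a[%classic.
  by apply/seteqP; split => s /=; rewrite !in_itv /= /reflection lerNl ltrNr andbC.
rewrite !lebesgue_measure_itv /= !lte_fin ltrN2; case: ifP => // _.
by rewrite -!EFinB; congr (_%:E); ring.
Qed.

Lemma ge0_integral_reflection (f : R -> \bar R) :
  measurable_fun (`]-oo, 0] : set R) f -> (forall u, (0 <= f u)%E) ->
  (\int[mu]_(u in `]-oo, 0%R]) f u = \int[mu]_(s in `[0%R, +oo[) f (- s)%R)%E.
Proof.
move=> mf f0.
have mphi := measurable_reflection.
have e (A : set (measurableTypeR R)) : measurable A -> A `<=` `]-oo, 0] ->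
    pushforward mu reflection A = mu A.
  by move=> mA _; apply/esym/pushforward_reflection.
rewrite -(eq_measure_integral _ e) // ge0_integral_pushforward //.
congr (integral mu _ _).
by apply/seteqP; split => s /=; rewrite !in_itv /= !andbT /reflection oppr_le0.
Qed.

Lemma Rintegral_reflection (f : R -> R) : measurable_fun (`]-oo, 0] : set R) f ->
  \int[mu]_(u in `]-oo, 0%R]) f u = \int[mu]_(s in `[0%R, +oo[) f (- s).
Proof.
move=> mf; rewrite /Rintegral; congr fine.
rewrite [LHS]integralE [RHS]integralE; congr (_ - _)%E.
  rewrite ge0_integral_reflection //.
    by apply: eq_integral => s _; rewrite !funeposE.
  by apply: measurable_funepos; exact/measurable_EFinP.
rewrite ge0_integral_reflection //.
  by apply: eq_integral => s _; rewrite !funenegE.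
by apply: measurable_funeneg; exact/measurable_EFinP.
Qed.

Lemma setT_halves : [set: R] = `]-oo, 0] `|` `]0, +oo[.
Proof.
apply/seteqP; split => u //= _; rewrite !in_itv /= andbT.
by case: (leP u 0) => _; [left|right].
Qed.

Lemma rintegrable_expN_abs : rintegrable setT (fun u : R => expR (- `|u|)).
Proof.
have mf : measurable_fun setT (fun u : R => expR (- `|u|)).
  apply: measurableT_comp => //; apply: measurableT_comp => //.
have mE : measurable_fun setT (fun u : R => (expR (- `|u|))%:E) by exact/measurable_EFinP.
apply/integrableP; split => //.
rewrite (_ : (\int[mu]_x _)%E = (\int[mu]_x (expR (- `|x|))%:E)%E); last first.
  by apply: eq_integral => u _; rewrite gee0_abs // lee_fin expR_ge0.
rewrite setT_halves.
have dj : [disjoint (`]-oo, 0] : set R) & (`]0, +oo[ : set R)].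
  apply/disj_set2P; apply/seteqP; split => u //= []; rewrite !in_itv /= andbT.
  by move=> h1 h2; have := lt_le_trans h2 h1; rewrite ltxx.
have m1 : measurable_fun (`]-oo, 0] `|` `]0, +oo[ : set R) (fun u : R => (expR (- `|u|))%:E).
  exact: measurable_funTS.
have m2 : measurable_fun (`]-oo, 0] : set R) (fun u : R => (expR (- `|u|))%:E).
  exact: measurable_funTS.
rewrite ge0_integral_setU // ge0_integral_reflection //.
rewrite (_ : (\int[mu]_(s in _) _)%E = 1%:E); last first.
  rewrite -integral_expN; apply: eq_integral => u /set_mem /=.
  by rewrite in_itv /= andbT => u0; rewrite normrN (ger0_norm u0).
rewrite (_ : (\int[mu]_(s in `]0%R, +oo[) _)%E = 1%:E) ?ltry //.
rewrite -Rintegral_expN -rintegralE //; last exact: rintegrable_expN.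
apply: eq_integral => u /set_mem /=.
by rewrite in_itv /= andbT => /ltW u0; rewrite (ger0_norm u0).
Qed.

Lemma Rintegral_halves (f : R -> R) M : measurable_fun setT f ->
  (forall u, `|f u| <= M * expR (- `|u|)) ->
  \int[mu]_u f u =
  \int[mu]_(u in `]0%R, +oo[) f (- u) + \int[mu]_(u in `]0%R, +oo[) f u.
Proof.
move=> mf le.
have fi : rintegrable setT f.
  by apply: rintegrable_le (rintegrableZ M _ rintegrable_expN_abs) _.
rewrite setT_halves Rintegral_setU //; last 2 first.
- by rewrite -setT_halves.
- apply/disj_set2P; apply/seteqP; split => u //= []; rewrite !in_itv /= andbT.
  by move=> h1 h2; have := lt_le_trans h2 h1; rewrite ltxx.
congr (_ + _); rewrite Rintegral_reflection; last exact: measurable_funTS.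
rewrite -Rintegral_itv_obnd_cbnd //.
apply: rintegrable_le (rintegrableZ M _ (@rintegrable_expN R)) _ => //.
  apply: measurable_funTS; apply: (measurableT_comp mf).
  exact: measurable_reflection.
move=> u /=; rewrite in_itv /= andbT => u0; apply: le_trans (le _) _.
by rewrite normrN (gtr0_norm u0).
Qed.

Lemma cint_halves (f : R -> C) M : cmeas f ->
  (forall u, nrm (f u) <= M * expR (- `|u|)) ->
  cint setT f = cint `]0%R, +oo[ (fun u => f (- u)) + cint `]0%R, +oo[ f.
Proof.
move=> [f1 f2] le; apply: complexP; rewrite ?ReD ?ImD /=.
  apply: (@Rintegral_halves (fun u => Re (f u)) M) => // u.
  by apply: le_trans (le u); exact: Re_le_nrm.
apply: (@Rintegral_halves (fun u => Im (f u)) M) => // u.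
by apply: le_trans (le u); exact: Im_le_nrm.
Qed.

End Reflection.

(** * Wedge contours as pairs of rays *)

Section Contour.
Variable R : realType.
Local Notation C := R[i].
Local Notation mu := (@lebesgue_measure R).

(* For s = 1 and s = -1 the two half-lines of the contour, both oriented
   outwards from the vertex i c. *)
Definition ray (s c u : R) : C := (s * (Num.sqrt 3 / 2) * u) +i* (c + u / 2).

Definition ray_dir (s : R) : C := (s * (Num.sqrt 3 / 2)) +i* 2^-1.

(** The left half of the contour runs towards the vertex, against the outward orientation of its
    ray: hence the difference. *)
Definition ray_int (c : R) (phi : C -> C) : C :=
  cint `]0%R, +oo[ (fun u => phi (ray 1 c u) * ray_dir 1 - phi (ray (-1) c u) * ray_dir (-1)).

(** Measurability in the form of stability under composition, which yields joint measurability of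
    the integrands in [xi] and in the position on the ray. *)
Definition cmfun (phi : C -> C) :=
  forall d (T : measurableType d) (g : T -> C), cmeas g -> cmeas (fun t => phi (g t)).

(** The condition [s ^+ 2 = 1] means [s = 1] or [s = -1] and treats both rays at once. *)
Definition decays (c : R) (phi : C -> C) (M : R) :=
  forall s u, s ^+ 2 = 1 -> 0 <= u -> nrm (phi (ray s c u)) <= M * expR (- u).

Lemma sqr_sqrt3 : (Num.sqrt 3 : R) ^+ 2 = 3.
Proof. by rewrite sqr_sqrtr. Qed.

Lemma sqrt3_ge0 : 0 <= Num.sqrt 3 :> R.
Proof. exact: sqrtr_ge0. Qed.

Lemma sqrt3_gt0 : 0 < Num.sqrt 3 :> R.
Proof. by rewrite sqrtr_gt0. Qed.

Lemma sqrt3_le2 : Num.sqrt 3 <= 2 :> R.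
Proof. by rewrite -(@ler_pXn2r _ 2) ?nnegrE ?sqr_sqrt3 ?sqrt3_ge0 //; lra. Qed.

Lemma norm_of_sqr1 (s : R) : s ^+ 2 = 1 -> `|s| = 1.
Proof. by move=> h; apply/eqP; rewrite -sqrp_eq1 // real_normK ?num_real // h. Qed.

Lemma nrm_ray_dir s : s ^+ 2 = 1 -> nrm (ray_dir s) <= 2.
Proof.
move=> /norm_of_sqr1 s1; rewrite /nrm /= normrM s1 mul1r.
by have := sqrt3_le2; have := sqrt3_ge0 => h0 h2; rewrite !ger0_norm //; lra.
Qed.

Lemma nrm_ray s c u : s ^+ 2 = 1 -> 0 <= u -> nrm (ray s c u) <= `|c| + 2 * u.
Proof.
move=> /norm_of_sqr1 s1 u0; have h2 := sqrt3_le2; have h0 := sqrt3_ge0.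
have -> : nrm (ray s c u) = Num.sqrt 3 / 2 * u + `|c + u / 2|.
  by rewrite /nrm /= -mulrA normrM s1 mul1r ger0_norm // mulr_ge0 // divr_ge0.
have := ler_normD c (u / 2); rewrite [`|u / 2|]ger0_norm ?divr_ge0 //.
have : Num.sqrt 3 / 2 * u <= 1 * u by rewrite ler_wpM2r //; lra.
lra.
Qed.

Lemma contour_ray c u : 0 <= u -> contour c u = ray 1 c u.
Proof. by move=> u0; rewrite /contour /ray ger0_norm // mul1r. Qed.

Lemma contourN_ray c u : 0 <= u -> contour c (- u) = ray (-1) c u.
Proof. by move=> u0; rewrite /contour /ray normrN ger0_norm //; congr (_ +i* _); ring. Qed.

Lemma cmeas_contour c : cmeas (fun u : R => contour c u).
Proof.
apply: cmeas_mk; first by apply: measurable_funM.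
by apply: measurable_funD => //; apply: measurable_funM => //.
Qed.

Lemma measurable_sgr : measurable_fun setT (fun u : R => Num.sg u).
Proof.
have -> : (fun u : R => Num.sg u) =
    (fun u => \1_(`]0%R, +oo[%classic) u - \1_(`]-oo, 0%R[%classic) u).
  apply/funext => u; rewrite !indicE !mem_setE !in_itv /= andbT.
  case: (ltgtP 0 u) => [u0|u0|<-]; last by rewrite sgr0 subr0.
    by rewrite gtr0_sg // subr0.
  by rewrite ltr0_sg // sub0r.
by apply: measurable_funB; exact: measurable_indic.
Qed.

Lemma cmeas_dcontour : cmeas (fun u : R => dcontour u).
Proof.
apply: cmeas_mk => //; apply: measurable_funM => //.
exact: measurable_sgr.
Qed.

Lemma cmeas_ray s c : cmeas (fun u : R => ray s c u).
Proof. by apply: cmeas_mk; [apply: measurable_funM|apply: measurable_funD => //; apply: measurable_funM]. Qed.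

Section ray_int.
Context (c : R).

Let summand (phi : C -> C) u :=
  phi (ray 1 c u) * ray_dir 1 - phi (ray (-1) c u) * ray_dir (-1).

Lemma cmeas_summand phi : cmfun phi -> cmeas (summand phi).
Proof.
move=> mphi; apply: cmeasB; apply: cmeasM; try exact: cmeas_cst; apply: mphi; exact: cmeas_ray.
Qed.

Lemma nrm_summand phi M u : decays c phi M -> 0 <= u -> nrm (summand phi u) <= 4 * M * expR (- u).
Proof.
move=> le u0; apply: le_trans (nrmB _ _) _.
have s1 : (1 : R) ^+ 2 = 1 by rewrite expr1n.
have s2 : (-1 : R) ^+ 2 = 1 by rewrite sqrrN expr1n.
have b s : s ^+ 2 = 1 -> nrm (phi (ray s c u) * ray_dir s) <= 2 * (M * expR (- u)).
  move=> ss; apply: le_trans (nrmM _ _) _; rewrite mulrC.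
  by apply: ler_pM; rewrite ?nrm_ge0 ?nrm_ray_dir //; exact: le.
by have := b _ s1; have := b _ s2; lra.
Qed.

Lemma cintegrable_summand phi M : cmfun phi -> decays c phi M ->
  cintegrable `]0%R, +oo[ (summand phi).
Proof.
move=> mphi le.
apply: (dom_cintegrable _ (cmeas_summand mphi) (rintegrableZ (4 * M) _ (@rintegrable_expN R))) => //.
by move=> u /=; rewrite in_itv /= andbT => /ltW u0; exact: nrm_summand.
Qed.

Lemma nrm_ray_int phi M : cmfun phi -> decays c phi M -> nrm (ray_int c phi) <= 4 * M.
Proof.
move=> mphi le.
have iE := rintegrableZ (4 * M) (measurable_itv _) (@rintegrable_expN R).
have -> : 4 * M = \int[mu]_(u in `]0%R, +oo[) (4 * M * expR (- u)).
  by rewrite RintegralZl //; [rewrite Rintegral_expN mulr1|exact: rintegrable_expN].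
apply: nrm_cint_le => //; first exact: cintegrable_summand le.
by move=> u /=; rewrite in_itv /= andbT => /ltW u0; exact: nrm_summand.
Qed.

Lemma ray_intD phi psi M N : cmfun phi -> decays c phi M -> cmfun psi -> decays c psi N ->
  ray_int c (fun z => phi z + psi z) = ray_int c phi + ray_int c psi.
Proof.
move=> m1 l1 m2 l2; rewrite -cintD //; [|exact: cintegrable_summand l1|exact: cintegrable_summand l2].
by apply: eq_cint => u _; rewrite /summand; ring.
Qed.

Lemma ray_intZ phi M k : cmfun phi -> decays c phi M ->
  ray_int c (fun z => k * phi z) = k * ray_int c phi.
Proof.
move=> m1 l1; rewrite -cintZ //; last exact: cintegrable_summand l1.
by apply: eq_cint => u _; rewrite /summand; ring.
Qed.

Lemma eq_ray_int phi psi :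
  (forall s u, s ^+ 2 = 1 -> 0 <= u -> phi (ray s c u) = psi (ray s c u)) ->
  ray_int c phi = ray_int c psi.
Proof.
move=> e; apply: eq_cint => u /=; rewrite in_itv /= andbT => /ltW u0.
by rewrite !e // ?sqrrN expr1n.
Qed.

(** The negative half-line is folded onto the positive one; there [dcontour] is minus the outward
    direction of the left ray. The open half-line leaves out the vertex, where [Num.sg] is 0. *)
Lemma contour_intE phi M : cmfun phi -> decays c phi M -> contour_int c phi = ray_int c phi.
Proof.
move=> mphi le.
have s1 : (1 : R) ^+ 2 = 1 by rewrite expr1n.
have s2 : (-1 : R) ^+ 2 = 1 by rewrite sqrrN expr1n.
have mi : cmeas (fun u => phi (contour c u) * dcontour u).
  by apply: cmeasM; [apply: mphi; exact: cmeas_contour|exact: cmeas_dcontour].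
have bi u : nrm (phi (contour c u) * dcontour u) <= (2 * M) * expR (- `|u|).
  apply: le_trans (nrmM _ _) _; rewrite (_ : 2 * M * _ = M * expR (- `|u|) * 2); last by ring.
  have h0 := sqrt3_ge0; have h2 := sqrt3_le2.
  apply: ler_pM; rewrite ?nrm_ge0 //; last first.
    rewrite /nrm /= ger0_norm ?divr_ge0 // normrM normr_sg (ger0_norm (_ : 0 <= 2^-1)) //.
    by case: (u != 0) => /=; lra.
  case: (lerP 0 u) => u0.
    by rewrite contour_ray // ger0_norm // ; exact: le.
  have nu0 : 0 <= - u by rewrite oppr_ge0 ltW.
  by have := le _ _ s2 nu0; rewrite -contourN_ray // opprK ltr0_norm // opprK.
have posE u : 0 < u -> phi (contour c u) * dcontour u = phi (ray 1 c u) * ray_dir 1.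
  move=> u0; rewrite contour_ray ?ltW //; congr (_ * _); rewrite /dcontour /ray_dir gtr0_sg //.
  by congr (_ +i* _); ring.
have negE u : 0 < u -> phi (contour c (- u)) * dcontour (- u) = - (phi (ray (-1) c u) * ray_dir (-1)).
  move=> u0; rewrite contourN_ray ?ltW // -mulrN; congr (_ * _).
  rewrite /dcontour /ray_dir sgrN gtr0_sg //; apply: complexP => /=; ring.
rewrite /contour_int (cint_halves mi bi) -cintD //.
- apply: eq_cint => u /=; rewrite in_itv /= andbT => u0.
  by rewrite (posE _ u0) (negE _ u0) addrC.
- apply: (dom_cintegrable (G := fun u => 2 * M * expR (- u))) => //.
  + apply: (cmeas_comp mi); exact: measurable_reflection.
  + by apply: rintegrableZ => //; exact: rintegrable_expN.
  + by move=> u /=; rewrite in_itv /= andbT => u0; apply: le_trans (bi _) _; rewrite normrN gtr0_norm.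
- apply: (dom_cintegrable (G := fun u => 2 * M * expR (- u))) => //.
  + by apply: rintegrableZ => //; exact: rintegrable_expN.
  + by move=> u /=; rewrite in_itv /= andbT => u0; apply: le_trans (bi _) _; rewrite gtr0_norm.
Qed.

End ray_int.

End Contour.

(** * Decay of the Airy exponential along the rays *)

Section AiryExponential.
Variable R : realType.
Local Notation C := R[i].
Local Notation Re := (@complex.Re R).

Definition airy_exp (xi : R) (z : C) : C := cexp ('i * (z ^+ 3 / 3 + xi%:C * z)).

Lemma cmeas_airy_exp d (T : measurableType d) (x : T -> R) (g : T -> C) :
  measurable_fun setT x -> cmeas g -> cmeas (fun t => airy_exp (x t) (g t)).
Proof.
move=> mx mg; apply: cmeas_exp; apply: cmeasM; first exact: cmeas_cst.
apply: cmeasD; apply: cmeasM; [exact: cmeasX|exact: cmeas_cst|exact: cmeas_real|by []].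
Qed.

(** The directions [e^{i pi/6}] and [e^{5 i pi/6}] both have cube [i], so the cubic term contributes
    [- u^3 / 3]. The height [c] of the vertex contributes [- xi c], the source of all exponential
    weights below. *)
Lemma airy_exp_rate (s c u xi : R) : s ^+ 2 = 1 ->
  Re ('i * (ray s c u ^+ 3 / 3 + xi%:C * ray s c u)) =
  c ^+ 3 / 3 - xi * c + (- u ^+ 3 / 3 - c * u ^+ 2 / 2 + (c ^+ 2 - xi) * u / 2).
Proof.
move=> s2; have t2 := sqr_sqrt3 R; rewrite /ray; set p := s * _ * u.
have p2 : p ^+ 2 = 3 / 4 * u ^+ 2 by rewrite /p !exprMn s2 t2; field.
have -> : Re ('i * (((p +i* (c + u / 2)) ^+ 3) / 3 + xi%:C * (p +i* (c + u / 2)))) =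
  - (p ^+ 2 * (c + u / 2)) + (c + u / 2) ^+ 3 / 3 - xi * (c + u / 2).
  have -> : (3 : C)^-1 = (3^-1)%:C by rewrite fmorphV /= rmorph_nat.
  by rewrite !exprS expr0 /=; field.
by rewrite p2; field.
Qed.

Lemma cubic_decay (A1 A2 : R) : 0 <= A1 -> 0 <= A2 ->
  exists2 M, 0 <= M & forall u, 0 <= u ->
    expR (- u ^+ 3 / 3 + A1 * u ^+ 2 + A2 * u) <= M * expR (- u).
Proof.
(* For [u > U] one has [u^3 / 3 >= (A1 + A2 + 2) u^2] and [u^2 >= u], so the cubic term absorbs all
   others; for [u <= U] the other terms are at most their values at [U]. [B] includes the [u] moved
   over from the right-hand side. *)
move=> a1 a2; set U := 3 * (A1 + A2 + 2); set B := A2 + 1.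
have U0 : 3 <= U by rewrite /U; lra.
exists (expR (A1 * U ^+ 2 + B * U)); first exact: expR_ge0.
move=> u u0; rewrite -expRD ler_expR.
have [uU|Uu] := leP u U.
  have h2 : u ^+ 2 <= U ^+ 2 by rewrite lerXn2r // nnegrE; lra.
  have h3 : 0 <= u ^+ 3 by rewrite exprn_ge0.
  have h4 := ler_wpM2l a1 h2.
  have h5 : B * u <= B * U by rewrite ler_wpM2l // /B; lra.
  rewrite /B in h5 *; lra.
have h1 : u ^+ 2 * U <= u ^+ 2 * u by rewrite ler_wpM2l ?sqr_ge0 // ltW.
have h2 : u * 1 <= u * u by rewrite ler_wpM2l //; lra.
have h3 : 0 <= A1 * U ^+ 2 by rewrite mulr_ge0 // sqr_ge0.
have h4 : 0 <= B * U by rewrite mulr_ge0 // /B; lra.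
have h5 : B * (u * 1) <= B * (u * u) by rewrite ler_wpM2l // /B; lra.
rewrite /U in h1; rewrite /B in h5 h4.
have e3 : u ^+ 3 = u ^+ 2 * u by rewrite exprSr.
have e2 : u ^+ 2 = u * u by rewrite expr2.
rewrite /B; move: h3 h4; rewrite /U /B e3; rewrite e2 in h1 *; nra.
Qed.

(** For [xi >= - X] the term [- xi u / 2] of the exponent is at most [X u / 2], so that [xi]
    survives only in [expR (- (xi * c))]: the choice of the vertex prescribes decay or growth at
    infinity. *)
Lemma airy_exp_bound (a b X : R) (N : nat) (L : R) : 0 <= X -> 0 <= L ->
  exists2 M, 0 <= M & forall xi c s u, - X <= xi -> a < c -> c < b -> s ^+ 2 = 1 -> 0 <= u ->
    nrm (airy_exp xi (ray s c u)) * ((1 + u) ^+ N * expR (L * u)) <=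
    M * expR (- (xi * c)) * expR (- u).
Proof.
move=> X0 L0; set B := `|a| + `|b|.
have B0 : 0 <= B by rewrite addr_ge0.
have h1 : 0 <= B / 2 by rewrite divr_ge0.
(* The linear coefficient collects [(c^2 - xi) / 2], the polynomial factor through
   [(1 + u)^N <= e^{N u}], and the rate [L]. *)
have h2 : 0 <= (B ^+ 2 + X) / 2 + N%:R + L.
  by rewrite !addr_ge0 // ?divr_ge0 ?addr_ge0 // sqr_ge0.
have [M M0 MP] := cubic_decay h1 h2.
exists (2 * expR (B ^+ 3 / 3) * M).
  by rewrite mulr_ge0 // mulr_ge0 // expR_ge0.
move=> xi c s u Xxi ac cb s2 u0.
have cB : `|c| <= B.
  by rewrite ler_norml /B; have := ler_norm b; have := ler_norm (- a); rewrite normrN; have := normr_ge0 a; have := normr_ge0 b; lra.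
have c3 : c ^+ 3 <= B ^+ 3.
  by apply: le_trans (ler_norm _) _; rewrite normrX lerXn2r // nnegrE.
have c2 : c ^+ 2 <= B ^+ 2 by rewrite -(real_normK (num_real c)) lerXn2r // nnegrE.
have p1 : (1 + u) ^+ N <= expR (N%:R * u).
  by rewrite expRM_natl; apply: lerXn2r; rewrite ?nnegrE ?expR_ge0 ?expR_ge1Dx // addr_ge0.
have p2 : nrm (airy_exp xi (ray s c u)) <= 2 * expR (c ^+ 3 / 3 - xi * c +
   (- u ^+ 3 / 3 - c * u ^+ 2 / 2 + (c ^+ 2 - xi) * u / 2)).
  by apply: le_trans (nrm_cexp _) _; rewrite airy_exp_rate.
apply: (@le_trans _ _ (2 * expR (B ^+ 3 / 3) * expR (- (xi * c)) *
   expR (- u ^+ 3 / 3 + B / 2 * u ^+ 2 + ((B ^+ 2 + X) / 2 + N%:R + L) * u))); last first.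
  rewrite (_ : 2 * _ * M * _ * _ = 2 * expR (B ^+ 3 / 3) * expR (- (xi * c)) * (M * expR (- u))); last by ring.
  by rewrite ler_wpM2l ?MP // !mulr_ge0 ?expR_ge0.
apply: le_trans (ler_pM (nrm_ge0 _) _ p2 (ler_wpM2r (expR_ge0 _) p1)) _.
  by rewrite mulr_ge0 ?expR_ge0 // exprn_ge0 // addr_ge0.
rewrite -expRD -!mulrA -!expRD ler_wpM2l // ler_expR.
have q1 : - (c * u ^+ 2) <= B * u ^+ 2.
  by rewrite -mulNr ler_wpM2r ?sqr_ge0 //; move: cB; rewrite ler_norml; lra.
have q2 : (c ^+ 2 - xi) * u <= (B ^+ 2 + X) * u by rewrite ler_wpM2r //; lra.
lra.
Qed.

Lemma cexp_taylor1 (v : C) : nrm (cexp v - 1) <= 4 * nrm v * expR (nrm v).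
Proof.
have := @cMVT R (fun t => cexp (t%:C * v)) (fun t => v * cexp (t%:C * v)) 0 1 (2 * nrm v * expR (nrm v)).
rewrite mul1r mul0r cexp0 subr0 mulr1 => H.
apply: le_trans (H _ _ _) _ => //; last by lra.
  move=> u _ _; apply: cder_exp.
  by apply: cder_eq (cderM (cder_real u) (cder_cst v u)) _; rewrite mul1r mulr0 addr0.
move=> u u0 u1; apply: le_trans (nrmM _ _) _.
rewrite mulrAC mulrC ler_wpM2r ?nrm_ge0 //; apply: le_trans (nrm_cexp _) _.
rewrite ler_wpM2l // ler_expR.
apply: le_trans (ler_norm _) _; apply: le_trans (Re_le_nrm _) _.
by rewrite nrmMr ger0_norm // -[leRHS]mul1r ler_wpM2r ?nrm_ge0.
Qed.

Lemma cexp_taylor2 (v : C) : nrm (cexp v - 1 - v) <= 8 * nrm v ^+ 2 * expR (nrm v).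
Proof.
have := @cMVT R (fun t => cexp (t%:C * v) - 1 - t%:C * v) (fun t => v * (cexp (t%:C * v) - 1)) 0 1
  (4 * nrm v ^+ 2 * expR (nrm v)).
rewrite mul1r mul0r cexp0 subrr !subr0 mulr1 => H.
apply: le_trans (H _ _ _) _ => //; last by lra.
  move=> u _ _.
  have h : cder (fun t => t%:C * v) u v.
    by apply: cder_eq (cderM (cder_real u) (cder_cst v u)) _; rewrite mul1r mulr0 addr0.
  apply: cder_eq (cderB (cderB (cder_exp h) (cder_cst 1 u)) h) _; ring.
move=> u u0 u1; apply: le_trans (nrmM _ _) _.
have n0 := nrm_ge0 v.
have le : nrm (u%:C * v) <= nrm v by rewrite nrmMr ger0_norm // -[leRHS]mul1r ler_wpM2r.
rewrite (_ : 4 * _ * _ = nrm v * (4 * nrm v * expR (nrm v))); last by ring.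
rewrite ler_wpM2l //; apply: le_trans (cexp_taylor1 _) _.
apply: ler_pM; rewrite ?expR_ge0 ?ler_expR // ?mulr_ge0 ?nrm_ge0 //.
by rewrite ler_wpM2l.
Qed.

End AiryExponential.

(** * Contour integrals depending on [xi] *)

Section ContourFamilies.
Variable R : realType.
Local Notation C := R[i].
Implicit Types (r q phi psi f g : C -> C).

(** Complex differentiability at [z] with derivative [phi1 z], encoded as the chain rule along every
    differentiable real curve through [z]. The two curves that matter are the ray itself and the
    vertical motion of its vertex. *)
Definition holo phi phi1 (z : C) :=
  forall (g : R -> C) u l, g u = z -> cder g u l -> cder (fun v => phi (g v)) u (l * phi1 z).

Lemma holo_ext phi phi1 phi2 z : holo phi phi1 z -> phi1 z = phi2 z -> holo phi phi2 z.
Proof. by move=> h e g u l gz hg; rewrite -e; exact: h. Qed.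

Lemma holo_cst k z : holo (fun=> k) (fun=> 0) z.
Proof. by move=> g u l gz hg; rewrite mulr0; exact: cder_cst. Qed.

Lemma holo_id z : holo id (fun=> 1) z.
Proof. by move=> g u l gz hg; rewrite mulr1. Qed.

Lemma holoD f (f1 : C -> C) g (g1 : C -> C) z : holo f f1 z -> holo g g1 z ->
  holo (fun z => f z + g z) (fun z => f1 z + g1 z) z.
Proof.
by move=> hf hg c u l cz hc; rewrite mulrDr; apply: cderD; [exact: hf|exact: hg].
Qed.

Lemma holoM f (f1 : C -> C) g (g1 : C -> C) z : holo f f1 z -> holo g g1 z ->
  holo (fun z => f z * g z) (fun z => f1 z * g z + f z * g1 z) z.
Proof.
move=> hf hg c u l cz hc.
by apply: cder_eq (cderM (hf _ _ _ cz hc) (hg _ _ _ cz hc)) _; rewrite cz; ring.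
Qed.

Lemma holoX f f1 z n : holo f f1 z ->
  holo (fun z => f z ^+ n) (fun z => n%:R * f z ^+ n.-1 * f1 z) z.
Proof.
by move=> hf c u l cz hc; apply: cder_eq (cderX n (hf _ _ _ cz hc)) _; rewrite cz; ring.
Qed.

Lemma holo_inv f f1 z : f z != 0 -> holo f f1 z ->
  holo (fun z => (f z)^-1) (fun z => - f1 z / f z ^+ 2) z.
Proof.
move=> f0 hf c u l cz hc.
apply: cder_eq (cder_inv _ (hf _ _ _ cz hc)) _; first by rewrite cz.
by rewrite cz !mulrA mulrN.
Qed.

Lemma holo_exp f f1 z : holo f f1 z -> holo (fun z => cexp (f z)) (fun z => f1 z * cexp (f z)) z.
Proof.
move=> hf c u l cz hc.
by apply: cder_eq (cder_exp (hf _ _ _ cz hc)) _; rewrite cz; ring.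
Qed.

Lemma holo_airy_exp xi z :
  holo (airy_exp xi) (fun z => 'i * (z ^+ 2 + xi%:C) * airy_exp xi z) z.
Proof.
have h1 := holoX 3 (@holo_id z).
have h2 := holoM h1 (@holo_cst 3^-1 z).
have h3 := holoM (@holo_cst xi%:C z) (@holo_id z).
have h4 := holoM (@holo_cst 'i%R z) (holoD h2 h3).
apply: holo_ext (holo_exp h4) _; rewrite /airy_exp; congr (_ * _).
by field.
Qed.

(** Uniform over all vertices between [a] and [b], because the vertex will be moved inside this
    strip. *)
Definition polybounded (a b : R) r := exists P N, 0 <= P /\
  forall s c u, a < c -> c < b -> s ^+ 2 = 1 -> 0 <= u -> nrm (r (ray s c u)) <= P * (1 + u) ^+ N.

Lemma polybounded_cst a b k : polybounded a b (fun=> k).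
Proof. by exists (nrm k), 0%N; rewrite nrm_ge0; split => // *; rewrite expr0 mulr1. Qed.

Lemma polybounded_id a b : polybounded a b id.
Proof.
exists (`|a| + `|b| + 2), 1%N; split; first by rewrite !addr_ge0.
move=> s c u ac cb s2 u0; apply: le_trans (nrm_ray _ s2 u0) _; rewrite expr1.
have h : `|c| <= `|a| + `|b|.
  by rewrite ler_norml; have := ler_norm b; have := ler_norm (- a); rewrite normrN; have := normr_ge0 a; have := normr_ge0 b; lra.
have := mulr_ge0 (normr_ge0 a) u0; have := mulr_ge0 (normr_ge0 b) u0; lra.
Qed.

Lemma polyboundedM a b f g : polybounded a b f -> polybounded a b g ->
  polybounded a b (fun z => f z * g z).
Proof.
move=> [P [N [P0 hf]]] [Q [K [Q0 hg]]]; exists (P * Q), (N + K)%N; split; first exact: mulr_ge0.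
move=> s c u ac cb s2 u0; apply: le_trans (nrmM _ _) _.
rewrite exprD mulrACA; apply: ler_pM; rewrite ?nrm_ge0 //; [exact: hf|exact: hg].
Qed.

Lemma polyboundedD a b f g : polybounded a b f -> polybounded a b g ->
  polybounded a b (fun z => f z + g z).
Proof.
move=> [P [N [P0 hf]]] [Q [K [Q0 hg]]]; exists (P + Q), (N + K)%N; split; first exact: addr_ge0.
move=> s c u ac cb s2 u0; apply: le_trans (nrmD _ _) _.
rewrite mulrDl; apply: lerD.
  apply: le_trans (hf _ _ _ ac cb s2 u0) _; rewrite ler_wpM2l // ler_weXn2l ?leq_addr //; lra.
apply: le_trans (hg _ _ _ ac cb s2 u0) _; rewrite ler_wpM2l // ler_weXn2l ?leq_addl //; lra.
Qed.

Lemma polyboundedX a b f n : polybounded a b f -> polybounded a b (fun z => f z ^+ n).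
Proof.
move=> h; elim: n => [|n IH].
  by under eq_fun do rewrite expr0; exact: polybounded_cst.
by under eq_fun do rewrite exprS; exact: polyboundedM.
Qed.

(* The factor expR (nrm z) leaves room for shifting xi by at most 1. *)
Lemma polybounded_airy_exp a b r X : polybounded a b r -> 0 <= X ->
  exists2 M, 0 <= M & forall xi c s u, - X <= xi -> a < c -> c < b -> s ^+ 2 = 1 -> 0 <= u ->
    nrm (airy_exp xi (ray s c u)) * nrm (r (ray s c u)) * expR (nrm (ray s c u)) <=
    M * expR (- (xi * c)) * expR (- u).
Proof.
move=> [P [N [P0 hr]]] X0.
(* By [nrm_ray] a point of the ray has norm at most [|c| + 2 u], hence the rate 2 for
   [expR (nrm z)]. *)
have L0 : 0 <= 2 :> R by [].
have [M M0 hM] := airy_exp_bound a b N X0 L0.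
exists (P * expR (`|a| + `|b|) * M); first by rewrite !mulr_ge0 // expR_ge0.
move=> xi c s u Xxi ac cb s2 u0.
have e1 : expR (nrm (ray s c u)) <= expR (`|a| + `|b|) * expR (2 * u).
  rewrite -expRD ler_expR; apply: le_trans (nrm_ray _ s2 u0) _; rewrite lerD2r.
  by rewrite ler_norml; have := ler_norm b; have := ler_norm (- a); rewrite normrN; have := normr_ge0 a; have := normr_ge0 b; lra.
have e2 := hr _ _ _ ac cb s2 u0.
apply: (@le_trans _ _ (P * expR (`|a| + `|b|) *
   (nrm (airy_exp xi (ray s c u)) * ((1 + u) ^+ N * expR (2 * u))))).
  rewrite -mulrA (_ : P * _ * (_ * _) = nrm (airy_exp xi (ray s c u)) *
    ((P * (1 + u) ^+ N) * (expR (`|a| + `|b|) * expR (2 * u)))); last by ring.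
  rewrite ler_wpM2l ?nrm_ge0 //; apply: ler_pM; rewrite ?nrm_ge0 ?expR_ge0 //.
rewrite [X in _ <= X](_ : _ = P * expR (`|a| + `|b|) *
  (M * expR (- (xi * c)) * expR (- u))); last by ring.
by rewrite ler_wpM2l ?mulr_ge0 ?expR_ge0 //; exact: hM.
Qed.

Lemma polybounded_decays a b r X : polybounded a b r -> 0 <= X ->
  exists2 M, 0 <= M & forall xi c, - X <= xi -> a < c -> c < b ->
    decays c (fun z => airy_exp xi z * r z) (M * expR (- (xi * c))).
Proof.
move=> hr X0; have [M M0 hM] := polybounded_airy_exp hr X0; exists M => // xi c Xxi ac cb s u s2 u0.
apply: le_trans (hM _ _ _ _ Xxi ac cb s2 u0); apply: le_trans (nrmM _ _) _.
by rewrite -[leLHS]mulr1 ler_wpM2l ?mulr_ge0 ?nrm_ge0 // -expR0 ler_expR nrm_ge0.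
Qed.

Lemma cmfunM f g : cmfun f -> cmfun g -> cmfun (fun z => f z * g z).
Proof. by move=> hf hg d T k mk; apply: cmeasM; [exact: hf|exact: hg]. Qed.

Lemma cmfunD f g : cmfun f -> cmfun g -> cmfun (fun z => f z + g z).
Proof. by move=> hf hg d T k mk; apply: cmeasD; [exact: hf|exact: hg]. Qed.

Lemma cmfun_cst k : cmfun (fun _ : C => k).
Proof. by move=> d T g mg; exact: cmeas_cst. Qed.

Lemma cmfun_id : cmfun (fun z : C => z).
Proof. by []. Qed.

Lemma cmfunX f n : cmfun f -> cmfun (fun z => f z ^+ n).
Proof. by move=> hf d T k mk; apply: cmeasX; exact: hf. Qed.

Lemma cmfun_airy_exp (xi : R) : cmfun (airy_exp xi).
Proof. by move=> d T k mk; apply: cmeas_airy_exp. Qed.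

(** Common form of [Ai] and its derivatives, [C_w], [s^(m)] and [t^(m)]: only the amplitude [r]
    changes, and differentiation in [xi] multiplies [r] by ['i * z]. *)
Definition airy_int (c : R) r (xi : R) : C :=
  (2 * pi)^-1%:C * ray_int c (fun z => airy_exp xi z * r z).

Let cpi : R := `|(2 * pi)^-1|.

Lemma airy_int_bound a b r X : cmfun r -> polybounded a b r -> 0 <= X ->
  exists2 M, 0 <= M & forall xi c, - X <= xi -> a < c -> c < b ->
    nrm (airy_int c r xi) <= M * expR (- (xi * c)).
Proof.
move=> mr hr X0; have [M M0 hM] := polybounded_decays hr X0.
exists (cpi * 4 * M); first by rewrite !mulr_ge0 // normr_ge0.
move=> xi c Xxi ac cb; rewrite /airy_int nrmMr -!mulrA ler_wpM2l // mulrA -mulrA.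
by apply: nrm_ray_int; [exact: cmfunM (cmfun_airy_exp _) _|exact: hM].
Qed.

Lemma airy_expD xi d (z : C) : airy_exp (xi + d) z = airy_exp xi z * cexp (d%:C * ('i * z)).
Proof. by rewrite /airy_exp -cexpD; congr cexp; rewrite rmorphD /=; ring. Qed.

Lemma decays_le c phi M M' : decays c phi M -> M <= M' -> decays c phi M'.
Proof. by move=> h le s u s2 u0; apply: le_trans (h s u s2 u0) _; rewrite ler_wpM2r ?expR_ge0. Qed.

(** Shifting [xi] by [d] multiplies the integrand by [cexp (d%:C * ('i * z))], whose second-order
    remainder is integrated. The remainder keeps the weight [e^{-xi c}], so it is small in the
    weighted norms and not merely at each point. *)
Lemma airy_int_taylor a b r X : cmfun r -> polybounded a b r -> 0 <= X ->
  exists2 M, 0 <= M & forall xi c d, - X <= xi -> a < c -> c < b -> `|d| <= 1 ->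
    nrm (airy_int c r (xi + d) - airy_int c r xi - d%:C * airy_int c (fun z => 'i * z * r z) xi)
    <= M * d ^+ 2 * expR (- (xi * c)).
Proof.
move=> mr hr X0.
have pid := @polybounded_id a b.
have [M M0 hM] := polybounded_airy_exp (polyboundedM (polyboundedX 2 pid) hr) X0.
have X1 : 0 <= X + 1 by rewrite addr_ge0.
have [M1 _ hM1] := polybounded_decays hr X1.
have hir : polybounded a b (fun z => 'i * z * r z).
  exact: polyboundedM (polyboundedM (polybounded_cst _ _ _) pid) hr.
have [M2 _ hM2] := polybounded_decays hir X1.
(* The factor [nrm z ^+ 2] of the Taylor remainder is treated as part of the amplitude; its factor
   [expR (nrm z)] is provided for by [polybounded_airy_exp]. *)
have hq : polybounded a b (fun z => (nrm z)%:C ^+ 2 * r z).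
  have [P [N [P0 h]]] := pid.
  apply: polyboundedM hr; apply: polyboundedX; exists P, N; split => // *.
  by rewrite nrm_real ger0_norm ?nrm_ge0 //; exact: h.
have {M M0 hM}[M M0 hM] := polybounded_airy_exp hq X0.
exists (cpi * 4 * (8 * M)); first by rewrite !mulr_ge0 // normr_ge0.
move=> xi c d Xxi ac cb d1.
have Xxi1 : - (X + 1) <= xi by lra.
have Xxid : - (X + 1) <= xi + d by move: d1; rewrite ler_norml; lra.
have mir : cmfun (fun z => 'i * z * r z) by apply: cmfunM => //; apply: cmfunM => //; exact: cmfun_cst.
have A1 := cmfunM (@cmfun_airy_exp (xi + d)) mr.
have A2 := cmfunM (@cmfun_airy_exp xi) mr.
have A3 := cmfunM (@cmfun_airy_exp xi) mir.
have -> : airy_int c r (xi + d) - airy_int c r xi - d%:C * airy_int c (fun z => 'i * z * r z) xi =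
  (2 * pi)^-1%:C * ray_int c (fun z => airy_exp xi z * r z * (cexp (d%:C * ('i * z)) - 1 - d%:C * ('i * z))).
  have -> : ray_int c (fun z => airy_exp xi z * r z * (cexp (d%:C * ('i * z)) - 1 - d%:C * ('i * z))) =
    ray_int c (fun z => airy_exp (xi + d) z * r z + ((-1) * (airy_exp xi z * r z) +
      (- d%:C) * (airy_exp xi z * ('i * z * r z)))).
    by apply: eq_ray_int => s u _ _; rewrite airy_expD; ring.
  have decZ k phi N : decays c phi N -> decays c (fun z => k * phi z) (nrm k * N).
    move=> h s u s2 u0; apply: le_trans (nrmM _ _) _; rewrite -mulrA.
    by rewrite ler_wpM2l ?nrm_ge0 //; exact: h.
  have decD phi psi N K : decays c phi N -> decays c psi K -> decays c (fun z => phi z + psi z) (N + K).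
    move=> h h' s u s2 u0; apply: le_trans (nrmD _ _) _; rewrite mulrDl.
    by apply: lerD; [exact: h|exact: h'].
  have B1 := hM1 _ _ Xxid ac cb; have B2 := hM1 _ _ Xxi1 ac cb; have B3 := hM2 _ _ Xxi1 ac cb.
  have Am k phi : cmfun phi -> cmfun (fun z => k * phi z) by move=> h; apply: cmfunM => //; exact: cmfun_cst.
  rewrite (ray_intD A1 B1 (cmfunD (Am _ _ A2) (Am _ _ A3)) (decD _ _ _ _ (decZ _ _ _ B2) (decZ _ _ _ B3))).
  rewrite (ray_intD (Am _ _ A2) (decZ _ _ _ B2) (Am _ _ A3) (decZ _ _ _ B3)).
  by rewrite (ray_intZ _ A2 B2) (ray_intZ _ A3 B3) /airy_int; ring.
rewrite nrmMr -!mulrA ler_wpM2l // mulrA -mulrA.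
have -> : 4 * (8 * (M * (d * (d * expR (- (xi * c)))))) = 4 * (8 * (d ^+ 2 * (M * expR (- (xi * c))))) by ring.
apply: nrm_ray_int.
  apply: cmfunM A2 _ => dd T k mk.
  have mi : cmeas (fun t => d%:C * ('i * k t)).
    by apply: cmeasM; [exact: cmeas_cst|apply: cmeasM => //; exact: cmeas_cst].
  by apply: cmeasB => //; apply: cmeasB; [exact: cmeas_exp|exact: cmeas_cst].
move=> s u s2 u0.
have := hM _ _ _ _ Xxi ac cb s2 u0.
set z := ray s c u; set e := airy_exp xi z => h.
apply: le_trans (nrmM _ _) _.
have n0 := nrm_ge0 z.
have nv : nrm (d%:C * ('i * z)) = `|d| * nrm z by rewrite nrmMr nrmMi.
apply: le_trans (ler_pM (nrm_ge0 _) (nrm_ge0 _) (nrmM _ _) (cexp_taylor2 _)) _.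
rewrite nv.
have E : expR (`|d| * nrm z) <= expR (nrm z) by rewrite ler_expR -[leRHS]mul1r ler_wpM2r.
have : nrm e * nrm (r z) * (8 * (`|d| * nrm z) ^+ 2 * expR (`|d| * nrm z)) <=
       nrm e * nrm (r z) * (8 * (`|d| * nrm z) ^+ 2 * expR (nrm z)).
  by rewrite ler_wpM2l ?mulr_ge0 ?nrm_ge0 // ler_wpM2l // mulr_ge0 // exprn_ge0 // mulr_ge0.
move=> /le_trans; apply.
rewrite exprMn real_normK ?num_real //.
have q : nrm ((nrm z)%:C ^+ 2 * r z) = nrm z ^+ 2 * nrm (r z).
  by rewrite -rmorphXn nrmMr ger0_norm // exprn_ge0.
rewrite q in h.
have d0 : 0 <= 8 * d ^+ 2 by rewrite mulr_ge0 // sqr_ge0.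
have := ler_wpM2l d0 h.
rewrite -/e; move=> h'; apply: le_trans (le_trans _ h') _.
  by rewrite le_eqVlt; apply/orP; left; apply/eqP; ring.
by rewrite le_eqVlt; apply/orP; left; apply/eqP; ring.
Qed.

Lemma cmeas_airy_int c r : cmfun r -> cmeas (airy_int c r).
Proof.
move=> mr; apply: cmeasM; first exact: cmeas_cst.
apply: (@cmeas_cint _ _ _ _ (fun p : R * R =>
  airy_exp p.1 (ray 1 c p.2) * r (ray 1 c p.2) * ray_dir 1 -
  airy_exp p.1 (ray (-1) c p.2) * r (ray (-1) c p.2) * ray_dir (-1))) => //.
have mray s : cmeas (fun p : R * R => ray s c p.2).
  by apply: (cmeas_comp (cmeas_ray s c)).
apply: cmeasB; apply: cmeasM; try exact: cmeas_cst; apply: cmeasM; try exact: mr;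
  by apply: cmeas_airy_exp.
Qed.

Lemma airy_intD a b c r q xi : cmfun r -> polybounded a b r -> cmfun q -> polybounded a b q ->
  a < c -> c < b -> airy_int c (fun z => r z + q z) xi = airy_int c r xi + airy_int c q xi.
Proof.
move=> mr hr mq hq ac cb; rewrite /airy_int -mulrDr; congr (_ * _).
have X0 : 0 <= `|xi| by [].
have Xx : - `|xi| <= xi by rewrite lerNl -normrN ler_norm.
have [M1 _ h1] := polybounded_decays hr X0.
have [M2 _ h2] := polybounded_decays hq X0.
rewrite -(ray_intD (cmfunM (@cmfun_airy_exp xi) mr) (h1 _ _ Xx ac cb) (cmfunM (@cmfun_airy_exp xi) mq) (h2 _ _ Xx ac cb)).
by apply: eq_ray_int => s u _ _; rewrite mulrDr.
Qed.

Lemma airy_intZ a b c r k xi : cmfun r -> polybounded a b r ->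
  a < c -> c < b -> airy_int c (fun z => k * r z) xi = k * airy_int c r xi.
Proof.
move=> mr hr ac cb; rewrite /airy_int mulrCA; congr (_ * _).
have X0 : 0 <= `|xi| by [].
have Xx : - `|xi| <= xi by rewrite lerNl -normrN ler_norm.
have [M1 _ h1] := polybounded_decays hr X0.
rewrite -(ray_intZ k (cmfunM (@cmfun_airy_exp xi) mr) (h1 _ _ Xx ac cb)).
by apply: eq_ray_int => s u _ _; rewrite mulrCA.
Qed.

Lemma eq_airy_int c r q xi :
  (forall s u, s ^+ 2 = 1 -> 0 <= u -> r (ray s c u) = q (ray s c u)) ->
  airy_int c r xi = airy_int c q xi.
Proof. by move=> e; congr (_ * _); apply: eq_ray_int => s u s2 u0; rewrite e. Qed.

End ContourFamilies.

(** * Independence of the vertex *)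

Section ContourShift.
Variable R : realType.
Local Notation C := R[i].
Local Notation Re := (@complex.Re R).
Local Notation Im := (@complex.Im R).
Local Notation mu := (@lebesgue_measure R).
Implicit Types (r q phi psi f g : C -> C).

Definition holo_strip (a b : R) phi phi1 := forall s c u,
  a < c -> c < b -> s ^+ 2 = 1 -> 0 <= u -> holo phi phi1 (ray s c u).

(** [r1] and [r2] are the first two derivatives of [r]. The second one carries no bound: it makes
    the integrand built from [r1] continuous for the fundamental theorem. *)
Definition admissible (a b : R) r := exists r1 r2,
  [/\ cmfun r, cmfun r1, polybounded a b r, polybounded a b r1 &
      holo_strip a b r r1 /\ holo_strip a b r1 r2].

Lemma admissible_meas a b r : admissible a b r -> cmfun r.
Proof. by move=> [r1 [r2 []]]. Qed.

Lemma admissible_bounded a b r : admissible a b r -> polybounded a b r.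
Proof. by move=> [r1 [r2 []]]. Qed.

Lemma admissible_cst a b k : admissible a b (fun=> k).
Proof.
exists (fun=> 0), (fun=> 0); split; try exact: cmfun_cst; try exact: polybounded_cst.
by split => s c u *; exact: holo_cst.
Qed.

Lemma admissible_id a b : admissible a b id.
Proof.
exists (fun=> 1), (fun=> 0); split; try exact: cmfun_cst; try exact: polybounded_cst; try exact: polybounded_id.
- exact: cmfun_id.
- by split => s c u *; [exact: holo_id|exact: holo_cst].
Qed.

Lemma admissibleM a b f g : admissible a b f -> admissible a b g ->
  admissible a b (fun z => f z * g z).
Proof.
move=> [f1 [f2 [mf mf1 bf bf1 [hf hf1]]]] [g1 [g2 [mg mg1 bg bg1 [hg hg1]]]].
exists (fun z => f1 z * g z + f z * g1 z),
  (fun z => (f2 z * g z + f1 z * g1 z) + (f1 z * g1 z + f z * g2 z)); split.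
- exact: cmfunM.
- by apply: cmfunD; exact: cmfunM.
- exact: polyboundedM.
- by apply: polyboundedD; exact: polyboundedM.
split => s c u ac cb s2 u0.
  exact: holoM (hf _ _ _ ac cb s2 u0) (hg _ _ _ ac cb s2 u0).
have H := holoM (hf1 _ _ _ ac cb s2 u0) (hg _ _ _ ac cb s2 u0).
have K := holoM (hf _ _ _ ac cb s2 u0) (hg1 _ _ _ ac cb s2 u0).
exact: holoD H K.
Qed.

Lemma admissibleX a b f n : admissible a b f -> admissible a b (fun z => f z ^+ n).
Proof.
move=> h; elim: n => [|n IH].
  by under eq_fun do rewrite expr0; exact: admissible_cst.
by under eq_fun do rewrite exprS; exact: admissibleM.
Qed.

Lemma admissible_prod a b (I : Type) (l : seq I) (F : I -> C -> C) :
  (forall i, admissible a b (F i)) -> admissible a b (fun z => \prod_(i <- l) F i z).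
Proof.
move=> h; elim: l => [|i l IH].
  by under eq_fun do rewrite big_nil; exact: admissible_cst.
by under eq_fun do rewrite big_cons; exact: admissibleM.
Qed.

(** The contour with vertex [i c] has height [c + |x| / sqrt 3] over the abscissa [x], and the pole
    [i w] has abscissa [- Im w] and height [Re w]. So this is the height of the vertex for which the
    contour passes through the pole. *)
Definition pole_height (w : C) : R := Re w - `|Im w| / Num.sqrt 3.

(** The contour has slope [1 / sqrt 3 <= 1], so in the l1 norm a sideways displacement costs at
    least the height gained along the contour: the vertical gap [d] bounds the distance from
    below. *)
Lemma pole_gap (w : C) s c u d : c + d <= pole_height w -> 0 <= d -> s ^+ 2 = 1 -> 0 <= u ->
  d <= nrm (w + 'i * ray s c u).
Proof.
move=> cd d0 s2 u0; rewrite /nrm ReD ImD ReM ImM /= !mul0r !mul1r sub0r add0r.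
set t := Num.sqrt 3 / 2 * u.
have h0 := sqrt3_gt0 R; have h2 := sqr_sqrt3 R.
have q0 : 0 < (Num.sqrt 3 : R)^-1 by rewrite invr_gt0.
have q1 : (Num.sqrt 3 : R)^-1 <= 1.
  by rewrite invf_le1 // -(@ler_pXn2r _ 2) ?nnegrE ?ltW // h2; lra.
have ut : u / 2 = t * (Num.sqrt 3)^-1 by rewrite /t; field; rewrite gt_eqF.
have t0 : 0 <= t by rewrite /t !mulr_ge0 // ltW.
have B : t - `|Im w| <= `|Im w + s * (Num.sqrt 3 / 2) * u|.
  have tE : t = `|s * (Num.sqrt 3 / 2) * u|.
    by rewrite -mulrA normrM norm_of_sqr1 // mul1r ger0_norm.
  have := lerB_dist (s * (Num.sqrt 3 / 2) * u) (- Im w).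
  by rewrite opprK normrN -tE addrC [in leRHS]addrC addrC.
have A : Re w - (c + u / 2) <= `|Re w - (c + u / 2)| by exact: ler_norm.
rewrite /pole_height in cd; set iv := (Num.sqrt 3)^-1 in cd ut q0 q1.
have B0 := normr_ge0 (Im w + s * (Num.sqrt 3 / 2) * u).
have [h|h] := leP 0 (t - `|Im w|).
  have := ler_wpM2l h q1; rewrite ut in A *; lra.
have h' : 0 <= `|Im w| - t by lra.
have := mulr_ge0 h' (ltW q0); rewrite ut in A *; lra.
Qed.

Lemma nrmV_le (z : C) d : 0 < d -> d <= nrm z -> nrm z^-1 <= 2 / d.
Proof.
move=> d0 dz; have z0 : z != 0 by apply: contraTneq dz => ->; rewrite nrm0 -ltNge.
apply: le_trans (nrmV z0) _; rewrite ler_wpM2l // lef_pV2 ?posrE //; lra.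
Qed.

Definition inv_lin (w z : C) : C := (w + 'i * z)^-1.

Lemma nrm_inv_lin (w : C) s c u d : c + d <= pole_height w -> 0 < d -> s ^+ 2 = 1 -> 0 <= u ->
  nrm (inv_lin w (ray s c u)) <= 2 / d.
Proof. by move=> cd d0 s2 u0; apply: nrmV_le => //; apply: pole_gap => //; exact: ltW. Qed.

Lemma cmfun_inv_lin w : cmfun (inv_lin w).
Proof.
move=> d T g mg; apply: cmeas_inv; apply: cmeasD; first exact: cmeas_cst.
by apply: cmeasM => //; exact: cmeas_cst.
Qed.

Lemma polybounded_inv_lin a b d w : b + d <= pole_height w -> 0 < d ->
  polybounded a b (inv_lin w).
Proof.
move=> bd d0; exists (2 / d), 0%N; split; first by rewrite divr_ge0 // ltW.
move=> s c u ac cb s2 u0; rewrite expr0 mulr1; apply: nrm_inv_lin => //; lra.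
Qed.

Lemma holo_inv_lin (w z : C) : w + 'i * z != 0 -> holo (inv_lin w) (fun z => - 'i%R * inv_lin w z ^+ 2) z.
Proof.
move=> h.
have h1 := holoD (@holo_cst R w z) (holoM (@holo_cst R 'i%R z) (@holo_id R z)).
apply: holo_ext (holo_inv (f := fun z => w + 'i * z) h h1) _.
by rewrite /inv_lin exprVn; congr (_ * _); ring.
Qed.

Lemma admissible_inv_lin a b d w : b + d <= pole_height w -> 0 < d ->
  admissible a b (inv_lin w).
Proof.
move=> bd d0.
have nz s c u : a < c -> c < b -> s ^+ 2 = 1 -> 0 <= u -> w + 'i * ray s c u != 0.
  move=> ac cb s2 u0; have cd : c + d <= pole_height w by lra.
  have := pole_gap cd (ltW d0) s2 u0; apply: contraTneq => ->; by rewrite nrm0 -ltNge.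
have pb := polybounded_inv_lin a bd d0; have mi := cmfun_inv_lin w.
exists (fun z => - 'i%R * inv_lin w z ^+ 2),
  (fun z => 0 * inv_lin w z ^+ 2 + - 'i%R * (2%:R * inv_lin w z ^+ 1 * (- 'i%R * inv_lin w z ^+ 2))).
split => //.
- by apply: cmfunM; [exact: cmfun_cst|exact: cmfunX].
- by apply: polyboundedM; [exact: polybounded_cst|exact: polyboundedX].
split => s c u ac cb s2 u0; have h := holo_inv_lin (nz _ _ _ ac cb s2 u0); first exact: h.
exact: holoM (@holo_cst R (- 'i%R) _) (holoX 2 h).
Qed.

Section shift.
Context (a b : R) (phi phi1 phi2 : C -> C) (M : R).
Hypotheses (mphi : cmfun phi) (mphi1 : cmfun phi1) (M0 : 0 <= M).
Hypothesis dphi : forall c, a < c -> c < b -> decays c phi M.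
Hypothesis dphi1 : forall c, a < c -> c < b -> decays c phi1 M.
Hypothesis hphi : holo_strip a b phi phi1.
Hypothesis hphi1 : holo_strip a b phi1 phi2.

Let cder_ray_u (s c u : R) : cder (fun u => ray s c u) u (ray_dir s).
Proof.
split => /=.
  apply: is_derive_eq (is_deriveZ (s * (Num.sqrt 3 / 2)) (@is_derive_id _ _ u 1)) _.
  by rewrite /GRing.scale /= mulr1.
under eq_fun do rewrite mulrC.
apply: is_derive_eq (is_deriveD (@is_derive_cst _ _ _ c u 1) (is_deriveZ 2^-1 (@is_derive_id _ _ u 1))) _.
by rewrite /GRing.scale /= mulr1 add0r.
Qed.

Let cder_ray_c (s c u : R) : cder (fun c => ray s c u) c 'i%R.
Proof.
split => /=; first exact: is_derive_cst.
apply: is_derive_eq (is_deriveD (@is_derive_id _ _ c 1) (@is_derive_cst _ _ _ (u / 2) c 1)) _.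
by rewrite addr0.
Qed.

Let ray_FTC s c : a < c -> c < b -> s ^+ 2 = 1 ->
  cint `]0%R, +oo[ (fun u => ray_dir s * phi1 (ray s c u)) = - phi (ray s c 0).
Proof.
move=> ac cb s2.
apply: (@cint_FTCy _ (fun u => phi (ray s c u)) _ (2 * M)).
- by move=> u u0; exact: (hphi ac cb s2 u0 erefl (cder_ray_u s c u)).
- move=> u u0; eexists; apply: cderZ.
  exact: (hphi1 ac cb s2 u0 erefl (cder_ray_u s c u)).
- move=> u u0; apply: le_trans (dphi ac cb s2 u0) _.
  by have := mulr_ge0 M0 (expR_ge0 (- u)); lra.
- move=> u u0; apply: le_trans (nrmM _ _) _; rewrite -mulrA.
  by apply: ler_pM; rewrite ?nrm_ge0 ?nrm_ray_dir //; exact: dphi1.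
Qed.

Let F c u := phi (ray 1 c u) * ray_dir 1 - phi (ray (-1) c u) * ray_dir (-1).
Let F1 c u := 'i * (phi1 (ray 1 c u) * ray_dir 1 - phi1 (ray (-1) c u) * ray_dir (-1)).

Let cder_F c u : a < c -> c < b -> 0 <= u -> cder (F ^~ u) c (F1 c u).
Proof.
move=> ac cb u0; have s1 : (1 : R) ^+ 2 = 1 by rewrite expr1n.
have s2 : (-1 : R) ^+ 2 = 1 by rewrite sqrrN expr1n.
have h1 := (hphi ac cb s1 u0 : holo phi phi1 (ray 1 c u)) (ray 1 ^~ u) c _ erefl (cder_ray_c 1 c u).
have h2 := (hphi ac cb s2 u0 : holo phi phi1 (ray (-1) c u)) (ray (-1) ^~ u) c _ erefl (cder_ray_c (-1) c u).
have k1 := cderM h1 (cder_cst (ray_dir 1) c).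
have k2 := cderM h2 (cder_cst (ray_dir (-1)) c).
by apply: cder_eq (cderB k1 k2) _; rewrite /F1; ring.
Qed.

Let nrm_F1 c u : a < c -> c < b -> 0 <= u -> nrm (F1 c u) <= 4 * M * expR (- u).
Proof. by move=> ac cb u0; rewrite /F1 nrmMi; apply: nrm_summand => //; exact: dphi1. Qed.

Let int_F1 c : a < c -> c < b -> cint `]0%R, +oo[ (F1 c) = 0.
Proof.
move=> ac cb; rewrite cintZ //; last exact: cintegrable_summand (dphi1 ac cb).
have s1 : (1 : R) ^+ 2 = 1 by rewrite expr1n.
have s2 : (-1 : R) ^+ 2 = 1 by rewrite sqrrN expr1n.
have ig s : s ^+ 2 = 1 -> cintegrable `]0%R, +oo[ (fun u => ray_dir s * phi1 (ray s c u)).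
  move=> ss; apply: (dom_cintegrable (G := fun u => 2 * M * expR (- u))) => //.
  - by apply: cmeasM; [exact: cmeas_cst|apply: mphi1; exact: cmeas_ray].
  - by apply: rintegrableZ => //; exact: rintegrable_expN.
  - move=> u /=; rewrite in_itv /= andbT => /ltW u0; apply: le_trans (nrmM _ _) _; rewrite -mulrA.
    by apply: ler_pM; rewrite ?nrm_ge0 ?nrm_ray_dir //; exact: dphi1.
have -> : cint `]0%R, +oo[ (fun u => phi1 (ray 1 c u) * ray_dir 1 - phi1 (ray (-1) c u) * ray_dir (-1)) =
  cint `]0%R, +oo[ (fun u => ray_dir 1 * phi1 (ray 1 c u)) - cint `]0%R, +oo[ (fun u => ray_dir (-1) * phi1 (ray (-1) c u)).
  rewrite -cintB //; [|exact: ig|exact: ig].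
  by apply: eq_cint => u _; ring.
rewrite !ray_FTC // /ray !mulr0 subrr mulr0 //.
Qed.

Let shift_component (P : C -> R) : (P = Re \/ P = Im) ->
  forall c, a < c -> c < b ->
  is_derive c 1 (fun c => \int[mu]_(u in `]0%R, +oo[) P (F c u)) 0.
Proof.
move=> PE c ac cb.
have dP k v (l : C) : cder k v l -> is_derive v 1 (fun v => P (k v)) (P l).
  by case: PE => -> [].
have leP z : `|P z| <= nrm z by case: PE => ->; [exact: Re_le_nrm|exact: Im_le_nrm].
have Iab : (`]a, b[%classic : set R) c by rewrite /= in_itv /= ac cb.
have E y u : a < y -> y < b -> 0 <= u -> partial1of2 (fun c u => P (F c u)) y u = P (F1 y u).
  move=> ay yb u0; rewrite partial1of2E.
  by have [_ ->] := dP _ _ _ (cder_F ay yb u0).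
have igP y : a < y -> y < b -> rintegrable `]0%R, +oo[ (fun u => P (F y u)).
  move=> ay yb; have [h1 h2] := cintegrable_summand mphi (dphi ay yb).
  by case: PE => ->.
have intf y : (`]a, b[%classic : set R) y -> mu.-integrable `]0%R, +oo[ (EFin \o (fun u => P (F y u))).
  by rewrite /= in_itv /= => /andP[ay yb]; exact: igP.
have derf y u : (`]a, b[%classic : set R) y -> (`]0%R, +oo[%classic : set R) u -> derivable ((fun c u => P (F c u)) ^~ u) y 1.
  rewrite /= !in_itv /= andbT => /andP[ay yb] /ltW u0.
  by have [] := dP _ _ _ (cder_F ay yb u0).
have G0 (u : R) : 0 <= 4 * M * expR (- u) by rewrite !mulr_ge0 ?expR_ge0.
have iG : mu.-integrable `]0%R, +oo[ (EFin \o (fun u : R => 4 * M * expR (- u))).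
  by apply: (rintegrableZ (4 * M)) => //; exact: rintegrable_expN.
have Gub y u : (`]a, b[%classic : set R) y -> (`]0%R, +oo[%classic : set R) u ->
    `|partial1of2 (fun c u => P (F c u)) y u| <= 4 * M * expR (- u).
  rewrite /= !in_itv /= andbT => /andP[ay yb] /ltW u0; rewrite E //.
  by apply: le_trans (leP _) _; exact: nrm_F1.
have mD : measurable (`]0%R, +oo[%classic : set R) by [].
apply: DeriveDef.
  have := @derivable_under_integral R _ _ mu (fun c u => P (F c u)) _ mD c a b Iab intf derf (fun u => 4 * M * expR (- u)) G0 iG Gub.
  exact.
rewrite -derive1E (@differentiation_under_integral R _ _ mu (fun c u => P (F c u)) _ mD c a b Iab intf derf (fun u => 4 * M * expR (- u)) G0 iG Gub).
have := int_F1 ac cb; rewrite /cint => -[i1 i2].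
transitivity (\int[mu]_(u in `]0%R, +oo[) P (F1 c u)).
  apply: eq_Rintegral => u /set_mem /=; rewrite in_itv /= andbT => /ltW u0; exact: E.
by case: PE => ->.
Qed.

(** As a function of the vertex the integral has derivative 0: it differentiates to ['i] times the
    contour integral of [phi1], which is a difference of boundary values of [phi] at the common
    vertex of the two rays ([int_F1]). *)
Lemma ray_int_shift_le c c' : a < c -> c <= c' -> c' < b -> ray_int c phi = ray_int c' phi.
Proof.
move=> ac cc' cb.
have comp (P : C -> R) : (P = Re \/ P = Im) ->
  \int[mu]_(u in `]0%R, +oo[) P (F c u) = \int[mu]_(u in `]0%R, +oo[) P (F c' u).
  move=> PE; apply/esym/eqP; rewrite -subr_eq0 -normr_le0.
  have := @real_MVT_le _ (fun c => \int[mu]_(u in `]0%R, +oo[) P (F c u)) (fun=> 0) c c' 0 cc'.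
  rewrite mul0r; apply.
    move=> y cy yc'; apply: shift_component => //; [exact: lt_le_trans cy|exact: le_lt_trans yc' _].
  by move=> y _ _; rewrite normr0.
by apply: complexP => /=; apply: comp; [left|right].
Qed.

End shift.

Lemma airy_int_shift a b r c c' xi : admissible a b r -> a < c -> c < b -> a < c' -> c' < b ->
  airy_int c r xi = airy_int c' r xi.
Proof.
move=> [r1 [r2 [mr mr1 br br1 [hr hr1]]]].
wlog cc' : c c' / c <= c'.
  move=> W ac cb ac' cb'; have [cc'|c'c] := leP c c'; first exact: W.
  by apply/esym; apply: W => //; exact: ltW.
move=> ac _ _ cb; congr (_ * _).
have X0 : 0 <= `|xi| by [].
have Xx : - `|xi| <= xi by rewrite lerNl -normrN ler_norm.
have pid := @polybounded_id R a b.
(* [airy_exp xi z * q z] is the derivative of [airy_exp xi z * r z]; the function passed as [phi2]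
   below is the next derivative. *)
pose q z := 'i * (z ^+ 2 + xi%:C) * r z + r1 z.
have bq : polybounded a b q.
  apply: polyboundedD => //; apply: polyboundedM => //.
  apply: polyboundedM; first exact: polybounded_cst.
  by apply: polyboundedD; [exact: polyboundedX|exact: polybounded_cst].
have mq : cmfun q.
  apply: cmfunD => //; apply: cmfunM => //; apply: cmfunM; first exact: cmfun_cst.
  by apply: cmfunD; [exact: cmfunX|exact: cmfun_cst].
have [M1 M10 h1] := polybounded_decays br X0.
have [M2 M20 h2] := polybounded_decays bq X0.
pose K := expR (`|xi| * (`|a| + `|b|)).
have eK y : a < y -> y < b -> expR (- (xi * y)) <= K.
  move=> ay yb; rewrite ler_expR -mulNr; apply: le_trans (ler_norm _) _; rewrite normrM normrN.
  rewrite ler_wpM2l // ler_norml; have := ler_norm b; have := ler_norm (- a); rewrite normrN.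
  have := normr_ge0 a; have := normr_ge0 b; lra.
have K0 : 0 <= K by exact: expR_ge0.
pose h z := 'i * (z ^+ 2 + xi%:C) * airy_exp xi z.
apply: (@ray_int_shift_le a b (fun z => airy_exp xi z * r z) (fun z => airy_exp xi z * q z)
  (fun z => h z * q z + airy_exp xi z *
   ((0 * (z ^+ 2 + xi%:C) + 'i * (2%:R * z ^+ 1 * 1 + 0)) * r z + 'i * (z ^+ 2 + xi%:C) * r1 z + r2 z)) ((M1 + M2) * K)) => //.
- by apply: cmfunM => //; exact: cmfun_airy_exp.
- by apply: cmfunM => //; exact: cmfun_airy_exp.
- by rewrite mulr_ge0 // addr_ge0.
- move=> y ay yb; apply: decays_le (h1 _ _ Xx ay yb) _.
  by apply: ler_pM; rewrite ?expR_ge0 ?eK //; lra.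
- move=> y ay yb; apply: decays_le (h2 _ _ Xx ay yb) _.
  by apply: ler_pM; rewrite ?expR_ge0 ?eK //; lra.
- move=> s y u ay yb s2 u0.
  apply: holo_ext (holoM (@holo_airy_exp R xi _) (hr _ _ _ ay yb s2 u0)) _.
  by rewrite /q; ring.
- move=> s y u ay yb s2 u0; set z := ray s y u.
  have k1 := holoM (@holo_cst R 'i%R z) (holoD (holoX 2 (@holo_id R z)) (@holo_cst R xi%:C z)).
  have k2 := holoD (holoM k1 (hr _ _ _ ay yb s2 u0)) (hr1 _ _ _ ay yb s2 u0).
  exact: holoM (@holo_airy_exp R xi z) k2.
Qed.

End ContourShift.

(** * The functions [Ai], [C_w], [s^(m)] and [t^(m)] *)

Section AiryFunctions.
Variable R : realType.
Local Notation C := R[i].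
Implicit Types (r q phi psi f g : C -> C) (ws : seq C) (w : C).

Lemma strip (c : R) : c - 1 < c /\ c < c + 1.
Proof. lra. Qed.

Lemma contour_airy_int c r phi xi : cmfun r -> polybounded (c - 1) (c + 1) r ->
  (forall z, phi z = airy_exp xi z * r z) ->
  (2 * pi)^-1%:C * contour_int c phi = airy_int c r xi.
Proof.
move=> mr hr e; congr (_ * _).
have -> : phi = (fun z => airy_exp xi z * r z) by apply/funext.
have X0 : 0 <= `|xi| by [].
have Xx : - `|xi| <= xi by rewrite lerNl -normrN ler_norm.
have [M1 _ h1] := polybounded_decays hr X0.
have [l1 l2] := strip c.
apply: contour_intE (h1 _ _ Xx l1 l2).
by apply: cmfunM => //; exact: cmfun_airy_exp.
Qed.

Lemma addr_halves : 2^-1 + 2^-1 = 1 :> R.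
Proof. by field. Qed.

Definition AiD n (xi : R) : C := airy_int 0 (fun z => ('i * z) ^+ n) xi.

Lemma admissible_iz (a b : R) : admissible a b (fun z => 'i * z).
Proof. by apply: admissibleM; [exact: admissible_cst|exact: admissible_id]. Qed.

Lemma admissible_izX (a b : R) n : admissible a b (fun z => ('i * z) ^+ n).
Proof. by apply: admissibleX; exact: admissible_iz. Qed.

Lemma AiE (xi : R) : Ai xi = AiD 0 xi.
Proof.
apply: contour_airy_int.
- exact: admissible_meas (admissible_izX 0 0 _).
- exact: admissible_bounded (admissible_izX _ _ _).
- by move=> z; rewrite expr0 mulr1 /airy_exp addrC.
Qed.

Lemma AiD_shift n c xi : AiD n xi = airy_int c (fun z => ('i * z) ^+ n) xi.
Proof.
apply: (@airy_int_shift _ (- `|c| - 1) (`|c| + 1)); first exact: admissible_izX.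
all: have := ler_norm c; have := ler_norm (- c); rewrite normrN; have := normr_ge0 c; lra.
Qed.

Lemma cmeas_AiD n : cmeas (AiD n).
Proof. by apply: cmeas_airy_int; exact: admissible_meas (admissible_izX 0 0 _). Qed.

(** The integrand has no poles, so the vertex can be put at any height [c]: Airy functions decay
    faster than every exponential. *)
Lemma AiD_bound n (c X : R) : 0 <= X -> exists2 M, 0 <= M &
  forall xi, - X <= xi -> nrm (AiD n xi) <= M * expR (- (xi * c)).
Proof.
move=> X0; have ad := admissible_izX (c - 1) (c + 1) n.
have [M M0 h] := airy_int_bound (admissible_meas ad) (admissible_bounded ad) X0.
have [l1 l2] := strip c.
by exists M => // xi Xx; rewrite (AiD_shift _ c); exact: h.
Qed.

Lemma AiD_taylor n (c X : R) : 0 <= X -> exists2 M, 0 <= M &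
  forall xi d, - X <= xi -> `|d| <= 1 ->
  nrm (AiD n (xi + d) - AiD n xi - d%:C * AiD n.+1 xi) <= M * d ^+ 2 * expR (- (xi * c)).
Proof.
move=> X0; have ad := admissible_izX (c - 1) (c + 1) n.
have [M M0 h] := airy_int_taylor (admissible_meas ad) (admissible_bounded ad) X0.
have [l1 l2] := strip c.
exists M => // xi d Xx d1; rewrite !(AiD_shift _ c).
have -> : airy_int c (fun z => ('i * z) ^+ n.+1) xi = airy_int c (fun z => 'i * z * ('i * z) ^+ n) xi.
  by apply: eq_airy_int => s u _ _; rewrite exprS.
exact: h.
Qed.

Lemma vertex_pole ws w : w \in ws -> vertex ws + 1 <= pole_height w.
Proof.
rewrite /vertex /pole_height subrK; elim: ws => // v ws IH; rewrite inE big_cons => /predU1P[<-|/IH h].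
  by rewrite ge_min lexx.
by rewrite ge_min h orbT.
Qed.

Lemma admissible_inv_prod a b ws : (forall w, w \in ws -> b + 2^-1 <= pole_height w) ->
  admissible a b (fun z => \prod_(w <- ws) inv_lin w z).
Proof.
elim: ws => [|w ws IH] h.
  by under eq_fun do rewrite big_nil; exact: admissible_cst.
under eq_fun do rewrite big_cons; apply: admissibleM.
  by apply: (@admissible_inv_lin R a b 2^-1) => //; apply: h; rewrite mem_head.
by apply: IH => v vws; apply: h; rewrite inE vws orbT.
Qed.

Lemma polybounded_subset (a b a' b' : R) r : a <= a' -> b' <= b -> polybounded a b r -> polybounded a' b' r.
Proof.
move=> aa bb [P [N [P0 h]]]; exists P, N; split => // s c u ac cb; apply: h.
  exact: le_lt_trans ac.
exact: lt_le_trans bb.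
Qed.

Lemma contour_airy_int_le c b r phi xi : cmfun r -> c < b -> polybounded (c - 1) b r ->
  (forall z, phi z = airy_exp xi z * r z) ->
  (2 * pi)^-1%:C * contour_int c phi = airy_int c r xi.
Proof.
move=> mr cb hr e; congr (_ * _).
have -> : phi = (fun z => airy_exp xi z * r z) by apply/funext.
have X0 : 0 <= `|xi| by [].
have Xx : - `|xi| <= xi by rewrite lerNl -normrN ler_norm.
have [M1 _ h1] := polybounded_decays hr X0.
have [l1 l2] := strip c.
apply: contour_intE (h1 _ _ Xx l1 cb).
by apply: cmfunM => //; exact: cmfun_airy_exp.
Qed.

Lemma sfunE ws c xi : (forall w, w \in ws -> c + 1 <= pole_height w) ->
  Defs.sfun ws xi = airy_int c (fun z => \prod_(w <- ws) inv_lin w z) xi.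
Proof.
move=> hc; set v := vertex ws.
(* Both vertices lie in the strip from [min v c - 1] to [max v c + 2^-1]; the pole heights are at
   least [max v c + 1], which leaves half a unit above the strip. *)
pose m := Num.max v c.
have hm w : w \in ws -> (m + 2^-1) + 2^-1 <= pole_height w.
  move=> wws; rewrite -addrA addr_halves /m.
  by have := vertex_pole wws; have := hc _ wws; case: (leP v c).
pose l := Num.min v c - 1.
have ad := admissible_inv_prod l hm.
have lv : l <= v - 1 by rewrite /l lerB // ge_min lexx.
have lc : l <= c - 1 by rewrite /l lerB // ge_min lexx orbT.
have vm : v <= m by rewrite /m le_max lexx.
have cm : c <= m by rewrite /m le_max lexx orbT.
rewrite -(@airy_int_shift _ l (m + 2^-1) _ v) //; [|lra|lra|lra|lra].
apply: (@contour_airy_int_le _ (m + 2^-1)).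
- exact: admissible_meas ad.
- by rewrite -/v; lra.
- by apply: polybounded_subset (admissible_bounded ad).
- move=> z; rewrite /airy_exp mulrDr; congr (_ * _).
Qed.

Lemma CfunE w xi : Cfun w xi = Defs.sfun [:: w] xi.
Proof.
rewrite /Cfun /Defs.sfun; congr (_ * contour_int _ _); apply/funext => z.
by rewrite mulrDr big_seq1.
Qed.

Lemma tfunE ws xi : tfun ws xi = airy_int 0 (fun z => \prod_(w <- ws) (w - 'i * z)) xi.
Proof.
have ad : admissible (0 - 1) (0 + 1) (fun z => \prod_(w <- ws) (w - 'i * z)).
  apply: admissible_prod => w.
  have -> : (fun z => w - 'i * z) = (fun z => w + (- 'i%R) * z) by apply/funext => z; rewrite mulNr.
  exists (fun=> - 'i%R), (fun=> 0).
  have pi := polyboundedM (polybounded_cst (0 - 1) (0 + 1) (- 'i%R)) (@polybounded_id R (0 - 1) (0 + 1)).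
  split; try exact: cmfun_cst; try exact: polybounded_cst.
  - by apply: cmfunD; [exact: cmfun_cst|apply: cmfunM; [exact: cmfun_cst|exact: cmfun_id]].
  - by apply: polyboundedD => //; exact: polybounded_cst.
  split => s c u *; last exact: holo_cst.
  have h := holoD (@holo_cst R w (ray s c u)) (holoM (@holo_cst R (- 'i%R) (ray s c u)) (@holo_id R (ray s c u))).
  by apply: holo_ext h _; ring.
apply: contour_airy_int.
- exact: admissible_meas ad.
- exact: admissible_bounded ad.
- by move=> z; rewrite /airy_exp mulrDr.
Qed.

Lemma cmeas_Cfun w : cmeas (Cfun w).
Proof.
have -> : Cfun w = airy_int (vertex [:: w]) (fun z => \prod_(w <- [:: w]) inv_lin w z).
  by apply/funext => xi; rewrite CfunE; apply: sfunE => v; exact: vertex_pole.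
apply: cmeas_airy_int.
by move=> d T g mg; apply: cmeas_prod => v; exact: cmfun_inv_lin.
Qed.

Lemma sfun_bound ws c X : (forall w, w \in ws -> c + 1 <= pole_height w) -> 0 <= X ->
  exists2 M, 0 <= M & forall xi, - X <= xi -> nrm (Defs.sfun ws xi) <= M * expR (- (xi * c)).
Proof.
move=> hc X0.
have hm w : w \in ws -> (c + 2^-1) + 2^-1 <= pole_height w.
  by move=> wws; rewrite -addrA addr_halves; exact: hc.
have ad := admissible_inv_prod (c - 1) hm.
have [M M0 h] := airy_int_bound (admissible_meas ad) (admissible_bounded ad) X0.
exists M => // xi Xx; rewrite (sfunE xi hc); apply: h => //; lra.
Qed.

Lemma cmeas_sfun ws : cmeas (Defs.sfun ws).
Proof.
have -> : Defs.sfun ws = airy_int (vertex ws) (fun z => \prod_(w <- ws) inv_lin w z).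
  by apply/funext => xi; apply: sfunE => v; exact: vertex_pole.
apply: cmeas_airy_int.
by move=> d T g mg; apply: cmeas_prod => v; exact: cmfun_inv_lin.
Qed.

(** Differentiation multiplies the amplitude by ['i z], and
    ['i z / (w + 'i z) = 1 - w / (w + 'i z)]. *)
Lemma Cfun_taylor w c X : c + 1 <= pole_height w -> 0 <= X ->
  exists2 M, 0 <= M & forall xi d, - X <= xi -> `|d| <= 1 ->
  nrm (Cfun w (xi + d) - Cfun w xi - d%:C * (AiD 0 xi - w * Cfun w xi)) <=
    M * d ^+ 2 * expR (- (xi * c)).
Proof.
move=> hc X0.
have hw v : v \in [:: w] -> c + 1 <= pole_height v by rewrite inE => /eqP ->.
have hm v : v \in [:: w] -> (c + 2^-1) + 2^-1 <= pole_height v.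
  by move=> vw; rewrite -addrA addr_halves; exact: hw.
have ad := admissible_inv_prod (c - 1) hm.
have [M M0 h] := airy_int_taylor (admissible_meas ad) (admissible_bounded ad) X0.
have cl : c - 1 < c by lra.
have cr : c < c + 2^-1 by lra.
exists M => // xi d Xx d1; rewrite !CfunE !(sfunE _ hw).
have -> : AiD 0 xi - w * airy_int c (fun z => \prod_(w <- [:: w]) inv_lin w z) xi =
  airy_int c (fun z => 'i * z * \prod_(w <- [:: w]) inv_lin w z) xi; last exact: h.
rewrite (AiD_shift _ c).
have a1 := admissible_izX (c - 1) (c + 2^-1) 0.
rewrite -mulNr -(@airy_intZ _ (c - 1) (c + 2^-1)) //; [|exact: admissible_meas ad|exact: admissible_bounded ad].
have m2 : cmfun (fun z => - w * \prod_(w <- [:: w]) inv_lin w z).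
  by apply: cmfunM; [exact: cmfun_cst|exact: admissible_meas ad].
have p2 : polybounded (c - 1) (c + 2^-1) (fun z => - w * \prod_(w <- [:: w]) inv_lin w z).
  by apply: polyboundedM; [exact: polybounded_cst|exact: admissible_bounded ad].
rewrite -(@airy_intD R (c - 1) (c + 2^-1) c _ _ xi (admissible_meas a1) (admissible_bounded a1) m2 p2) //.
apply: eq_airy_int => s u s2 u0; rewrite expr0 !big_seq1 /inv_lin.
have nz : w + 'i * ray s c u != 0.
  have := pole_gap hc ler01 s2 u0; apply: contraTneq => ->; by rewrite nrm0 -ltNge.
by field.
Qed.

End AiryFunctions.

(** * Fredholm theory in weighted spaces *)

Section Hadamard.
Variable R : realType.
Local Notation C := R[i].
Local Notation Re := (@complex.Re R).
Local Notation Im := (@complex.Im R).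

Lemma mulC_conj (z : C) : z * z^* = (Re z ^+ 2 + Im z ^+ 2)%:C.
Proof. by case: z => x y; apply: complexP => /=; ring. Qed.

Lemma mulC_conj_le (z : C) K : nrm z <= K -> z * z^* <= (K ^+ 2)%:C.
Proof.
move=> h; have h0 := nrm_ge0 z; rewrite mulC_conj lecR.
apply: (@le_trans _ _ (nrm z ^+ 2)); last by rewrite lerXn2r // nnegrE; lra.
rewrite /nrm sqrrD !real_normK ?num_real //.
by have := mulr_ge0 (normr_ge0 (Re z)) (normr_ge0 (Im z)); lra.
Qed.

Local Open Scope sesquilinear_scope.

(** The inequality of arithmetic and geometric means for the eigenvalues of [M *m M ^t*], which are
    nonnegative as the diagonal of the Gram matrix of [P *m M] with [P] unitary. This is the source
    of Hadamard's inequality below. *)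
Lemma det_gram_le n (M : 'M[C]_n) :
  \det (M *m M ^t*) <= (\tr (M *m M ^t*) / n%:R) ^+ n.
Proof.
case: n M => [|n] M; first by rewrite expr0 det_mx00.
set A := M *m M ^t*.
have An : A \is normalmx.
  by apply/normalmxP; rewrite /A trmx_mul map_mxM /= trmxCK.
have /orthomx_spectralP := An; set P := spectralmx A; set d := spectral_diag A => AE.
have Pu : P \is unitarymx by exact: spectral_unitarymx.
have Punit : P \in unitmx by exact: spectral_unit.
have dE i : d 0 i = \sum_j (P *m M) i j * ((P *m M) i j)^*.
  have DE : diag_mx d = (P *m M) *m (P *m M) ^t*.
    transitivity (P *m A *m invmx P).
      by rewrite AE !mulmxA mulmxV // mul1mx mulmxK.
    by rewrite invmx_unitary // /A trmx_mul map_mxM !mulmxA.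
  have /matrixP/(_ i i) := DE; rewrite !mxE eqxx mulr1n => ->.
  by apply: eq_bigr => j _; rewrite !mxE.
have d0 i : 0 <= d 0 i.
  by rewrite dE sumr_ge0 // => j _; rewrite mul_conjC_ge0.
have -> : \det A = \prod_i d 0 i.
  by rewrite AE !det_mulmx det_inv mulrAC mulVr ?mul1r ?det_diag // -unitmxE.
have -> : \tr A = \sum_i d 0 i.
  by rewrite AE mxtrace_mulC mulmxA mulmxV // mul1mx mxtrace_diag.
have n0 : (n.+1%:R : C) != 0 by rewrite pnatr_eq0.
have := @leif_AGM_scaled C 'I_n.+1 predT (fun i => d 0 i / n.+1%:R).
rewrite card_ord => H.
have /H [le _] : {in predT, forall i : 'I_n.+1, 0 <= d 0 i / n.+1%:R *+ n.+1}.
  by move=> i _; rewrite -mulr_natr mulfVK.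
rewrite mulr_suml; apply: le_trans le.
by rewrite le_eqVlt; apply/orP; left; apply/eqP; apply: eq_bigr => i _; rewrite -[_ / _ *+ _]mulr_natr mulfVK.
Qed.

Lemma hadamard_nrm n (M : 'M[C]_n) K : (forall i j, nrm (M i j) <= K) ->
  nrm (\det M) ^+ 2 <= 2 * (n%:R * K ^+ 2) ^+ n.
Proof.
move=> h; apply: le_trans (nrm_sqr_le _) _; rewrite ler_wpM2l //.
rewrite -lecR -mulC_conj.
have -> : \det M * (\det M)^* = \det (M *m M ^t*).
  by rewrite det_mulmx det_map_mx det_tr.
apply: le_trans (det_gram_le M) _.
case: n M h => [|n] M h; first by rewrite !expr0.
have n0 : (n.+1%:R : C) != 0 by rewrite pnatr_eq0.
rewrite rmorphXn /=.
have tE : \tr (M *m M ^t*) = \sum_i \sum_j M i j * (M i j)^*.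
  by rewrite /mxtrace; apply: eq_bigr => i _; rewrite mxE; apply: eq_bigr => j _; rewrite !mxE.
have t0 : 0 <= \tr (M *m M ^t*).
  by rewrite tE; do 2 (apply: sumr_ge0 => ? _); rewrite mul_conjC_ge0.
apply: lerXn2r; rewrite ?nnegrE.
- by rewrite divr_ge0 // ler0n.
- by rewrite ler0c mulr_ge0 ?sqr_ge0.
rewrite ler_pdivrMr ?ltr0n // tE.
apply: (@le_trans _ _ (\sum_(i < n.+1) \sum_(j < n.+1) (K ^+ 2)%:C)).
  by apply: ler_sum => i _; apply: ler_sum => j _; exact: mulC_conj_le.
have -> : (n.+1%:R * K ^+ 2)%:C = n.+1%:R * (K ^+ 2)%:C.
  by rewrite rmorphM /=; congr (_ * _); exact: rmorph_nat.
rewrite !sumr_const !card_ord.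
by rewrite -[_ *+ n.+1 *+ n.+1]mulr_natr -[(K ^+ 2)%:C *+ _]mulr_natl.
Qed.

(** A substitute for Stirling's formula: [n^n] is at most [(n+1) ... (2n)], which is [n!] times a
    central binomial coefficient, itself at most [2^(2n)]. *)
Lemma exp_le_fact n : (n ^ n <= 4 ^ n * n`!)%N.
Proof.
have h1 : (n ^ n <= (n + n) ^_ n)%N.
  rewrite ffact_prod.
  have -> : (n ^ n = \prod_(i < n) n)%N by rewrite prod_nat_const card_ord.
  by apply: leq_prod => i _; rewrite -addnBA ?leq_addr // ltnW.
have h2 : ((n + n) ^_ n = 'C(n + n, n) * n`!)%N by rewrite bin_ffact.
have h3 : ('C(n + n, n) <= 4 ^ n)%N.
  have e : (n + n = 2 * n)%N by rewrite mul2n addnn.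
  have -> : (4 ^ n = (1 + 1) ^ (n + n))%N by rewrite e expnM.
  rewrite expnDn (bigD1 (inord n : 'I_(n + n).+1)) //= inordK ?ltnS ?leq_addr //.
  by rewrite !exp1n !muln1 leq_addr.
by apply: leq_trans h1 _; rewrite h2 leq_mul2r h3 orbT.
Qed.

Lemma pow_le_fact (q : R) n : 0 <= q -> q ^+ n <= expR q * n`!%:R.
Proof.
move=> q0; case: n => [|n]; first by rewrite expr0 fact0 mulr1 -{1}expR0 ler_expR.
have := expR_ge1Dxn n q0 => h.
rewrite -ler_pdivrMr ?ltr0n ?fact_gt0 //; lra.
Qed.

(** Hadamard's bound grows like [n^{n/2}] up to geometric factors, so its quotient by [n!] beats
    every geometric sequence; the ratio [2^-1] matches [csum_exists]. The size is [n.+1] against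
    [n!] because a first minor has [n] integrated variables besides the pair [x], [y]. *)
Lemma hadamard_decay (K : R) : 0 <= K -> exists2 P, 0 <= P & forall n (M : 'M[C]_n.+1),
  (forall i j, nrm (M i j) <= K) -> nrm (\det M) <= P * 2^-1 ^+ n * n`!%:R.
Proof.
move=> K0.
(* squares: 2 (n+1)^(n+1) K^(2n+2) <= 2 (4 K^2)^(n+1) (n+1)!, (n+1) <= 2^n,
   and (32 K^2)^n <= expR (32 K^2) n! *)
pose q := 32 * K ^+ 2.
have q0 : 0 <= q by rewrite mulr_ge0 // sqr_ge0.
pose P2 := 8 * K ^+ 2 * expR q.
have P20 : 0 <= P2 by rewrite !mulr_ge0 ?expR_ge0 // sqr_ge0.
exists (Num.sqrt P2); first exact: sqrtr_ge0.
move=> n M h.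
have f0 : 0 <= (n`!%:R : R) by [].
have r0 : 0 <= Num.sqrt P2 * 2^-1 ^+ n * n`!%:R.
  by rewrite mulr_ge0 // mulr_ge0 ?sqrtr_ge0 // exprn_ge0.
rewrite -(@ler_pXn2r _ 2) ?nnegrE ?nrm_ge0 //.
apply: le_trans (hadamard_nrm h) _.
rewrite [leRHS]exprMn [(Num.sqrt P2 * _) ^+ 2]exprMn sqr_sqrtr //.
have e1 : ((n.+1 ^ n.+1)%:R : R) <= (4 ^ n.+1 * n.+1`!)%:R by rewrite ler_nat exp_le_fact.
have e2 : (n.+1`!%:R : R) <= 2 ^+ n * n`!%:R.
  by rewrite factS natrM ler_wpM2r // -natrX ler_nat ltn_expl.
have e3 := pow_le_fact n q0.
have K2 : 0 <= (K ^+ 2) ^+ n.+1 by rewrite exprn_ge0 // sqr_ge0.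
have i1 : ((n.+1 ^ n.+1)%:R : R) * (K ^+ 2) ^+ n.+1 <= (4 ^+ n.+1 * (2 ^+ n * n`!%:R)) * (K ^+ 2) ^+ n.+1.
  rewrite ler_wpM2r //; apply: le_trans e1 _; rewrite natrM natrX ler_wpM2l // exprn_ge0 //.
have i2 : 2 * ((4 ^+ n.+1 * (2 ^+ n * n`!%:R)) * (K ^+ 2) ^+ n.+1) =
  (8 * K ^+ 2 * (2^-1 ^+ n) ^+ 2 * n`!%:R) * q ^+ n.
  have t : (2^-1 ^+ n) ^+ 2 * (32 : R) ^+ n = 8 ^+ n.
    by rewrite -exprM mulnC exprM -exprMn; congr (_ ^+ _); field.
  have gen1 (c x f y z : R) : c * x * f * (y * z) = c * f * (x * y) * z by ring.
  have gen2 (p l f s k : R) : 2 * (p * 4 * (l * f) * (s * k)) = 8 * k * f * (p * l) * s by ring.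
  rewrite /q [(32 * _) ^+ n]exprMn gen1 t.
  have -> : (8 : R) ^+ n = 4 ^+ n * 2 ^+ n by rewrite -exprMn; congr (_ ^+ _); ring.
  by rewrite [4 ^+ n.+1]exprSr [(K ^+ 2) ^+ n.+1]exprSr gen2.
have c0 : 0 <= 8 * K ^+ 2 * (2^-1 ^+ n) ^+ 2 * n`!%:R.
  by rewrite !mulr_ge0 ?sqr_ge0.
have i3 := ler_wpM2l c0 e3.
rewrite [(n.+1%:R * _) ^+ _]exprMn -natrX; move: i1; set u := _ * (K ^+ 2) ^+ n.+1 => i1.
apply: (@le_trans _ _ ((8 * K ^+ 2 * (2^-1 ^+ n) ^+ 2 * n`!%:R) * q ^+ n)); first by rewrite -i2; lra.
apply: le_trans i3 _; rewrite le_eqVlt; apply/orP; left; apply/eqP; rewrite /P2; ring.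
Qed.

Lemma geometric_vanish (x c : R) : (forall n, x <= c * 2^-1 ^+ n) -> x <= 0.
Proof.
move=> h; rewrite leNgt; apply/negP => x0.
have c0 : 0 <= c / x.
  rewrite divr_ge0 ?(ltW x0) //; have := h 0%N; rewrite expr0 mulr1 => /(lt_le_trans x0); exact: ltW.
have [n hn] : exists n : nat, c / x < n%:R by exists (Num.bound (c / x)); exact: archi_boundP.
have := h n; rewrite exprVn ler_pdivlMr ?exprn_gt0 // leNgt => /negP; apply.
rewrite mulrC -ltr_pdivrMr //; apply: lt_trans hn _.
by rewrite -natrX ltr_nat ltn_expl.
Qed.

(** Identities between sums of series are proved this way: partial sums are inserted, and the
    difference of the two sides is bounded for every [n]. *)
Lemma nrm_geometric_vanish (z : C) c : (forall n, nrm z <= c * 2^-1 ^+ n) -> z = 0.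
Proof. by move=> h; apply: nrm_le0; exact: geometric_vanish h. Qed.

Lemma cseries_limit (z : nat -> C) M : 0 <= M -> (forall n, nrm (z n) <= M * 2^-1 ^+ n) ->
  exists F, forall n, nrm (F - \sum_(0 <= i < n) z i) <= 4 * M * 2^-1 ^+ n.
Proof.
move=> M0 h.
have [U _ hU] := @csum_exists R setT (fun n _ => z n) (fun=> 1) M measurableT M0
  (fun _ _ => ler01) (fun n => @cmeas_cst R _ _ (z n)) (fun n s _ => ltac:(rewrite mulr1; exact: h)).
by exists (U 0) => n; have := hU n 0 I; rewrite mulr1.
Qed.

End Hadamard.

(** * Integral operators on weighted spaces *)

Section WeightedOperators.
Variable R : realType.
Local Notation C := R[i].
Local Notation mu := (@lebesgue_measure R).
(* a bounds the growth of the functions acted on, b the decay of the kernels. *)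
Variables (D : set R) (a b : R -> R).
Hypothesis mD : measurable D.
Hypothesis a_gt0 : forall s, D s -> 0 < a s.
Hypothesis b_gt0 : forall s, D s -> 0 < b s.
Hypothesis b_le_a : forall s, D s -> b s <= a s.
Hypothesis iw : rintegrable D (fun s => a s * b s).
Hypothesis intw : \int[mu]_(s in D) (a s * b s) = 1.
Implicit Types (u v g h : R -> C) (k l : R -> R -> C).

Definition bounded_by (c : R -> R) u M := cmeas u /\ forall s, D s -> nrm (u s) <= M * c s.

Definition kernel_bound k M :=
  cmeas (fun p : R * R => k p.1 p.2) /\
  forall s t, D s -> D t -> nrm (k s t) <= M * (b s * b t).

Definition op k u s := cint D (fun t => k s t * u t).

Definition dual u v := cint D (fun s => u s * v s).

Lemma bounded_by_nneg c u M : bounded_by c u M -> (forall s, D s -> 0 < c s) ->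
  (exists s, D s) -> 0 <= M.
Proof.
move=> [_ h] c0 [s Ds]; have := le_trans (nrm_ge0 _) (h s Ds).
by rewrite pmulr_lge0 // c0.
Qed.

Lemma dual_bounds u v M N s : bounded_by a u M -> bounded_by b v N -> D s ->
  nrm (u s * v s) <= M * N * (a s * b s).
Proof.
move=> [_ hu] [_ hv] Ds; apply: le_trans (nrmM _ _) _.
by rewrite mulrACA; apply: ler_pM; rewrite ?nrm_ge0 ?hu ?hv.
Qed.

Lemma dual_integrable u v M N : bounded_by a u M -> bounded_by b v N ->
  cintegrable D (fun s => u s * v s).
Proof.
move=> hu hv; apply: (dom_cintegrable mD _ (rintegrableZ (M * N) mD iw)).
  by apply: cmeasM; [have [] := hu|have [] := hv].
by move=> s Ds; exact: dual_bounds.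
Qed.

Lemma nrm_dual u v M N : bounded_by a u M -> bounded_by b v N -> nrm (dual u v) <= M * N.
Proof.
move=> hu hv.
have := nrm_cint_le mD (dual_integrable hu hv) (rintegrableZ (M * N) mD iw)
  (fun s Ds => dual_bounds hu hv Ds).
by rewrite RintegralZl // intw mulr1.
Qed.

Lemma bounded_byD c u v M N : bounded_by c u M -> bounded_by c v N ->
  bounded_by c (fun s => u s + v s) (M + N).
Proof.
move=> [mu1 hu] [mv hv]; split; first exact: cmeasD.
move=> s Ds; apply: le_trans (nrmD _ _) _.
by rewrite mulrDl; apply: lerD; [exact: hu|exact: hv].
Qed.

Lemma bounded_byN c u M : bounded_by c u M -> bounded_by c (fun s => - u s) M.
Proof.
move=> [mu1 hu]; split; first exact: cmeasN.
by move=> s Ds; rewrite nrmN; exact: hu.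
Qed.

Lemma bounded_byB c u v M N : bounded_by c u M -> bounded_by c v N ->
  bounded_by c (fun s => u s - v s) (M + N).
Proof. by move=> hu hv; apply: bounded_byD => //; exact: bounded_byN. Qed.

Lemma bounded_byZ c u M z : bounded_by c u M -> bounded_by c (fun s => z * u s) (nrm z * M).
Proof.
move=> [mu1 hu]; split; first by apply: cmeasM => //; exact: cmeas_cst.
move=> s Ds; apply: le_trans (nrmM _ _) _.
by rewrite -mulrA ler_wpM2l ?nrm_ge0 //; exact: hu.
Qed.

Lemma bounded_by_le c u M N : (forall s, D s -> 0 < c s) ->
  bounded_by c u M -> M <= N -> bounded_by c u N.
Proof.
move=> c0 [mu1 hu] MN; split => // s Ds; apply: le_trans (hu s Ds) _.
by rewrite ler_wpM2r // ltW // c0.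
Qed.

Lemma bounded_by0 (c : R -> R) : bounded_by c (fun=> 0) 0.
Proof. by split; [exact: cmeas_cst|move=> s _; rewrite nrm0 mul0r]. Qed.

Lemma bounded_by_sum (I : Type) (r : seq I) c (F : I -> R -> C) (N : I -> R) :
  (forall i, bounded_by c (F i) (N i)) ->
  bounded_by c (fun s => \sum_(i <- r) F i s) (\sum_(i <- r) N i).
Proof.
move=> h; elim: r => [|i r IH].
  by under eq_fun do rewrite big_nil; rewrite big_nil; exact: bounded_by0.
by under eq_fun do rewrite big_cons; rewrite big_cons; exact: bounded_byD.
Qed.

Lemma bounded_ba u M : 0 <= M -> bounded_by b u M -> bounded_by a u M.
Proof.
move=> M0 [mu1 hu]; split => // s Ds; apply: le_trans (hu s Ds) _.
by rewrite ler_wpM2l // b_le_a.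
Qed.

Lemma kernel_row k M s : kernel_bound k M -> D s -> bounded_by b (k s) (M * b s).
Proof.
move=> [mk hk] Ds; split.
  by apply: (cmeas_comp mk (g := fun t => (s, t))); exact: pair1_measurable.
by move=> t Dt; rewrite -mulrA; exact: hk.
Qed.

Lemma op_integrable k u M N s : kernel_bound k M -> bounded_by a u N -> D s ->
  cintegrable D (fun t => k s t * u t).
Proof.
move=> hk hu Ds; have := dual_integrable hu (kernel_row hk Ds).
by under eq_fun do rewrite mulrC.
Qed.

Lemma op_dual k u s : op k u s = dual u (k s).
Proof. by apply: eq_cint => t _; rewrite mulrC. Qed.

Lemma cmeas_op k u : cmeas (fun p : R * R => k p.1 p.2) -> cmeas u -> cmeas (op k u).
Proof.
move=> mk mu1; apply: (@cmeas_cint _ _ _ _ (fun p : R * R => k p.1 p.2 * u p.2)) => //.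
apply: cmeasM => //; apply: (cmeas_comp mu1); exact: measurable_snd.
Qed.

(** A kernel dominated by [b s * b t] sends the growing weight [a] to the decaying weight [b]; since
    [a * b] has integral 1, the constants simply multiply. *)
Lemma bounded_op k u M N : kernel_bound k M -> bounded_by a u N ->
  bounded_by b (op k u) (M * N).
Proof.
move=> hk hu; split; first by apply: cmeas_op; [have [] := hk|have [] := hu].
move=> s Ds; rewrite op_dual; apply: le_trans (nrm_dual hu (kernel_row hk Ds)) _.
by rewrite mulrCA mulrA.
Qed.

Lemma opD k u v M N P s : kernel_bound k M -> bounded_by a u N -> bounded_by a v P -> D s ->
  op k (fun t => u t + v t) s = op k u s + op k v s.
Proof.
move=> hk hu hv Ds; rewrite /op -cintD //; [|exact: op_integrable hk hu Ds|exact: op_integrable hk hv Ds].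
by apply: eq_cint => t _; rewrite mulrDr.
Qed.

Lemma opZ k u M N z s : kernel_bound k M -> bounded_by a u N -> D s ->
  op k (fun t => z * u t) s = z * op k u s.
Proof.
move=> hk hu Ds; rewrite /op -cintZ //; last exact: op_integrable hk hu Ds.
by apply: eq_cint => t _; rewrite mulrCA.
Qed.

Lemma opB k u v M N P s : kernel_bound k M -> bounded_by a u N -> bounded_by a v P -> D s ->
  op k (fun t => u t - v t) s = op k u s - op k v s.
Proof.
move=> hk hu hv Ds; rewrite /op -cintB //; [|exact: op_integrable hk hu Ds|exact: op_integrable hk hv Ds].
by apply: eq_cint => t _; rewrite mulrBr.
Qed.

Lemma op_sum (I : Type) (r : seq I) k (F : I -> R -> C) (N : I -> R) M s :
  kernel_bound k M -> (forall i, bounded_by a (F i) (N i)) -> D s ->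
  op k (fun t => \sum_(i <- r) F i t) s = \sum_(i <- r) op k (F i) s.
Proof.
move=> hk hF Ds; rewrite -cint_sum //; last first.
  by move=> i; exact: op_integrable hk (hF i) Ds.
by apply: eq_cint => t _; rewrite mulr_sumr.
Qed.

Lemma eq_op k u v s : (forall t, D t -> u t = v t) -> op k u s = op k v s.
Proof. by move=> e; apply: eq_cint => t Dt; rewrite e. Qed.

Lemma opBl k l u M N P s : kernel_bound k M -> kernel_bound l N -> bounded_by a u P -> D s ->
  op (fun s t => k s t - l s t) u s = op k u s - op l u s.
Proof.
move=> hk hl hu Ds; rewrite /op -cintB //; [|exact: op_integrable hk hu Ds|exact: op_integrable hl hu Ds].
by apply: eq_cint => t _; rewrite mulrBl.
Qed.

Lemma dualDl u u' v M M' N : bounded_by a u M -> bounded_by a u' M' -> bounded_by b v N ->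
  dual (fun s => u s + u' s) v = dual u v + dual u' v.
Proof.
move=> hu hu' hv; rewrite /dual -cintD //; [|exact: dual_integrable hu hv|exact: dual_integrable hu' hv].
by apply: eq_cint => s _; rewrite mulrDl.
Qed.

Lemma dualBl u u' v M M' N : bounded_by a u M -> bounded_by a u' M' -> bounded_by b v N ->
  dual (fun s => u s - u' s) v = dual u v - dual u' v.
Proof.
move=> hu hu' hv; rewrite /dual -cintB //; [|exact: dual_integrable hu hv|exact: dual_integrable hu' hv].
by apply: eq_cint => s _; rewrite mulrBl.
Qed.

Lemma dualBr u v v' M N N' : bounded_by a u M -> bounded_by b v N -> bounded_by b v' N' ->
  dual u (fun s => v s - v' s) = dual u v - dual u v'.
Proof.
move=> hu hv hv'; rewrite /dual -cintB //; [|exact: dual_integrable hu hv|exact: dual_integrable hu hv'].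
by apply: eq_cint => s _; rewrite mulrBr.
Qed.

Lemma dualZl u v M N z : bounded_by a u M -> bounded_by b v N ->
  dual (fun s => z * u s) v = z * dual u v.
Proof.
move=> hu hv; rewrite /dual -cintZ //; last exact: dual_integrable hu hv.
by apply: eq_cint => s _; rewrite mulrA.
Qed.

Lemma dualZr u v M N z : bounded_by a u M -> bounded_by b v N ->
  dual u (fun s => z * v s) = z * dual u v.
Proof.
move=> hu hv; rewrite /dual -cintZ //; last exact: dual_integrable hu hv.
by apply: eq_cint => s _; rewrite mulrCA.
Qed.

Lemma op_fubini k u v M N P : 0 <= M -> 0 <= N -> 0 <= P ->
  kernel_bound k M -> bounded_by a u N -> bounded_by a v P ->
  cint D (fun s => op k u s * v s) = cint D (fun t => u t * cint D (fun s => k s t * v s)).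
Proof.
move=> M0 N0 P0 hk hu hv; have [mk bk] := hk; have [mu1 bu] := hu; have [mv bv] := hv.
have E1 : cint D (fun s => op k u s * v s) = cint D (fun s => cint D (fun t => k s t * u t * v s)).
  apply: eq_cint => s Ds; rewrite mulrC -cintZ //; last exact: op_integrable hk hu Ds.
  by apply: eq_cint => t _; rewrite mulrC.
have E2 : cint D (fun t => u t * cint D (fun s => k s t * v s)) =
          cint D (fun t => cint D (fun s => k s t * u t * v s)).
  apply: eq_cint => t Dt; rewrite -cintZ //.
    by apply: eq_cint => s _; rewrite mulrA (mulrC (u t)).
  apply: (dom_cintegrable mD _ (rintegrableZ (M * b t * P) mD iw)).
    apply: cmeasM => //; apply: (cmeas_comp mk (g := fun s => (s, t))); exact: pair2_measurable.
  move=> s Ds; apply: le_trans (nrmM _ _) _.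
  rewrite (_ : _ * (a s * b s) = M * (b s * b t) * (P * a s)); last by ring.
  by apply: ler_pM; rewrite ?nrm_ge0 ?bk ?bv.
rewrite E1 E2.
apply: (@cint_fubini _ D (fun p : R * R => k p.1 p.2 * u p.2 * v p.1) (fun s => a s * b s) (M * N * P)) => //.
- apply: cmeasM; [apply: cmeasM => //|].
    by apply: (cmeas_comp mu1); exact: measurable_snd.
  by apply: (cmeas_comp mv); exact: measurable_fst.
- by move=> s Ds; rewrite mulr_ge0 // ltW // ?a_gt0 ?b_gt0.
- by rewrite !mulr_ge0.
- move=> s t Ds Dt /=; apply: le_trans (nrmM _ _) _.
  rewrite (_ : M * N * P * _ = (M * (b s * b t)) * (N * a t) * (P * a s)); last by ring.
  apply: ler_pM; rewrite ?nrm_ge0 ?bv //; apply: le_trans (nrmM _ _) _.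
  by apply: ler_pM; rewrite ?nrm_ge0 ?bk ?bu.
Qed.

Lemma op_sym k u v M N P : 0 <= M -> 0 <= N -> 0 <= P -> (forall s t, k s t = k t s) ->
  kernel_bound k M -> bounded_by a u N -> bounded_by a v P ->
  dual (op k u) v = dual u (op k v).
Proof.
move=> M0 N0 P0 ks hk hu hv; rewrite /dual (op_fubini M0 N0 P0 hk hu hv).
by apply: eq_cint => t _; congr (_ * _); apply: eq_cint => s _; rewrite ks.
Qed.

(** [K] bounds the inverse of [1 - op k] on the space of weight [a]; it is recorded because
    perturbation of the kernel needs it uniformly in the parameter. *)
Definition solvable k K := [/\ 0 <= K,
  forall g M, bounded_by a g M -> exists2 u, bounded_by a u (K * M) &
    forall s, D s -> u s - op k u s = g s &
  forall u M, bounded_by a u M -> (forall s, D s -> u s = op k u s) -> forall s, D s -> u s = 0].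


Definition wt s := a s * b s.

Definition all_in (s : seq R) := forall t, t \in s -> D t.

(** Joint measurability in [n] real variables for a function of lists: it is tested on all
    measurable families of lists of length [n], so that variables can be inserted and removed
    freely. *)
Definition seq_meas n (G : seq R -> C) := forall d (T : measurableType d) (F : T -> seq R),
  (forall t, size (F t) = n) -> (forall i, measurable_fun setT (fun t => (F t)`_i)) ->
  cmeas (fun t => G (F t)).

Definition tame n M (G : seq R -> C) := seq_meas n G /\
  forall s, size s = n -> all_in s -> nrm (G s) <= M * \prod_(t <- s) wt t.

Local Notation I n G := (iterated_int n D G).

Lemma wt_ge0 s : D s -> 0 <= wt s.
Proof. by move=> Ds; rewrite /wt mulr_ge0 // ltW // ?a_gt0 ?b_gt0. Qed.

Lemma prod_wt_ge0 s : all_in s -> 0 <= \prod_(t <- s) wt t.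
Proof. by move=> h; rewrite big_seq; apply: prodr_ge0 => t ts; apply: wt_ge0; exact: h. Qed.

Lemma all_in_cons t s : D t -> all_in s -> all_in (t :: s).
Proof. by move=> Dt h u; rewrite inE => /predU1P[->|/h]. Qed.

Lemma all_in_nth s i : all_in s -> (i < size s)%N -> D s`_i.
Proof. by move=> h si; apply: h; rewrite mem_nth. Qed.

Lemma tame_cons n M G t : tame n.+1 M G -> D t -> tame n (M * wt t) (fun s => G (t :: s)).
Proof.
move=> [mG bG] Dt; split.
  move=> d T F sF mF; apply: mG => [u|[|i]] /=; [by rewrite sF|exact: measurable_cst|exact: mF].
move=> s ss Ds; apply: le_trans (bG _ _ _) _; rewrite /= ?ss //; first exact: all_in_cons.
by rewrite big_cons mulrA.
Qed.

(** The integrand carries a parameter in an arbitrary space, because each integration turns its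
    variable into one more parameter for the induction. *)
Lemma iter_meas n d (T : measurableType d) (G : T -> seq R -> C) :
  (forall d' (T' : measurableType d') (p : T' -> T) (F : T' -> seq R),
    measurable_fun setT p -> (forall t, size (F t) = n) ->
    (forall i, measurable_fun setT (fun t => (F t)`_i)) -> cmeas (fun t => G (p t) (F t))) ->
  cmeas (fun t => I n (G t)).
Proof.
elim: n d T G => [|n IH] d T G h /=.
  by apply: (h _ _ id (fun=> [::])) => // i; rewrite nth_nil.
apply: (@cmeas_cint R _ _ _ (fun p : T * R => I n (fun s => G p.1 (p.2 :: s)))) => //.
apply: IH => d' T' p F mp sF mF; apply: (h _ _ (fst \o p) (fun t => (p t).2 :: F t)).
- exact: measurableT_comp.
- by move=> t /=; rewrite sF.
- by case=> [|i] /=; [exact: measurableT_comp|exact: mF].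
Qed.

Lemma iter_cons_meas n M G : tame n.+1 M G -> cmeas (fun t => I n (fun s => G (t :: s))).
Proof.
move=> [mG _]; apply: iter_meas => d T p F mp sF mF.
by apply: mG => [t|[|i]] /=; rewrite ?sF.
Qed.

Lemma nrm_iter n M G : tame n M G -> nrm (I n G) <= M.
Proof.
elim: n M G => [|n IH] M G hG /=.
  by have := hG.2 [::] erefl (fun t => ltac:(by [])); rewrite big_nil mulr1.
have bt t : D t -> nrm (I n (fun s => G (t :: s))) <= M * wt t.
  by move=> Dt; apply: IH; exact: tame_cons.
have iM := rintegrableZ M mD iw.
have := nrm_cint_le mD (dom_cintegrable mD (iter_cons_meas hG) iM bt) iM bt.
by rewrite RintegralZl // intw mulr1.
Qed.

Lemma iter_cons_integrable n M G : tame n.+1 M G ->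
  cintegrable D (fun t => I n (fun s => G (t :: s))).
Proof.
move=> hG; apply: (dom_cintegrable mD (iter_cons_meas hG) (rintegrableZ M mD iw)).
by move=> t Dt; apply: nrm_iter; exact: tame_cons.
Qed.

Lemma eq_iter n G H : (forall s, size s = n -> all_in s -> G s = H s) -> I n G = I n H.
Proof.
elim: n G H => [|n IH] G H e /=; first exact: e.
apply: eq_cint => t Dt; apply: IH => s ss Ds; apply: e; rewrite /= ?ss //.
exact: all_in_cons.
Qed.

Lemma iterD n M N G H : tame n M G -> tame n N H -> I n (fun s => G s + H s) = I n G + I n H.
Proof.
elim: n M N G H => [|n IH] M N G H hG hH //=.
rewrite -cintD //; [|exact: iter_cons_integrable hG|exact: iter_cons_integrable hH].
by apply: eq_cint => t Dt; exact: IH (tame_cons hG Dt) (tame_cons hH Dt).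
Qed.

Lemma iterZ n M G z : tame n M G -> I n (fun s => z * G s) = z * I n G.
Proof.
elim: n M G => [|n IH] M G hG //=.
rewrite -cintZ //; last exact: iter_cons_integrable hG.
by apply: eq_cint => t Dt; exact: IH (tame_cons hG Dt).
Qed.

Lemma tame0 n : tame n 0 (fun=> 0).
Proof. by split => [d T F _ _|s _ _]; [exact: cmeas_cst|rewrite nrm0 mul0r]. Qed.

Lemma tameD n M N G H : tame n M G -> tame n N H -> tame n (M + N) (fun s => G s + H s).
Proof.
move=> [mG bG] [mH bH]; split => [d T F sF mF|s ss Ds].
  by apply: cmeasD; [exact: mG|exact: mH].
by apply: le_trans (nrmD _ _) _; rewrite mulrDl; apply: lerD; [exact: bG|exact: bH].
Qed.

Lemma tameZ n M G z : tame n M G -> tame n (nrm z * M) (fun s => z * G s).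
Proof.
move=> [mG bG]; split => [d T F sF mF|s ss Ds].
  by apply: cmeasM; [exact: cmeas_cst|exact: mG].
by apply: le_trans (nrmM _ _) _; rewrite -mulrA ler_wpM2l ?nrm_ge0 //; exact: bG.
Qed.

Lemma tame_sum n (J : Type) (r : seq J) M (G : J -> seq R -> C) : (forall j, tame n (M j) (G j)) ->
  tame n (\sum_(j <- r) M j) (fun s => \sum_(j <- r) G j s).
Proof.
move=> h; elim: r => [|j r IH].
  rewrite (_ : (fun s => _) = (fun=> 0)) ?big_nil; first exact: tame0.
  by apply/funext => s; rewrite big_nil.
rewrite (_ : (fun s => _) = (fun s => G j s + \sum_(i <- r) G i s)) ?big_cons; first exact: tameD.
by apply/funext => s; rewrite big_cons.
Qed.

Lemma iter_sum n (J : Type) (r : seq J) M (G : J -> seq R -> C) : (forall j, tame n (M j) (G j)) ->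
  I n (fun s => \sum_(j <- r) G j s) = \sum_(j <- r) I n (G j).
Proof.
move=> h; elim: r => [|j r IH].
  rewrite big_nil -[RHS](mul0r (I n (fun=> 0))) -(iterZ _ (tame0 n)).
  by apply: eq_iter => s _ _; rewrite big_nil mul0r.
rewrite big_cons -IH -(iterD (h j) (tame_sum r h)).
by apply: eq_iter => s _ _; rewrite big_cons.
Qed.

Definition insert i (u : R) (s : seq R) := take i s ++ u :: drop i s.

Definition remove i (s : seq R) := take i s ++ drop i.+1 s.

Lemma size_insert i (u : R) s : size (insert i u s) = (size s).+1.
Proof. by rewrite size_cat /= addnS -size_cat cat_take_drop. Qed.

Lemma nth_insert i (u : R) s j : (i <= size s)%N ->
  (insert i u s)`_j = if (j < i)%N then s`_j else if j == i then u else s`_j.-1.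
Proof.
move=> is_; rewrite nth_cat size_takel //.
case: ltnP => ji; first by rewrite nth_take.
case: eqVneq => [->|ne]; first by rewrite subnn.
have ij : (i < j)%N by rewrite ltn_neqAle eq_sym ne.
rewrite -(subnKC ij) addSn subSn ?leq_addr // addKn /= nth_drop; congr nth.
Qed.

Lemma nth_remove i s j : (i < size s)%N -> (remove i s)`_j = s`_(bump i j).
Proof.
move=> is_; rewrite nth_cat (size_takel (ltnW is_)) /bump.
case: (ltnP j i) => ji; first by rewrite nth_take.
by rewrite nth_drop addSn subnKC.
Qed.

Lemma mem_insert i (u : R) s t : t \in insert i u s = (t == u) || (t \in s).
Proof.
by rewrite mem_cat inE -[in RHS](cat_take_drop i s) mem_cat orbCA.
Qed.

Lemma prod_insert i (u : R) s : \prod_(t <- insert i u s) wt t = wt u * \prod_(t <- s) wt t.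
Proof. by rewrite big_cat big_cons /= -[in RHS](cat_take_drop i s) big_cat /= mulrCA. Qed.

Lemma insert_meas n d (T : measurableType d) (F : T -> seq R) (u : T -> R) i : (i <= n)%N ->
  (forall t, size (F t) = n) -> (forall i, measurable_fun setT (fun t => (F t)`_i)) ->
  measurable_fun setT u -> forall j, measurable_fun setT (fun t => (insert i (u t) (F t))`_j).
Proof.
move=> i_n sF mF mu1 j.
have -> : (fun t => (insert i (u t) (F t))`_j) =
   (fun t => if (j < i)%N then (F t)`_j else if j == i then u t else (F t)`_j.-1).
  by apply/funext => t; rewrite nth_insert // sF.
by case: (j < i)%N => //; case: (j == i).
Qed.

Lemma tame_insert n M G (u : R) i : (i <= n)%N -> tame n.+1 M G -> D u ->
  tame n (M * wt u) (fun s => G (insert i u s)).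
Proof.
move=> i_n [mG bG] Du; split => [d T F sF mF|s ss Ds].
  by apply: mG => [t|j]; [rewrite size_insert sF|apply: (insert_meas i_n sF mF)].
rewrite -mulrA -(prod_insert i); apply: bG; first by rewrite size_insert ss.
by move=> t; rewrite mem_insert => /orP[/eqP ->//|]; exact: Ds.
Qed.

(** Fubini's theorem, once for each variable in front, lets the variable at position [i] be
    integrated outermost. The terms in the expansion of a minor, which single out different
    variables, thus acquire the same integral. *)
Lemma iter_insert n M G i : 0 <= M -> (i <= n)%N -> tame n.+1 M G ->
  I n.+1 G = cint D (fun u : R => I n (fun s => G (insert i u s))).
Proof.
have base m H : I m.+1 H = cint D (fun u : R => I m (fun s => H (insert 0 u s))).
  by apply: eq_cint => u _; apply: eq_iter => s _ _; rewrite /insert take0 drop0.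
elim: n M G i => [|n IH] M G i M0.
  by rewrite leqn0 => /eqP -> _; exact: base.
case: i => [|i]; first by move=> _ _; exact: base.
rewrite ltnS => i_n hG.
have -> : I n.+2 G = cint D (fun t => cint D (fun u : R => I n (fun s => G (t :: insert i u s)))).
  apply: eq_cint => t Dt.
  by apply: IH (tame_cons hG Dt) => //; rewrite mulr_ge0 // wt_ge0.
have -> : cint D (fun u : R => I n.+1 (fun s => G (insert i.+1 u s))) =
  cint D (fun u : R => cint D (fun t => I n (fun s => G (t :: insert i u s)))) by [].
apply: (@cint_fubini _ D (fun p : R * R => I n (fun s => G (p.1 :: insert i p.2 s))) wt M) => //.
- apply: iter_meas => d T p F mp sF mF; apply: hG.1 => [t|[|j]] /=.
  + by rewrite size_insert sF.
  + exact: measurableT_comp.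
  + by apply: (insert_meas i_n sF mF); exact: measurableT_comp.
- by move=> s; exact: wt_ge0.
- move=> t u Dt Du /=; rewrite mulrA.
  by apply: nrm_iter; apply: tame_insert (tame_cons hG Dt) Du.
Qed.


(** * Fredholm's first minors *)

Section Minors.
Variables (k : R -> R -> C) (kappa : R).
Hypothesis kappa0 : 0 <= kappa.
Hypothesis hk : kernel_bound k kappa.

Let mk : cmeas (fun p : R * R => k p.1 p.2). Proof. by have [] := hk. Qed.

Definition kmat n (r c : seq R) : 'M[C]_n := \matrix_(i, j) k r`_i c`_j.

(** Fredholm's determinant with rows [x, s] and columns [y, s]; its integrals over [s], multiplied
    by [sign_fact], are the terms of the first minor. *)
Definition minor n x y s := \det (kmat n.+1 (x :: s) (y :: s)).

Lemma det_kmat_meas d (T : measurableType d) n (r c : T -> seq R) :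
  (forall i, measurable_fun setT (fun t => (r t)`_i)) ->
  (forall i, measurable_fun setT (fun t => (c t)`_i)) ->
  cmeas (fun t => \det (kmat n (r t) (c t))).
Proof.
move=> mr mc.
have mij (i j : 'I_n) : cmeas (fun t => kmat n (r t) (c t) i j).
  rewrite (_ : (fun t => _) = (fun t => k (r t)`_i (c t)`_j)).
    apply: (cmeas_comp mk (g := fun t => ((r t)`_i, (c t)`_j))); exact: measurable_fun_pair.
  by apply/funext => t; rewrite mxE.
rewrite /determinant; apply: cmeas_sum => s.
by apply: cmeasM; [exact: cmeas_cst|apply: cmeas_prod => i; exact: mij].
Qed.

Lemma prod_nth (r : seq R) n (f : R -> C) : size r = n ->
  \prod_(i < n) f r`_i = \prod_(t <- r) f t.
Proof. by move=> <-; rewrite (big_nth 0) big_mkord. Qed.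

Lemma det_kmat_bound : exists2 P, 0 <= P & forall n r c,
  size r = n.+1 -> size c = n.+1 -> all_in r -> all_in c ->
  nrm (\det (kmat n.+1 r c)) <=
    P * 2^-1 ^+ n * n`!%:R * ((\prod_(t <- r) b t) * \prod_(t <- c) b t).
Proof.
have [P P0 hP] := hadamard_decay kappa0.
exists P => // n r c sr sc Dr Dc.
(* Dividing the rows and columns by their weights [b] makes every entry at most [kappa]; the weights
   come back as the two products. *)
pose M : 'M[C]_n.+1 := \matrix_(i, j) (((b r`_i)^-1 * (b c`_j)^-1)%:C * k r`_i c`_j).
have bp s (i : 'I_n.+1) : size s = n.+1 -> all_in s -> 0 < b s`_i.
  by move=> ss Ds; apply: b_gt0; apply: all_in_nth => //; rewrite ss.
have hM : forall i j, nrm (M i j) <= kappa.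
  move=> i j; rewrite mxE nrmMr.
  have bi := bp r i sr Dr; have bj := bp c j sc Dc.
  rewrite ger0_norm; last by rewrite mulr_ge0 // invr_ge0 ltW.
  rewrite mulrC -invfM ler_pdivrMr ?mulr_gt0 //.
  by apply: hk.2; apply: all_in_nth => //; rewrite ?sr ?sc.
have -> : \det (kmat n.+1 r c) = ((\prod_(t <- r) b t) * \prod_(t <- c) b t)%:C * \det M.
  have -> : kmat n.+1 r c = diag_mx (\row_i (b r`_i)%:C) *m M *m diag_mx (\row_j (b c`_j)%:C).
    apply/matrixP => i j; rewrite mul_mx_diag mul_diag_mx !mxE.
    have bi := bp r i sr Dr; have bj := bp c j sc Dc.
    transitivity ((b r`_i * ((b r`_i)^-1 * (b c`_j)^-1) * b c`_j)%:C * k r`_i c`_j).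
      by rewrite (_ : _ * _ * _ = 1) ?mul1r //; field; rewrite !gt_eqF.
    by rewrite !rmorphM /=; ring.
  rewrite !det_mulmx !det_diag.
  have pE s : size s = n.+1 -> \prod_(i < n.+1) (\row_j (b s`_j)%:C) 0 i = (\prod_(t <- s) b t)%:C.
    move=> ss; transitivity (\prod_(i < n.+1) (b s`_i)%:C).
      by apply: eq_bigr => i _; rewrite mxE.
    by rewrite (prod_nth (fun t => (b t)%:C) ss) rmorph_prod.
  by rewrite !pE // rmorphM /=; ring.
have pp s : all_in s -> 0 <= \prod_(t <- s) b t.
  by move=> Ds; rewrite big_seq; apply: prodr_ge0 => t ts; apply: ltW; apply: b_gt0; exact: Ds.
rewrite nrmMr ger0_norm; last by rewrite mulr_ge0 // pp.
by rewrite mulrC ler_wpM2r ?mulr_ge0 ?pp //; exact: hP.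
Qed.

Lemma prod_b2_le s : all_in s -> (\prod_(t <- s) b t) * \prod_(t <- s) b t <= \prod_(t <- s) wt t.
Proof.
move=> Ds; rewrite -big_split /= !big_seq; apply: ler_prod => t ts.
have Dt := Ds t ts; have b0 := ltW (b_gt0 Dt).
by rewrite mulr_ge0 //= /wt ler_wpM2r // b_le_a.
Qed.

Lemma minor_tame : exists2 P, 0 <= P & forall n x y, D x -> D y ->
  tame n (P * 2^-1 ^+ n * n`!%:R * (b x * b y)) (minor n x y).
Proof.
have [P P0 hP] := det_kmat_bound; exists P => // n x y Dx Dy; split.
  by move=> d T F sF mF; apply: det_kmat_meas => -[|i] //=.
move=> s ss Ds; rewrite /minor.
apply: le_trans (hP _ _ _ _ _ _ _) _; rewrite /= ?ss //; try exact: all_in_cons.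
rewrite !big_cons [X in _ * X <= _]mulrACA -[leRHS]mulrA.
rewrite ler_wpM2l ?mulr_ge0 ?exprn_ge0 // ler_wpM2l ?prod_b2_le //.
by rewrite mulr_ge0 // ltW // b_gt0.
Qed.

Lemma principal_tame : exists2 P, 0 <= P & forall n,
  tame n (P * 2^-1 ^+ n * n`!%:R) (fun s => \det (kmat n s s)).
Proof.
have [P P0 hP] := det_kmat_bound; exists (2 * P + 1); first by rewrite addr_ge0 // mulr_ge0.
move=> n; split; first by move=> d T F sF mF; exact: det_kmat_meas.
case: n => [|n] s ss Ds.
  move/size0nil: ss => ->; rewrite det_mx00 nrm1 big_nil expr0 fact0 !mulr1; lra.
apply: le_trans (hP _ _ _ ss ss Ds Ds) _.
have p0 := prod_wt_ge0 Ds; have p1 := prod_b2_le Ds.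
have f1 : (n`!%:R : R) <= n.+1`!%:R by rewrite ler_nat factS leq_pmull.
have h0 : 0 <= 2^-1 ^+ n :> R by rewrite exprn_ge0.
apply: ler_pM => //; rewrite ?mulr_ge0 //.
  by rewrite big_seq; apply: prodr_ge0 => t ts; apply: ltW; apply: b_gt0; exact: Ds.
  by rewrite big_seq; apply: prodr_ge0 => t ts; apply: ltW; apply: b_gt0; exact: Ds.
apply: ler_pM => //; rewrite ?mulr_ge0 // exprS mulrA; apply: ler_wpM2r => //; lra.
Qed.

(* Expansion along the column of y; in the i-th term the column of s_i is moved
   to the front, at the cost of a sign. *)
Lemma minor_expand n x y s : size s = n.+1 ->
  minor n.+1 x y s = k x y * \det (kmat n.+1 s s) -
    \sum_(i < n.+1) k s`_i y * minor n x s`_i (remove i s).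
Proof.
move=> ss; rewrite /minor (expand_det_col _ 0) big_ord_recl; congr (_ + _).
  rewrite mxE /=; congr (_ * _); rewrite /cofactor /= expr0 mul1r; congr (\det _).
  by apply/matrixP => i j; rewrite !mxE.
rewrite -sumrN; apply: eq_bigr => i _; rewrite mxE /= -mulrN; congr (_ * _).
have si : (i < size s)%N by rewrite ss.
rewrite /cofactor /= addn0.
set L := row' _ _; set B := kmat _ _ _.
have -> : \det L = (-1) ^+ i * \det B; last first.
  by rewrite mulrA -exprD addSn addnn exprS -mul2n exprM sqrrN expr1n expr1n mulr1 mulN1r.
rewrite (expand_det_col L i) (expand_det_col B 0) mulr_sumr; apply: eq_bigr => r _.
have rowE m : (x :: s)`_(bump i.+1 m) = (x :: remove i s)`_m.
  case: m => [|m] //=; rewrite nth_remove // /bump ltnS.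
  by case: (i <= m)%N.
have Lr : L r i = B r 0 by rewrite !mxE /=; congr (k _ _); exact: rowE.
rewrite Lr [RHS]mulrCA; congr (B r 0 * _); rewrite /cofactor.
rewrite addn0 mulrA -exprD addnC; congr (_ * \det _).
apply/matrixP => p q; rewrite !mxE /=; congr (k _ _); first exact: rowE.
by rewrite nth_remove.
Qed.


Definition sign_fact n : C := (-1) ^+ n / n`!%:R.

Definition fredholm_coef n := sign_fact n * I n (fun s => \det (kmat n s s)).

Definition minor_int n x y := I n (minor n x y).

Definition minor_op n g x := sign_fact n * op (minor_int n) g x.

Lemma nrm_sign_fact n : nrm (sign_fact n) = (n`!%:R)^-1.
Proof.
have -> : sign_fact n = ((-1) ^+ n / n`!%:R)%:C.
  rewrite /sign_fact rmorphM /= rmorphXn rmorphN1 fmorphV /=; congr (_ / _).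
  by rewrite rmorph_nat.
by rewrite nrm_real normrM normrX normrN1 expr1n mul1r ger0_norm // invr_ge0.
Qed.

Lemma minor_int_bound : exists2 P, 0 <= P & forall n, kernel_bound (minor_int n) (P * 2^-1 ^+ n * n`!%:R).
Proof.
have [P P0 hP] := minor_tame; exists P => // n; split; last first.
  by move=> x y Dx Dy; exact: nrm_iter (hP n x y Dx Dy).
apply: (@iter_meas n _ _ (fun p => minor n p.1 p.2)) => d T p F mp sF mF.
apply: det_kmat_meas => -[|i] //=; exact: measurableT_comp.
Qed.

Lemma prod_remove i s : (i < size s)%N ->
  \prod_(t <- s) wt t = wt s`_i * \prod_(t <- remove i s) wt t.
Proof.
move=> si; rewrite -[in LHS](cat_take_drop i s) (drop_nth 0 si) big_cat big_cons /=.
by rewrite /remove big_cat /= mulrCA.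
Qed.

Lemma mem_remove i s t : t \in remove i s -> t \in s.
Proof. by rewrite mem_cat => /orP[/mem_take|/mem_drop]. Qed.

Lemma size_remove n i s : size s = n.+1 -> (i < n.+1)%N -> size (remove i s) = n.
Proof.
move=> ss si; rewrite size_cat size_takel; last by rewrite ss ltnW.
by rewrite size_drop ss subSS subnKC.
Qed.

(** Integration of [minor_expand]: by [iter_insert] the [n.+1] terms of its sum have equal
    integrals. *)
Lemma minor_int_rec n x y : D x -> D y -> minor_int n.+1 x y =
  k x y * I n.+1 (fun s => \det (kmat n.+1 s s)) -
  n.+1%:R * cint D (fun u : R => k u y * minor_int n x u).
Proof.
move=> Dx Dy.
have [P P0 hP] := minor_tame; have [Q Q0 hQ] := principal_tame.
pose B (i : 'I_n.+1) s := k s`_i y * minor n x s`_i (remove i s).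
pose M := kappa * b y * (P * 2^-1 ^+ n * n`!%:R * b x).
have M0 : 0 <= M by rewrite !mulr_ge0 // ?exprn_ge0 // ltW // b_gt0.
have tB i : tame n.+1 M (B i).
  split.
    move=> d T F sF mF; apply: cmeasM.
      by apply: (cmeas_comp mk (g := fun t => ((F t)`_i, y))); exact: measurable_fun_pair.
    have mr j : measurable_fun setT (fun t => (remove i (F t))`_j).
      rewrite (_ : (fun t => _) = (fun t => (F t)`_(bump i j))) //.
      by apply/funext => t; rewrite nth_remove // sF.
    by apply: det_kmat_meas => -[|j] //=.
  move=> s ss Ds; have si : (i < size s)%N by rewrite ss.
  have Di := all_in_nth Ds si.
  have Dr : all_in (remove i s) by move=> t /mem_remove; exact: Ds.
  have w0 := prod_wt_ge0 Dr; have b0 := ltW (b_gt0 Di).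
  apply: le_trans (nrmM _ _) _.
  apply: le_trans (ler_pM (nrm_ge0 _) (nrm_ge0 _) (hk.2 _ _ Di Dy) ((hP n _ _ Dx Di).2 _ (size_remove ss (ltn_ord i)) Dr)) _.
  rewrite (prod_remove si).
  rewrite [leLHS](_ : _ = M * ((b s`_i * b s`_i) * \prod_(t <- remove i s) wt t)); last by rewrite /M; set e := 2^-1 ^+ n; ring.
  rewrite ler_wpM2l // ler_wpM2r // /wt ler_wpM2r // b_le_a //.
rewrite /minor_int (eq_iter (H := fun s => k x y * \det (kmat n.+1 s s) + (-1) * \sum_(i < n.+1) B i s)); last first.
  by move=> s ss Ds; rewrite minor_expand // mulN1r.
rewrite (iterD (tameZ (k x y) (hQ n.+1)) (tameZ (-1) (tame_sum _ tB))).
rewrite (iterZ _ (hQ n.+1)) (iterZ _ (tame_sum _ tB)) mulN1r; congr (_ - _).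
rewrite (iter_sum _ tB).
have E (i : 'I_n.+1) : I n.+1 (B i) = cint D (fun u : R => k u y * I n (minor n x u)).
  rewrite (iter_insert M0 (leq_ord i) (tB i)); apply: eq_cint => u Du.
  rewrite -(iterZ _ (hP n x u Dx Du)); apply: eq_iter => s ss Ds.
  have is_ : (i <= size s)%N by rewrite ss leq_ord.
  rewrite /B nth_insert // ltnn eqxx; congr (_ * minor _ _ _ _).
  rewrite /remove /insert take_cat drop_cat size_takel // ltnn subnn take0 cats0.
  by rewrite ltnNge leqnSn /= subSnn /= drop0 cat_take_drop.
under eq_bigr do rewrite E.
by rewrite sumr_const card_ord mulr_natl.
Qed.

Lemma minor_op0 g x : minor_op 0 g x = op k g x.
Proof.
rewrite /minor_op /sign_fact expr0 fact0 divr1 mul1r.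
apply: eq_cint => y _; congr (_ * _).
by rewrite /minor_int /= /minor det_mx11 mxE.
Qed.

(** Fredholm's recursion [M_{n+1} = d_{n+1} A + M_n A], with [A = op k], [M_n = minor_op n] and
    [d_n] the coefficients of the determinant: the factor [(-1)^{n+1} / (n+1)!] absorbs the [n.+1]
    and the sign in [minor_int_rec]. *)
Lemma minor_op_rec n g M x : 0 <= M -> bounded_by a g M -> D x ->
  minor_op n.+1 g x = fredholm_coef n.+1 * op k g x + minor_op n (op k g) x.
Proof.
move=> M0 hg Dx; have [P P0 hP] := minor_int_bound.
set K := P * 2^-1 ^+ n * n`!%:R.
have K0 : 0 <= K by rewrite !mulr_ge0 // exprn_ge0.
have hJ : bounded_by a (minor_int n x) (K * b x).
  by apply: bounded_ba; [rewrite mulr_ge0 // ltW // b_gt0|exact: kernel_row (hP n) Dx].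
have hJb := kernel_row (hP n) Dx.
have Kb0 : 0 <= K * b x by rewrite mulr_ge0 // ltW // b_gt0.
have opg : bounded_by b (op k g) (kappa * M) := bounded_op hk hg.
set d := I n.+1 (fun s => \det (kmat n.+1 s s)).
have i1 : cintegrable D (fun y => d * (k x y * g y)).
  by apply: cintegrableZ => //; exact: op_integrable hk hg Dx.
have E : op (minor_int n.+1) g x = d * op k g x - n.+1%:R * op (minor_int n) (op k g) x.
  have F := op_fubini kappa0 M0 Kb0 hk hg hJ.
  have iF : cintegrable D (fun t : R => g t * cint D (fun s : R => k s t * minor_int n x s)).
    apply: (dual_integrable hg (N := kappa * (K * b x))); split.
      apply: (@cmeas_cint _ _ _ _ (fun p : R * R => k p.2 p.1 * minor_int n x p.2)) => //.
      apply: cmeasM; last by apply: (cmeas_comp hJ.1); exact: measurable_snd.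
      apply: (cmeas_comp mk (g := fun p : R * R => (p.2, p.1))).
      by apply: measurable_fun_pair; [exact: measurable_snd|exact: measurable_fst].
    move=> t Dt.
    have hk' : bounded_by b (fun s => k s t) (kappa * b t).
      split; first by apply: (cmeas_comp mk (g := fun s => (s, t))); exact: pair2_measurable.
      by move=> s Ds; rewrite -mulrA (mulrC (b t)); exact: hk.2.
    have := nrm_dual hJ hk'; rewrite /dual => H.
    rewrite (_ : cint D _ = cint D (fun s : R => minor_int n x s * k s t)); last first.
      by apply: eq_cint => s _; rewrite mulrC.
    by apply: le_trans H _; rewrite le_eqVlt; apply/orP; left; apply/eqP; ring.
  have -> : op (minor_int n) (op k g) x = cint D (fun t : R => g t * cint D (fun s : R => k s t * minor_int n x s)).
    by rewrite -F; apply: eq_cint => s _; rewrite mulrC.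
  rewrite /op -(cintZ d mD (op_integrable hk hg Dx)) -(cintZ _ mD iF) -cintB //; last exact: cintegrableZ.
  by apply: eq_cint => y Dy; rewrite minor_int_rec // -/d; ring.
rewrite /minor_op E /fredholm_coef -/d mulrBr; congr (_ + _); first by rewrite mulrA.
rewrite -mulrN -mulNr mulrA; congr (_ * _).
have f0 : (n`!%:R : C) != 0 by rewrite pnatr_eq0 -lt0n fact_gt0.
have n0 : (n.+1%:R : C) != 0 by rewrite pnatr_eq0.
rewrite /sign_fact factS natrM exprS.
by move: (n.+1%:R : C) (n`!%:R : C) n0 f0 => p q p0 q0; field; rewrite p0 q0.
Qed.

Lemma minor_op_bound : exists2 P, 0 <= P & forall n g M, bounded_by a g M ->
  bounded_by b (minor_op n g) (P * 2^-1 ^+ n * M).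
Proof.
have [P P0 hP] := minor_int_bound; exists P => // n g M hg.
have [m1 h1] := bounded_byZ (sign_fact n) (bounded_op (hP n) hg).
split => // x Dx; apply: le_trans (h1 x Dx) _.
rewrite nrm_sign_fact mulrA (ler_wpM2r (ltW (b_gt0 Dx))) //.
rewrite le_eqVlt; apply/orP; left; apply/eqP.
by field; rewrite pnatr_eq0 -lt0n fact_gt0.
Qed.

Lemma eq_minor_op n g h x : (forall t, D t -> g t = h t) -> minor_op n g x = minor_op n h x.
Proof. by move=> e; congr (_ * _); exact: eq_op. Qed.

(** By the recursion [minor_op n] is a polynomial in [op k], hence commutes with it. *)
Lemma op_minor_op n g M x : 0 <= M -> bounded_by a g M -> D x ->
  minor_op n (op k g) x = op k (minor_op n g) x.
Proof.
elim: n g M x => [|n IH] g M x M0 hg Dx.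
  by rewrite minor_op0; apply: eq_op => t _; rewrite minor_op0.
have [P P0 hP] := minor_op_bound.
have M1 : 0 <= kappa * M by rewrite mulr_ge0.
have hkg := bounded_ba M1 (bounded_op hk hg).
rewrite (minor_op_rec _ M1 hkg Dx) (IH _ _ _ M1 hkg Dx).
have M2 : 0 <= P * 2^-1 ^+ n * (kappa * M) by rewrite !mulr_ge0 // exprn_ge0.
rewrite -(opZ _ hk hkg Dx) -(opD hk (bounded_byZ _ hkg) (bounded_ba M2 (hP n _ _ hkg)) Dx).
by apply: eq_op => t Dt; rewrite (minor_op_rec _ M0 hg Dt).
Qed.

Lemma fredholm_coef0 : fredholm_coef 0 = 1.
Proof. by rewrite /fredholm_coef /sign_fact expr0 fact0 divr1 mul1r /= det_mx00. Qed.

Lemma fredholm_coef_bound : exists2 P, 0 <= P & forall n, nrm (fredholm_coef n) <= P * 2^-1 ^+ n.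
Proof.
have [Q Q0 hQ] := principal_tame; exists Q => // n.
apply: le_trans (nrmM _ _) _; rewrite nrm_sign_fact.
apply: le_trans (ler_wpM2l _ (nrm_iter (hQ n))) _; first by rewrite invr_ge0.
rewrite le_eqVlt; apply/orP; left; apply/eqP.
by field; rewrite pnatr_eq0 -lt0n fact_gt0.
Qed.

Lemma sum_minor_op n g M x : 0 <= M -> bounded_by a g M -> D x ->
  \sum_(0 <= i < n.+1) minor_op i g x =
  (\sum_(0 <= i < n.+1) fredholm_coef i) * op k g x + op k (fun t => \sum_(0 <= i < n) minor_op i g t) x.
Proof.
move=> M0 hg Dx; have [P P0 hP] := minor_op_bound.
have bm i : bounded_by a (minor_op i g) (P * 2^-1 ^+ i * M).
  by apply: bounded_ba (hP _ _ _ hg); rewrite !mulr_ge0 // exprn_ge0.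
rewrite (op_sum _ hk bm Dx) big_nat_recl // minor_op0 [in RHS]big_nat_recl // fredholm_coef0.
rewrite mulrDl mul1r -addrA; congr (_ + _).
rewrite mulr_suml -big_split /=; apply: eq_bigr => i _.
by rewrite (minor_op_rec _ M0 hg Dx) (op_minor_op _ M0 hg Dx).
Qed.

(** For [U] the sum of all [M_n g], the summed recursion reads [U = F A g + A U], so that
    [g + F^-1 U] solves the equation. Conversely [u = A u] gives [M_n u = (d_0 + ... + d_n) u],
    where the left side tends to 0 and the right side to [F u]. *)
Lemma fredholm_invertible F : F != 0 -> (exists s, D s) ->
  (exists2 c, 0 <= c & forall n, nrm (F - \sum_(0 <= i < n) fredholm_coef i) <= c * 2^-1 ^+ n) ->
  exists K, solvable k K.
Proof.
move=> F0 Dne [c c0 hF]; have [P P0 hP] := minor_op_bound.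
(* [U] is bounded by [4 * P * M] through [csum_exists], so [9 * P] leaves room. *)
exists (1 + nrm F^-1 * (9 * P)); split.
- by rewrite addr_ge0 // mulr_ge0 ?nrm_ge0 // mulr_ge0.
- move=> g M hg; have M0 : 0 <= M by exact: bounded_by_nneg hg a_gt0 Dne.
  have PM0 : 0 <= P * M by rewrite mulr_ge0.
  have bm i : bounded_by a (minor_op i g) (P * 2^-1 ^+ i * M).
    by apply: bounded_ba (hP _ _ _ hg); rewrite !mulr_ge0 // exprn_ge0.
  have [U mU hU] := @csum_exists R D (fun n => minor_op n g) a (P * M) mD PM0
    (fun s Ds => ltW (a_gt0 Ds)) (fun n => (bm n).1)
    (fun n s Ds => ltac:(rewrite (mulrAC P); exact: (bm n).2 s Ds)).
  have hUb : bounded_by a U (4 * (P * M)).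
    split => // s Ds; have := hU 0%N s Ds.
    by rewrite big_geq // subr0 expr0 mulr1.
  have KU s : D s -> U s = F * op k g s + op k U s.
    move=> Ds; apply/eqP; rewrite -subr_eq0; apply/eqP.
    apply: (@nrm_geometric_vanish _ _ (4 * (P * M) * a s + c * nrm (op k g s) + kappa * (4 * (P * M)) * b s)) => n.
    pose S := \sum_(0 <= i < n.+1) fredholm_coef i.
    pose V t := \sum_(0 <= i < n) minor_op i g t.
    have hV := bounded_by_sum (index_iota 0 n) bm.
    have hUV : bounded_by a (fun t => U t - V t) (4 * (P * M) * 2^-1 ^+ n).
      split; first by apply: cmeasB => //; exact: hV.1.
      by move=> t Dt; exact: hU.
    have -> : U s - (F * op k g s + op k U s) =
      (U s - \sum_(0 <= i < n.+1) minor_op i g s) - (F - S) * op k g s - op k (fun t => U t - V t) s.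
      by rewrite (sum_minor_op _ M0 hg Ds) (opB hk hUb hV Ds) -/S; ring.
    have e0 : 0 <= 2^-1 ^+ n :> R by rewrite exprn_ge0.
    apply: le_trans (nrmB _ _) _; rewrite [leRHS]mulrDl; apply: lerD; last first.
      apply: le_trans ((bounded_op hk hUV).2 s Ds) _.
      by rewrite le_eqVlt; apply/orP; left; apply/eqP; ring.
    apply: le_trans (nrmB _ _) _; rewrite [leRHS]mulrDl; apply: lerD.
      apply: le_trans (hU _ s Ds) _; rewrite exprS.
      have := mulr_ge0 (mulr_ge0 PM0 e0) (ltW (a_gt0 Ds)); lra.
    apply: le_trans (nrmM _ _) _; rewrite mulrAC ler_wpM2r ?nrm_ge0 //.
    by apply: le_trans (hF _) _; rewrite ler_wpM2l // exprS; lra.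
  have hFU := bounded_byZ F^-1 hUb.
  exists (fun s => g s + F^-1 * U s).
    apply: bounded_by_le a_gt0 (bounded_byD hg hFU) _.
    by have := mulr_ge0 (nrm_ge0 F^-1) PM0; lra.
  move=> s Ds; rewrite (opD hk hg hFU Ds) (opZ _ hk hUb Ds) [in LHS](KU s Ds).
  by field.
- move=> u M hu e s Ds.
  have M0 : 0 <= M by exact: bounded_by_nneg hu a_gt0 Dne.
  have E n : minor_op n u s = (\sum_(0 <= i < n.+1) fredholm_coef i) * u s.
    elim: n => [|n IH]; first by rewrite minor_op0 big_nat1 fredholm_coef0 mul1r -e.
    rewrite (minor_op_rec _ M0 hu Ds) -e // [in RHS]big_nat_recr //= mulrDl addrC -IH; congr (_ + _).
    by apply: eq_minor_op => t Dt; rewrite -e.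
  have : F * u s = 0.
    apply: (@nrm_geometric_vanish _ _ (c * nrm (u s) + P * M * b s)) => n.
    have -> : F * u s = (F - \sum_(0 <= i < n.+1) fredholm_coef i) * u s + minor_op n u s.
      by rewrite E; ring.
    apply: le_trans (nrmD _ _) _; rewrite [leRHS]mulrDl; apply: lerD.
      apply: le_trans (nrmM _ _) _; rewrite mulrAC ler_wpM2r ?nrm_ge0 //.
      apply: le_trans (hF _) _; rewrite ler_wpM2l // exprS; have : 0 <= 2^-1 ^+ n :> R by rewrite exprn_ge0.
      lra.
    apply: le_trans ((hP n _ _ hu).2 s Ds) _.
    by rewrite le_eqVlt; apply/orP; left; apply/eqP; ring.
  by move/eqP; rewrite mulf_eq0 (negPf F0) => /eqP.
Qed.

End Minors.


(** * Solutions and their dependence on a parameter *)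

Lemma domain_nonempty : exists s, D s.
Proof.
apply: contrapT => h; have D0 : D = set0 by apply/seteqP; split => // s Ds; apply: h; exists s.
by have := intw; rewrite D0 Rintegral_set0 => /esym/eqP; rewrite oner_eq0.
Qed.

Lemma bounded_a_nneg u M : bounded_by a u M -> 0 <= M.
Proof. by move=> hu; exact: bounded_by_nneg hu a_gt0 domain_nonempty. Qed.

Lemma bounded_b_nneg u M : bounded_by b u M -> 0 <= M.
Proof. by move=> hu; exact: bounded_by_nneg hu b_gt0 domain_nonempty. Qed.

Lemma kernel_nneg k M : kernel_bound k M -> 0 <= M.
Proof.
move=> [_ h]; have [s Ds] := domain_nonempty; have := le_trans (nrm_ge0 _) (h s s Ds Ds).
by rewrite pmulr_lge0 // mulr_gt0 // b_gt0.
Qed.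

(* (1 - op k)^{-1} g on D; the junk value 0 if there is no solution. *)
Definition sol k g : R -> C := xget (fun=> 0)
  [set u | (exists M, bounded_by a u M) /\ forall s, D s -> u s - op k u s = g s].

Lemma solE k K kappa g u M N : kernel_bound k kappa -> solvable k K ->
  bounded_by a g M -> bounded_by a u N -> (forall s, D s -> u s - op k u s = g s) ->
  forall s, D s -> sol k g s = u s.
Proof.
move=> hk [K0 _ U] hg hu e s Ds; rewrite /sol; case: xgetP => [v _ [[P hv] ev]|/(_ u) []]; last first.
  by split=> //; exists N.
apply/eqP; rewrite -subr_eq0; apply/eqP.
apply: (U (fun t => v t - u t) _ (bounded_byB hv hu) _ s Ds) => t Dt.
rewrite (opB hk hv hu Dt); apply/eqP; rewrite -subr_eq0; apply/eqP.
by transitivity ((v t - op k v t) - (u t - op k u t)); [ring|rewrite ev // e // subrr].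
Qed.

Lemma sol_props k K kappa g M : kernel_bound k kappa -> solvable k K -> bounded_by a g M ->
  bounded_by a (sol k g) (K * M) /\ forall s, D s -> sol k g s - op k (sol k g) s = g s.
Proof.
move=> hk sk hg; have [_ ex _] := sk; have [u hu eu] := ex g M hg.
have [[P hv] ev] : (exists P, bounded_by a (sol k g) P) /\
    forall s, D s -> sol k g s - op k (sol k g) s = g s.
  rewrite /sol; case: xgetP => [v _ //|/(_ u) []].
  by split=> //; exists (K * M).
split=> //; split; first exact: hv.1.
by move=> s Ds; rewrite (solE hk sk hg hu eu Ds); exact: hu.2.
Qed.

(* Neumann series around k. *)
Lemma solvable_near k l K kappa lambda e : kernel_bound k kappa -> kernel_bound l lambda ->
  solvable k K -> kernel_bound (fun s t => l s t - k s t) e -> K * e <= 2^-1 ->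
  solvable l (4 * K).
Proof.
move=> hk hl sk he Ke; have [K0 ex U] := sk.
have e0 := kernel_nneg he.
pose m s t := l s t - k s t.
have mE u M s : bounded_by a u M -> D s -> op m u s = op l u s - op k u s.
  by move=> hu Ds; rewrite (opBl hl hk hu Ds).
have bm u M : bounded_by a u M -> bounded_by a (op m u) (e * M).
  by move=> hu; apply: bounded_ba (bounded_op he hu); rewrite mulr_ge0 // (bounded_a_nneg hu).
split; first by rewrite mulr_ge0.
- move=> g M hg; have M0 := bounded_a_nneg hg.
  (* The terms [u_{n+1} = (1 - k)^{-1} (l - k) u_n] are halved at each step because [K * e <= 2^-1];
     the factor 4 of [csum_exists] gives the bound [4 * K]. *)
  pose u := fix u n := if n is n'.+1 then sol k (op m (u n')) else sol k g.
  have hu n : bounded_by a (u n) (K * M * 2^-1 ^+ n).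
    elim: n => [|n IH] /=; first by rewrite expr0 mulr1; have [] := sol_props hk sk hg.
    have [h _] := sol_props hk sk (bm _ _ IH).
    apply: bounded_by_le a_gt0 h _; rewrite mulrA exprS.
    have p0 : 0 <= K * M * 2^-1 ^+ n by rewrite mulr_ge0 ?exprn_ge0 // mulr_ge0.
    by have := ler_wpM2r p0 Ke; rewrite mulrCA; lra.
  have [V mV hV] := @csum_exists R D u a (K * M) mD (mulr_ge0 K0 M0)
    (fun s Ds => ltW (a_gt0 Ds)) (fun n => (hu n).1) (fun n s Ds => (hu n).2 s Ds).
  have hVb : bounded_by a V (4 * K * M).
    split => // s Ds; have := hV 0%N s Ds.
    by rewrite big_geq // subr0 expr0 mulr1 mulrA.
  exists V => // s Ds.
  suff E : V s - op k V s = g s + op m V s.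
    by rewrite (mE _ _ _ hVb Ds) in E; have -> : V s - op l V s = (V s - op k V s) - (op l V s - op k V s) by [ring]; rewrite E; ring.
  apply/eqP; rewrite -subr_eq0; apply/eqP.
  apply: (@nrm_geometric_vanish _ _ (4 * (K * M) * a s + kappa * (4 * (K * M)) * b s + e * (4 * (K * M)) * b s)) => n.
  pose S j t := \sum_(0 <= i < j) u i t.
  have hS j := bounded_by_sum (index_iota 0 j) hu.
  have hVS j : bounded_by a (fun t => V t - S j t) (4 * (K * M) * 2^-1 ^+ j).
    by split=> [|t Dt]; [apply: cmeasB => //; exact: (hS j).1|exact: hV].
  have ES : S n.+1 s - op k (S n.+1) s = g s + op m (S n) s.
    rewrite /S (op_sum _ hk hu Ds) (op_sum _ he hu Ds) -sumrB big_nat_recl //.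
    have [_ ->] := sol_props hk sk hg => //; congr (_ + _); apply: eq_bigr => i _.
    by have [_ ->] := sol_props hk sk (bm _ _ (hu i)).
  have -> : V s - op k V s - (g s + op m V s) =
    (V s - S n.+1 s) - op k (fun t => V t - S n.+1 t) s - op m (fun t => V t - S n t) s.
    rewrite (opB hk hVb (hS _) Ds) (opB he hVb (hS _) Ds) -/m.
    have -> : g s = S n.+1 s - op k (S n.+1) s - op m (S n) s by rewrite ES; ring.
    by ring.
  have p0 : 0 <= 2^-1 ^+ n :> R by rewrite exprn_ge0.
  have KM := mulr_ge0 K0 M0.
  apply: le_trans (nrmB _ _) _; rewrite [leRHS]mulrDl; apply: lerD; last first.
    apply: le_trans ((bounded_op he (hVS n)).2 s Ds) _.
    by rewrite le_eqVlt; apply/orP; left; apply/eqP; ring.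
  apply: le_trans (nrmB _ _) _; rewrite [leRHS]mulrDl; apply: lerD.
    apply: le_trans (hV _ s Ds) _; rewrite exprS.
    by have := mulr_ge0 (mulr_ge0 KM p0) (ltW (a_gt0 Ds)); lra.
  apply: le_trans ((bounded_op hk (hVS n.+1)).2 s Ds) _; rewrite exprS.
  by have := mulr_ge0 (mulr_ge0 (kernel_nneg hk) (mulr_ge0 KM p0)) (ltW (b_gt0 Ds)); lra.
- move=> u M hu eu.
  have M0 := bounded_a_nneg hu.
  have H n : bounded_by a u (M * 2^-1 ^+ n).
    elim: n => [|n IH]; first by rewrite expr0 mulr1.
    have hmu := bm _ _ IH.
    have eq s : D s -> u s - op k u s = op m u s.
      by move=> Ds; rewrite (mE _ _ _ hu Ds) -eu.
    have [h _] := sol_props hk sk hmu.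
    split; first exact: hu.1.
    move=> s Ds; rewrite -(solE hk sk hmu hu eq Ds).
    apply: le_trans (h.2 s Ds) _; rewrite ler_wpM2r ?(ltW (a_gt0 Ds)) //.
    rewrite mulrA exprS.
    have p0 : 0 <= M * 2^-1 ^+ n by rewrite mulr_ge0 // exprn_ge0.
    by have := ler_wpM2r p0 Ke; lra.
  move=> s Ds; apply: (@nrm_geometric_vanish _ _ (M * a s)) => n.
  by apply: le_trans ((H n).2 s Ds) _; rewrite mulrAC.
Qed.

(* The resolvent identity
     <u_d, h_d> - <u_0, h_0> = <u_d, h_d - h_0> + <g_d - g_0, v> + <(k_d - k_0) u_d, v>,
   v = (1 - k_0)^{-1} h_0, expanded to first order in d. *)
Lemma dual_sol_taylor (kf : R -> R -> R -> C) (al : R -> C) (gf hf : R -> R -> C) (g1 h1 : R -> C)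
    kappa K e0 cg ch ca ck : 0 < e0 -> e0 <= 1 ->
  (forall s t, kf 0 s t = kf 0 t s) ->
  (forall d, `|d| <= e0 -> kernel_bound (kf d) kappa) ->
  (forall d, `|d| <= e0 -> solvable (kf d) K) ->
  (forall d, `|d| <= e0 ->
     kernel_bound (fun s t => kf d s t - kf 0 s t + d%:C * (al s * al t)) (ck * d ^+ 2)) ->
  bounded_by b al ca ->
  (forall d, `|d| <= e0 -> bounded_by a (gf d) cg) -> bounded_by a g1 cg ->
  (forall d, `|d| <= e0 ->
     bounded_by a (fun s => gf d s - gf 0 s - d%:C * g1 s) (cg * d ^+ 2)) ->
  (forall d, `|d| <= e0 -> bounded_by b (hf d) ch) -> bounded_by b h1 ch ->
  (forall d, `|d| <= e0 ->
     bounded_by b (fun s => hf d s - hf 0 s - d%:C * h1 s) (ch * d ^+ 2)) ->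
  exists2 c, 0 <= c & forall d, `|d| <= e0 ->
  nrm (dual (sol (kf d) (gf d)) (hf d) - dual (sol (kf 0) (gf 0)) (hf 0) -
    d%:C * (dual (sol (kf 0) g1) (hf 0) + dual (sol (kf 0) (gf 0)) h1 -
            dual (sol (kf 0) (gf 0)) al * dual (sol (kf 0) al) (hf 0))) <= c * d ^+ 2.
Proof.
move=> e0p e01 ksym hk sk tk hal hg hg1 tg hh hh1 th.
have z0 : `|0 : R| <= e0 by rewrite normr0 ltW.
have K0 : 0 <= K by have [] := sk 0 z0.
have kap0 := kernel_nneg (hk 0 z0).
have cg0 := bounded_a_nneg hg1; have ch0 := bounded_b_nneg hh1; have ca0 := bounded_b_nneg hal.
have ck0 : 0 <= ck.
  have e0e : `|e0| <= e0 by rewrite ger0_norm // ltW.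
  by have := kernel_nneg (tk e0 e0e); rewrite pmulr_lge0 // exprn_gt0.
have hala := bounded_ba ca0 hal.
have hh0 := hh 0 z0; have hh0a := bounded_ba ch0 hh0.
set k := kf 0; have hk0 : kernel_bound k kappa := hk 0 z0; have sk0 : solvable k K := sk 0 z0.
set u0 := sol k (gf 0); have [hu0 eu0] := sol_props hk0 sk0 (hg 0 z0); rewrite -/u0 in hu0 eu0.
set v := sol k (hf 0); have [hv ev] := sol_props hk0 sk0 hh0a; rewrite -/v in hv ev.
have hvb : bounded_by b v (ch + kappa * (K * ch)).
  have [h1' h2'] := bounded_byD hh0 (bounded_op hk0 hv); split; first exact: hv.1.
  by move=> s Ds; rewrite -[v s](subrK (op k v s)) ev //; exact: h2'.
set cv := ch + kappa * (K * ch) in hvb.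
have cv0 := bounded_b_nneg hvb.
have ksym' : forall s t, k s t = k t s := ksym.
(* [k] is symmetric, so the resolvent can be moved from the left entry of the pairing to the right
   one, where its result [v] decays like [b]. *)
have duality u g M N : bounded_by a u M -> bounded_by a g N -> (forall s, D s -> u s - op k u s = g s) ->
    dual u (hf 0) = dual g v.
  move=> hu hgg eu; have M0 := bounded_a_nneg hu; have KC0 := mulr_ge0 K0 ch0.
  have hva := hv.
  have s1 : dual u (hf 0) = dual u v - dual u (op k v).
    rewrite -(dualBr hu hvb (bounded_op hk0 hva)).
    by apply: eq_cint => s Ds; rewrite ev.
  rewrite s1 -(op_sym kap0 M0 KC0 ksym' hk0 hu hva).
  have hku := bounded_ba (mulr_ge0 kap0 M0) (bounded_op hk0 hu).
  rewrite -(dualBl hu hku hvb); by apply: eq_cint => s Ds; rewrite eu.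
have D1 : dual (sol k g1) (hf 0) = dual g1 v.
  by have [h e] := sol_props hk0 sk0 hg1; exact: duality h hg1 e.
have D2 : dual (sol k al) (hf 0) = dual al v.
  by have [h e] := sol_props hk0 sk0 hala; exact: duality h hala e.
have D3 : dual u0 (hf 0) = dual (gf 0) v by exact: duality hu0 (hg 0 z0) eu0.
(* Lipschitz constant of [u_d] at [d = 0]: [K] times the variation [2 * cg] of the data plus that of
   the kernel, [ck + ca * ca], applied to [u_d], which is bounded by [K * cg]. *)
pose c1 := K * (2 * cg + (ck + ca * ca) * (K * cg)).
exists (K * cg * ch + c1 * ch + cg * cv + ck * (K * cg) * cv + c1 * ca * (ca * cv)).
  have c10 : 0 <= c1 by rewrite /c1 !(mulr_ge0, addr_ge0).
  by rewrite !(addr_ge0, mulr_ge0).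
move=> d de.
have d2 : d ^+ 2 <= `|d|.
  rewrite -(real_normK (num_real d)) expr2 -[leRHS]mulr1 ler_wpM2l // (le_trans de) //.
have [hud eud] := sol_props (hk d de) (sk d de) (hg d de).
set ud := sol (kf d) (gf d) in hud eud *.
pose m s t := kf d s t - k s t.
have Kcg0 : 0 <= K * cg by rewrite mulr_ge0.
pose r s t := kf d s t - k s t + d%:C * (al s * al t).
have hr : kernel_bound r (ck * d ^+ 2) := tk d de.
pose aa s t := d%:C * (al s * al t).
have haa : kernel_bound aa (`|d| * (ca * ca)).
  split.
    apply: cmeasM; first exact: cmeas_cst.
    apply: cmeasM; [apply: (cmeas_comp hal.1); exact: measurable_fst|apply: (cmeas_comp hal.1); exact: measurable_snd].
  move=> s t Ds Dt; rewrite nrmMr -mulrA ler_wpM2l //; apply: le_trans (nrmM _ _) _.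
  by rewrite mulrACA; apply: ler_pM; rewrite ?nrm_ge0 ?hal.2.
have opm u M s : bounded_by a u M -> D s ->
    op (kf d) u s - op k u s = op r u s - d%:C * (al s * dual u al).
  move=> hu Ds.
  have -> : d%:C * (al s * dual u al) = op aa u s.
    rewrite /op mulrA /dual -cintZ //; last exact: dual_integrable hu hal.
    by apply: eq_cint => t _; rewrite /aa; ring.
  rewrite -(opBl (hk d de) hk0 hu Ds) -(opBl hr haa hu Ds); apply: eq_cint => t _.
  by rewrite /r /aa; ring.
have ha_al u M : bounded_by a u M -> nrm (dual u al) <= M * ca by move=> hu; exact: nrm_dual hu hal.
have hdiff : bounded_by a (fun s => ud s - u0 s) (c1 * `|d|).
  have eq s : D s -> (ud s - u0 s) - op k (fun s => ud s - u0 s) s =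
     (gf d s - gf 0 s) + (op (kf d) ud s - op k ud s).
    move=> Ds; rewrite (opB hk0 hud hu0 Ds) -(eu0 s Ds) -(eud s Ds); ring.
  have hgd : bounded_by a (fun s => gf d s - gf 0 s) (2 * cg * `|d|).
    split; first by apply: cmeasB; [exact: (hg d de).1|exact: (hg 0 z0).1].
    move=> s Ds; have -> : gf d s - gf 0 s = (gf d s - gf 0 s - d%:C * g1 s) + d%:C * g1 s by ring.
    apply: le_trans (nrmD _ _) _; rewrite nrmMr.
    have i1 := (tg d de).2 s Ds; have i2 := ler_wpM2l (normr_ge0 d) (hg1.2 s Ds).
    have i3 := ler_wpM2l (mulr_ge0 cg0 (ltW (a_gt0 Ds))) d2; lra.
  have hop : bounded_by a (fun s => op (kf d) ud s - op k ud s) ((ck + ca * ca) * (K * cg) * `|d|).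
    split; first by apply: cmeasB; [exact: (bounded_op (hk d de) hud).1|exact: (bounded_op hk0 hud).1].
    move=> s Ds; rewrite (opm _ _ _ hud Ds); apply: le_trans (nrmB _ _) _; rewrite nrmMr.
    have j1 := (bounded_op hr hud).2 s Ds.
    have j2 : nrm (al s * dual ud al) <= ca * b s * (K * cg * ca).
      by apply: le_trans (nrmM _ _) _; apply: ler_pM; rewrite ?nrm_ge0 ?hal.2 ?ha_al.
    have j3 := ler_wpM2l (normr_ge0 d) j2.
    have j4 := ler_wpM2l (mulr_ge0 (mulr_ge0 ck0 Kcg0) (ltW (b_gt0 Ds))) d2.
    have j5 : (ck + ca * ca) * (K * cg) * `|d| * b s <= (ck + ca * ca) * (K * cg) * `|d| * a s.
      by rewrite ler_wpM2l ?b_le_a // !(mulr_ge0, addr_ge0).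
    lra.
  have hrhs := bounded_byD hgd hop.
  have [h _] := sol_props hk0 sk0 hrhs.
  split; first by apply: cmeasB; [exact: hud.1|exact: hu0.1].
  move=> s Ds; rewrite -(solE hk0 sk0 hrhs (bounded_byB hud hu0) eq Ds).
  by apply: le_trans (h.2 s Ds) _; rewrite le_eqVlt; apply/orP; left; apply/eqP; rewrite /c1; ring.
(* [u_d] solves the equation at [d = 0] with the change of kernel moved into the right-hand side, so
   duality applies to it; the rank-one part of the change gives a product of two pairings. *)
have E1 : dual ud (hf 0) = dual (gf d) v + dual (op r ud) v - d%:C * (dual ud al * dual al v).
  have eq s : D s -> ud s - op k ud s = gf d s + (op r ud s - d%:C * (al s * dual ud al)).
    by move=> Ds; rewrite -(opm _ _ _ hud Ds) -(eud s Ds); ring.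
  have hrud := bounded_ba (mulr_ge0 (mulr_ge0 ck0 (sqr_ge0 d)) Kcg0) (bounded_op hr hud).
  have hx : bounded_by a (fun s => d%:C * (al s * dual ud al)) (nrm (d%:C * dual ud al) * ca).
    have := bounded_byZ (d%:C * dual ud al) hala.
    by rewrite (_ : (fun s => _ * _ * al s) = (fun s => d%:C * (al s * dual ud al))) //; apply/funext => s; ring.
  have hy := bounded_byB hrud hx.
  rewrite (duality _ _ _ _ hud (bounded_byD (hg d de) hy) eq).
  rewrite (dualDl (hg d de) hy hvb) (dualBl hrud hx hvb) addrA; congr (_ - _).
  rewrite mulrA -(dualZl (d%:C * dual ud al) hala hvb).
  by apply: eq_cint => s _; ring.
have hd1 := th d de; have hg2 := tg d de.
have T1 : dual ud (hf d) - dual ud (hf 0) =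
    dual ud (fun s => hf d s - hf 0 s - d%:C * h1 s) + d%:C * dual (fun s => ud s - u0 s) h1 + d%:C * dual u0 h1.
  have hdb := bounded_byB (bounded_byB (hh d de) hh0) (bounded_byZ d%:C hh1).
  rewrite (dualBr hud (bounded_byB (hh d de) hh0) (bounded_byZ d%:C hh1)) (dualBr hud (hh d de) hh0).
  by rewrite (dualZr _ hud hh1) (dualBl hud hu0 hh1); ring.
have T2 : dual (gf d) v - dual (gf 0) v =
    dual (fun s => gf d s - gf 0 s - d%:C * g1 s) v + d%:C * dual g1 v.
  rewrite (dualBl (bounded_byB (hg d de) (hg 0 z0)) (bounded_byZ d%:C hg1) hvb).
  by rewrite (dualBl (hg d de) (hg 0 z0) hvb) (dualZl _ hg1 hvb); ring.
have T3 : dual ud al = dual (fun s => ud s - u0 s) al + dual u0 al.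
  by rewrite (dualBl hud hu0 hal) subrK.
have -> : dual ud (hf d) - dual u0 (hf 0) -
    d%:C * (dual (sol k g1) (hf 0) + dual u0 h1 - dual u0 al * dual (sol k al) (hf 0)) =
  dual ud (fun s => hf d s - hf 0 s - d%:C * h1 s) + d%:C * dual (fun s => ud s - u0 s) h1 +
  dual (fun s => gf d s - gf 0 s - d%:C * g1 s) v + dual (op r ud) v -
  d%:C * (dual (fun s => ud s - u0 s) al * dual al v).
  have -> : dual ud (hf d) = (dual ud (hf d) - dual ud (hf 0)) + dual ud (hf 0) by ring.
  rewrite T1 E1 D1 D2 D3 T3.
  have -> : dual (gf d) v = (dual (gf d) v - dual (gf 0) v) + dual (gf 0) v by ring.
  by rewrite T2; ring.
have hrud := bounded_ba (mulr_ge0 (mulr_ge0 ck0 (sqr_ge0 d)) Kcg0) (bounded_op hr hud).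
have N1 := nrm_dual hud hd1.
have N2 := nrm_dual hdiff hh1.
have N3 := nrm_dual hg2 hvb.
have N4 := nrm_dual hrud hvb.
have N5 := nrm_dual hdiff hal.
have N6 := nrm_dual hala hvb.
have dd : `|d| * `|d| = d ^+ 2 by rewrite -expr2 real_normK ?num_real.
have N2' : nrm (d%:C * dual (fun s => ud s - u0 s) h1) <= c1 * ch * d ^+ 2.
  rewrite nrmMr -dd; apply: le_trans (ler_wpM2l (normr_ge0 d) N2) _.
  by rewrite le_eqVlt; apply/orP; left; apply/eqP; ring.
have N5' : nrm (d%:C * (dual (fun s => ud s - u0 s) al * dual al v)) <= c1 * ca * (ca * cv) * d ^+ 2.
  rewrite nrmMr -dd.
  apply: le_trans (ler_wpM2l (normr_ge0 d) (le_trans (nrmM _ _) (ler_pM (nrm_ge0 _) (nrm_ge0 _) N5 N6))) _.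
  by rewrite le_eqVlt; apply/orP; left; apply/eqP; ring.
apply: le_trans (nrmB _ _) _; rewrite [leRHS]mulrDl; apply: lerD => //.
apply: le_trans (nrmD _ _) _; rewrite [leRHS]mulrDl; apply: lerD; last first.
  by apply: le_trans N4 _; rewrite le_eqVlt; apply/orP; left; apply/eqP; ring.
apply: le_trans (nrmD _ _) _; rewrite [leRHS]mulrDl; apply: lerD; last first.
  by apply: le_trans N3 _; rewrite le_eqVlt; apply/orP; left; apply/eqP; ring.
apply: le_trans (nrmD _ _) _; rewrite [leRHS]mulrDl; apply: lerD => //.
by apply: le_trans N1 _; rewrite le_eqVlt; apply/orP; left; apply/eqP; ring.
Qed.

End WeightedOperators.

(** * The resolvent of the Airy kernel *)

Section AiryKernel.
Variable R : realType.
Local Notation C := R[i].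
Local Notation Re := (@complex.Re R).
Local Notation Im := (@complex.Im R).
Local Notation mu := (@lebesgue_measure R).
Local Notation half := (`]0%R, +oo[%classic : set R).

Lemma is_derive_of_taylor (f : R -> R) (x l c : R) : 0 <= c ->
  (exists2 e, 0 < e & forall d, `|d| <= e -> `|f (x + d) - f x - d * l| <= c * d ^+ 2) ->
  is_derive x 1 f l.
Proof.
move=> c0 [e e0 h].
have key : (fun d => d^-1 *: (f (d *: (1 : R) + x) - f x)) @ (0 : R)^' --> l.
  apply/cvgrPdist_le => eps eps0.
  have c1 : 0 < c + 1 by lra.
  near=> d.
  have d0 : d != 0 by near: d; exact: nbhs_dnbhs_neq.
  have de : `|d| <= e.
    by near: d; apply: dnbhs0_le.
  have d2 : `|d| <= eps / (c + 1) by near: d; apply: dnbhs0_le; rewrite divr_gt0.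
  rewrite /GRing.scale /= mulr1 (addrC d).
  have -> : l - d^-1 * (f (x + d) - f x) = - (d^-1 * (f (x + d) - f x - d * l)) by field.
  rewrite normrN normrM normfV ler_pdivrMl ?normr_gt0 //.
  apply: le_trans (h d de) _.
  rewrite -(real_normK (num_real d)) expr2 mulrCA ler_wpM2l //.
  apply: (@le_trans _ _ ((c + 1) * `|d|)); first by rewrite ler_wpM2r //; lra.
  by rewrite mulrC -ler_pdivlMr.
apply: DeriveDef; first by apply/cvg_ex; exists l.
exact/cvg_lim.
Unshelve. all: by end_near. Qed.

Lemma cder_of_taylor (f : R -> C) (x : R) l c : 0 <= c ->
  (exists2 e, 0 < e & forall d : R, `|d| <= e -> nrm (f (x + d) - f x - d%:C * l) <= c * d ^+ 2) ->
  cder f x l.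
Proof.
move=> c0 [e e0 h]; split; apply: (is_derive_of_taylor c0); exists e => // d de.
  apply: le_trans (h d de); apply: le_trans (Re_le_nrm _).
  by rewrite !ReImE /= mul0r subr0.
apply: le_trans (h d de); apply: le_trans (Im_le_nrm _).
by rewrite !ReImE /= mul0r addr0.
Qed.

Lemma cder_AiD n (x : R) : cder (AiD n) x (AiD n.+1 x).
Proof.
have X0 : 0 <= `|x| by [].
have [M M0 h] := @AiD_taylor R n 0 _ X0.
apply: (cder_of_taylor M0); exists 1 => // d d1.
have Xx : - `|x| <= x by rewrite lerNl -normrN ler_norm.
by have := h x d Xx d1; rewrite mulr0 oppr0 expR0 mulr1.
Qed.

Lemma cint_closed_half (f : R -> C) : cmeas f ->
  cint `[0%R, +oo[ f = cint half f.
Proof.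
move=> [f1 f2]; apply: complexP => /=.
  rewrite /Rintegral -integral_itv_obnd_cbnd //.
  by apply: measurable_funTS; exact/measurable_EFinP.
rewrite /Rintegral -integral_itv_obnd_cbnd //.
by apply: measurable_funTS; exact/measurable_EFinP.
Qed.

Lemma cmeas_shift (f : R -> C) (x : R) : cmeas f -> cmeas (fun s : R => f (x + s)).
Proof. by move=> mf; apply: (cmeas_comp mf); exact: measurable_translation. Qed.

Lemma airy_kernelE (xi eta : R) : airy_kernel xi eta = cint half (fun z => AiD 0 (xi + z) * AiD 0 (eta + z)).
Proof.
rewrite /airy_kernel (_ : (fun z => _) = (fun z => AiD 0 (xi + z) * AiD 0 (eta + z))).
  by apply: cint_closed_half; apply: cmeasM; apply: cmeas_shift; exact: cmeas_AiD.
by apply/funext => z; rewrite !AiE (addrC z).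
Qed.

Lemma airy_kernel_sym (xi eta : R) : airy_kernel xi eta = airy_kernel eta xi.
Proof. by rewrite !airy_kernelE; apply: eq_cint => z _; rewrite mulrC. Qed.

Lemma cmeas_airy_kernel : cmeas (fun p : R * R => airy_kernel p.1 p.2).
Proof.
rewrite (_ : (fun p => _) = (fun p => cint half (fun z => AiD 0 (p.1 + z) * AiD 0 (p.2 + z)))); last first.
  by apply/funext => p; rewrite airy_kernelE.
apply: (@cmeas_cint _ _ _ _ (fun q : (R * R) * R => AiD 0 (q.1.1 + q.2) * AiD 0 (q.1.2 + q.2))) => //.
apply: cmeasM; apply: (cmeas_comp (@cmeas_AiD R 0)); apply: measurable_funD => //;
  exact: measurableT_comp.
Qed.

(** Both factors decay at rate [g], so the integration variable contributes [e^{-2 g z}]; as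
    [g >= 1], this is at most [e^{-z}], which has integral 1 over the half-line. *)
Lemma prod_AiD_bound m n (g X : R) : 1 <= g -> 0 <= X -> exists2 M, 0 <= M &
  forall xi eta z, - X <= xi -> - X <= eta -> 0 <= z ->
  nrm (AiD m (xi + z) * AiD n (eta + z)) <= M * (expR (- (g * xi)) * expR (- (g * eta))) * expR (- z).
Proof.
move=> g1 X0; have [M M0 hM] := @AiD_bound R m g _ X0; have [N N0 hN] := @AiD_bound R n g _ X0.
exists (M * N); first exact: mulr_ge0.
move=> xi eta z Xxi Xeta z0; apply: le_trans (nrmM _ _) _.
apply: (@le_trans _ _ (M * expR (- ((xi + z) * g)) * (N * expR (- ((eta + z) * g))))).
  apply: ler_pM; [exact: nrm_ge0|exact: nrm_ge0|apply: hM|apply: hN]; lra.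
rewrite mulrACA -!mulrA; do 2 apply: ler_wpM2l => //.
rewrite -!expRD ler_expR.
have : 1 * z <= g * z by rewrite ler_wpM2r.
lra.
Qed.

Lemma airy_kernel_bound (g X : R) : 1 <= g -> 0 <= X -> exists2 M, 0 <= M &
  forall xi eta, - X <= xi -> - X <= eta ->
  nrm (airy_kernel xi eta) <= M * (expR (- (g * xi)) * expR (- (g * eta))).
Proof.
move=> g1 X0; have [M M0 hM] := prod_AiD_bound 0 0 g1 X0; exists M => // xi eta Xxi Xeta.
rewrite airy_kernelE; set K := M * _.
have iE := rintegrableZ K (measurable_itv _) (@rintegrable_expN R).
have -> : K = \int[mu]_(z in half) (K * expR (- z)).
  by rewrite RintegralZl //; [rewrite Rintegral_expN mulr1|exact: rintegrable_expN].
have bnd z : half z -> nrm (AiD 0 (xi + z) * AiD 0 (eta + z)) <= K * expR (- z).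
  by rewrite /= in_itv /= andbT => /ltW z0; exact: hM.
apply: nrm_cint_le => //; apply: (dom_cintegrable _ _ iE) => //.
by apply: cmeasM; apply: cmeas_shift; exact: cmeas_AiD.
Qed.

Lemma cder_shift (f : R -> C) (x u : R) l : cder f (x + u) l -> cder (fun z => f (x + z)) u l.
Proof.
have d1 : is_derive u 1 (fun z => x + z) 1.
  apply: is_derive_eq (is_deriveD (@is_derive_cst _ _ _ x u 1) (@is_derive_id _ _ u 1)) _.
  by rewrite add0r.
move=> [f1 f2]; split.
  by have := @is_derive1_comp _ (fun v => Re (f v)) (fun z => x + z) u _ _ f1 d1; rewrite mulr1.
by have := @is_derive1_comp _ (fun v => Im (f v)) (fun z => x + z) u _ _ f2 d1; rewrite mulr1.
Qed.

Lemma prod_remainder (p q p' q' p1 q1 : C) (d : R) :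
  p' * q' - p * q - d%:C * (p1 * q + p * q1) =
  (p' - p - d%:C * p1) * q' + p * (q' - q - d%:C * q1) + d%:C * p1 * (q' - q).
Proof. ring. Qed.

(** One constant and one weight, taken at the unshifted point [y], for everything that occurs in
    [prod_remainder]. *)
Lemma AiD_incr (g X : R) : 0 <= g -> 0 <= X -> exists2 M, 0 <= M &
  forall y d, - X <= y -> `|d| <= 1 ->
  [/\ nrm (AiD 0 y) <= M * expR (- (y * g)), nrm (AiD 1 y) <= M * expR (- (y * g)),
     nrm (AiD 0 (y + d)) <= M * expR (- (y * g)),
     nrm (AiD 0 (y + d) - AiD 0 y) <= `|d| * (M * expR (- (y * g))) &
     nrm (AiD 0 (y + d) - AiD 0 y - d%:C * AiD 1 y) <= M * d ^+ 2 * expR (- (y * g))].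
Proof.
move=> g0 X0; have [A A0 hA] := @AiD_bound R 0 g _ X0.
have [B B0 hB] := @AiD_bound R 1 g _ X0; have [T T0 hT] := @AiD_taylor R 0 g _ X0.
exists (A + B + T); first by rewrite !addr_ge0.
move=> y d Xy d1; have hd := hT y d Xy d1; have a := hA y Xy; have b := hB y Xy.
set e := expR _ in hd a b *; have e0 : 0 <= e by exact: expR_ge0.
have d2 : d ^+ 2 <= `|d| by rewrite -(real_normK (num_real d)) expr2 -[leRHS]mulr1 ler_wpM2l.
pose S := A + B + T.
have AS : A <= S by rewrite /S -addrA lerDl addr_ge0.
have BTS : B + T <= S by rewrite /S -addrA lerDr.
have BS : B <= S by apply: le_trans BTS; rewrite lerDl.
have TS : T <= S by rewrite lerDr addr_ge0.
have i4 : nrm (AiD 0 (y + d) - AiD 0 y) <= `|d| * ((B + T) * e).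
  have -> : AiD 0 (y + d) - AiD 0 y = (AiD 0 (y + d) - AiD 0 y - d%:C * AiD 1 y) + d%:C * AiD 1 y by rewrite subrK.
  apply: le_trans (nrmD _ _) _; rewrite nrmMr addrC mulrDl mulrDr; apply: lerD.
    by rewrite ler_wpM2l.
  by apply: le_trans hd _; rewrite mulrAC mulrC ler_wpM2r // mulr_ge0.
rewrite -/S; split.
- by apply: le_trans a _; rewrite ler_wpM2r.
- by apply: le_trans b _; rewrite ler_wpM2r.
- rewrite -[X in nrm X](subrK (AiD 0 y)); apply: le_trans (nrmD _ _) _.
  have i6 : `|d| * ((B + T) * e) <= (B + T) * e by rewrite -[leRHS]mul1r ler_wpM2r // mulr_ge0 // addr_ge0.
  apply: le_trans (lerD (le_trans i4 i6) a) _.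
  by rewrite -mulrDl le_eqVlt; apply/orP; left; apply/eqP; rewrite /S; ring.
- by apply: le_trans i4 _; rewrite ler_wpM2l // ler_wpM2r.
- by apply: le_trans hd _; rewrite ler_wpM2r // ler_wpM2r // sqr_ge0.
Qed.

Lemma prod_AiD_taylor (g X : R) : 1 <= g -> 0 <= X -> exists2 c, 0 <= c &
  forall xi eta z d, - X <= xi -> - X <= eta -> 0 <= z -> `|d| <= 1 ->
  nrm (AiD 0 (xi + d + z) * AiD 0 (eta + d + z) - AiD 0 (xi + z) * AiD 0 (eta + z) -
    d%:C * (AiD 1 (xi + z) * AiD 0 (eta + z) + AiD 0 (xi + z) * AiD 1 (eta + z))) <=
  c * d ^+ 2 * (expR (- (g * xi)) * expR (- (g * eta))) * expR (- z).
Proof.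
move=> g1 X0; have g0 : 0 <= g by exact: le_trans g1.
have [M M0 hM] := AiD_incr g0 X0.
(* One [M ^+ 2] for each of the three terms of [prod_remainder]. *)
exists (3 * M ^+ 2); first by rewrite mulr_ge0 // sqr_ge0.
move=> xi eta z d Xxi Xeta z0 d1.
have Xxiz : - X <= xi + z by rewrite (le_trans Xxi) // lerDl.
have Xetaz : - X <= eta + z by rewrite (le_trans Xeta) // lerDl.
rewrite !(addrAC _ d z) prod_remainder.
have [a1 a2 a3 a4 a5] := hM (xi + z) d Xxiz d1.
have [b1 b2 b3 b4 b5] := hM (eta + z) d Xetaz d1.
set ex := expR (- ((xi + z) * g)) in a1 a2 a3 a4 a5.
set ee := expR (- ((eta + z) * g)) in b1 b2 b3 b4 b5.
have dsq : `|d| * `|d| = d ^+ 2 by rewrite -expr2 real_normK ?num_real.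
have exee : ex * ee <= expR (- (g * xi)) * expR (- (g * eta)) * expR (- z).
  rewrite /ex /ee -!expRD ler_expR.
  have : 1 * z <= g * z by rewrite ler_wpM2r.
  clear -z0; lra.
have n0 := @nrm_ge0 R.
have q1 := le_trans (nrmM (AiD 0 (xi + z + d) - AiD 0 (xi + z) - d%:C * AiD 1 (xi + z)) (AiD 0 (eta + z + d)))
  (ler_pM (n0 _) (n0 _) a5 b3).
have q2 := le_trans (nrmM (AiD 0 (xi + z)) (AiD 0 (eta + z + d) - AiD 0 (eta + z) - d%:C * AiD 1 (eta + z)))
  (ler_pM (n0 _) (n0 _) a1 b5).
have q3 : nrm (d%:C * AiD 1 (xi + z) * (AiD 0 (eta + z + d) - AiD 0 (eta + z))) <= `|d| * (M * ex) * (`|d| * (M * ee)).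
  by apply: le_trans (nrmM _ _) _; apply: ler_pM; rewrite ?nrm_ge0 // nrmMr ler_wpM2l.
apply: le_trans (nrmD _ _) _; apply: le_trans (lerD (nrmD _ _) (lexx _)) _.
apply: le_trans (lerD (lerD q1 q2) q3) _.
apply: (@le_trans _ _ (3 * M ^+ 2 * d ^+ 2 * (ex * ee))).
  by rewrite le_eqVlt; apply/orP; left; apply/eqP; rewrite -dsq; ring.
by rewrite -[leRHS]mulrA; apply: ler_wpM2l => //; apply: mulr_ge0 (sqr_ge0 d); apply: mulr_ge0 (sqr_ge0 M).
Qed.

(* The linear term integrates to - Ai xi * Ai eta since the integrand is
   d/dz (Ai (xi + z) Ai (eta + z)). *)
Lemma airy_kernel_taylor (g X : R) : 1 <= g -> 0 <= X -> exists2 M, 0 <= M &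
  forall xi eta d, - X <= xi -> - X <= eta -> `|d| <= 1 ->
  nrm (airy_kernel (xi + d) (eta + d) - airy_kernel xi eta + d%:C * (AiD 0 xi * AiD 0 eta)) <=
  M * d ^+ 2 * (expR (- (g * xi)) * expR (- (g * eta))).
Proof.
move=> g1 X0.
have X1 : 0 <= X + 1 by rewrite addr_ge0.
have [P P0 hP] := prod_AiD_bound 0 0 g1 X1.
have [P1 P10 hP1] := prod_AiD_bound 1 0 g1 X1.
have [P2 P20 hP2] := prod_AiD_bound 0 1 g1 X1.
have [c c0 hc] := prod_AiD_taylor g1 X0.
exists c => // xi eta d Xxi Xeta d1.
pose W := expR (- (g * xi)) * expR (- (g * eta)).
have W0 : 0 <= W by rewrite mulr_ge0 ?expR_ge0.
pose F z := AiD 0 (xi + z) * AiD 0 (eta + z).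
pose F1 z := AiD 1 (xi + z) * AiD 0 (eta + z) + AiD 0 (xi + z) * AiD 1 (eta + z).
pose Fd z := AiD 0 (xi + d + z) * AiD 0 (eta + d + z).
have XX : - (X + 1) <= - X by rewrite lerN2 lerDl.
have dm : - 1 <= d by move: d1; rewrite ler_norml => /andP[].
have X1d y : - X <= y -> - (X + 1) <= y + d by move=> h; rewrite opprD lerD.
have X1xi := le_trans XX Xxi; have X1eta := le_trans XX Xeta.
have mA n y : cmeas (fun z : R => AiD n (y + z)) by apply: cmeas_shift; exact: cmeas_AiD.
have mF : cmeas F by apply: cmeasM.
have mF1 : cmeas F1 by apply: cmeasD; apply: cmeasM.
have mFd : cmeas Fd by apply: cmeasM.
have bF z : 0 <= z -> nrm (F z) <= P * W * expR (- z) by exact: hP.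
have bF1 z : 0 <= z -> nrm (F1 z) <= (P1 + P2) * W * expR (- z).
  move=> z0; apply: le_trans (nrmD _ _) _; rewrite !mulrDl; apply: lerD; [exact: hP1|exact: hP2].
have iE := @rintegrable_expN R.
have ig (f : R -> C) M : cmeas f -> (forall z : R, 0 <= z -> nrm (f z) <= M * expR (- z)) -> cintegrable half f.
  move=> mf bf; apply: (dom_cintegrable _ mf (rintegrableZ M _ iE)) => // z.
  by rewrite /= in_itv /= andbT => /ltW; exact: bf.
have iF := ig _ _ mF bF; have iF1 := ig _ _ mF1 bF1.
have iFd := ig _ _ mFd (fun z z0 => hP _ _ z (X1d _ Xxi) (X1d _ Xeta) z0).
have FTC : cint half F1 = - (AiD 0 xi * AiD 0 eta).
  rewrite (@cint_FTCy R F F1 ((P + (P1 + P2)) * W)); first by rewrite /F !addr0.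
  - move=> u u0; exact: cderM (cder_shift (cder_AiD _ _)) (cder_shift (cder_AiD _ _)).
  - move=> u u0; eexists; apply: cderD; apply: cderM; exact: cder_shift (cder_AiD _ _).
  - move=> u u0; apply: le_trans (bF u u0) _; rewrite ler_wpM2r ?expR_ge0 // ler_wpM2r // lerDl addr_ge0 //.
  - move=> u u0; apply: le_trans (bF1 u u0) _; rewrite ler_wpM2r ?expR_ge0 // ler_wpM2r // lerDr //.
have -> : airy_kernel (xi + d) (eta + d) - airy_kernel xi eta + d%:C * (AiD 0 xi * AiD 0 eta) =
  cint half (fun z => Fd z - F z - d%:C * F1 z).
  rewrite cintB //; [|exact: cintegrableB|exact: cintegrableZ].
  rewrite (cintB (measurable_itv _) iFd iF) (cintZ d%:C (measurable_itv _) iF1) FTC mulrN opprK.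
  by rewrite (airy_kernelE (xi + d)) (airy_kernelE xi).
set K := c * _ * _.
have iK := rintegrableZ K (measurable_itv _) iE.
have -> : K = \int[mu]_(z in half) (K * expR (- z)).
  by rewrite RintegralZl //; rewrite Rintegral_expN mulr1.
have bnd z : half z -> nrm (Fd z - F z - d%:C * F1 z) <= K * expR (- z).
  by rewrite /= in_itv /= andbT => /ltW z0; exact: hc.
apply: nrm_cint_le => //; apply: (dom_cintegrable _ _ iK) => //.
by apply: cmeasB; [exact: cmeasB|apply: cmeasM => //; exact: cmeas_cst].
Qed.

End AiryKernel.

(** * Solutions for the translated Airy kernel *)

Section AiryResolvent.
Variable R : realType.
Local Notation C := R[i].
Local Notation mu := (@lebesgue_measure R).
Local Notation half := (`]0%R, +oo[%classic : set R).

Definition ewt (g s : R) : R := expR (- (s * g)).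

Lemma halfP (s : R) : half s -> 0 < s.
Proof. by rewrite /= in_itv /= andbT. Qed.

Lemma ewt_gt0 g s : 0 < ewt g s.
Proof. exact: expR_gt0. Qed.

Lemma ewtM g g' s : ewt g s * ewt g' s = expR (- (s * (g + g'))).
Proof. by rewrite /ewt -expRD -opprD mulrDr. Qed.

Lemma ewt_le g g' s : g <= g' -> 0 < s -> ewt g' s <= ewt g s.
Proof. by move=> gg s0; rewrite ler_expR lerN2 ler_wpM2l // ltW. Qed.

(** The growing weight [e^{B s}] and the decaying weight [e^{-(B+1) s}] multiply to [e^{-s}]; its
    integral 1 is the normalisation assumed for [WeightedOperators]. *)
Lemma ewt_pairE B : (fun s => ewt (- B) s * ewt (B + 1) s) = (fun s => expR (- s)).
Proof. by apply/funext => s; rewrite ewtM addKr mulr1. Qed.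

Lemma rintegrable_wt B : rintegrable half (fun s => ewt (- B) s * ewt (B + 1) s).
Proof. by rewrite ewt_pairE; exact: rintegrable_expN. Qed.

Lemma Rintegral_wt B : \int[mu]_(s in half) (ewt (- B) s * ewt (B + 1) s) = 1.
Proof. by rewrite ewt_pairE Rintegral_expN. Qed.

Lemma bounded_shift (f : R -> C) (g M X y : R) : cmeas f -> 0 <= M -> `|y| <= X ->
  (forall xi, - X <= xi -> nrm (f xi) <= M * expR (- (xi * g))) ->
  bounded_by half (ewt g) (fun s => f (y + s)) (M * expR (X * `|g|)).
Proof.
move=> mf M0 yX h; split; first exact: cmeas_shift.
move=> s /halfP s0; have Xy : - X <= y by move: yX; rewrite ler_norml => /andP[].
apply: le_trans (h _ _) _; first by rewrite (le_trans Xy) // lerDl ltW.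
rewrite -mulrA ler_wpM2l // /ewt -expRD ler_expR mulrDl opprD lerD2r.
apply: le_trans (ler_norm _) _; rewrite normrN normrM; exact: ler_wpM2r.
Qed.

Definition kern (y s t : R) : C := airy_kernel (y + s) (y + t).

Lemma cmeas2_kern y : cmeas (fun p : R * R => kern y p.1 p.2).
Proof.
apply: (cmeas_comp (@cmeas_airy_kernel R) (g := fun p : R * R => (y + p.1, y + p.2))).
apply/measurable_fun_pairP; split => /=; apply: measurable_funD => //.
Qed.

Lemma kern_sym y s t : kern y s t = kern y t s.
Proof. exact: airy_kernel_sym. Qed.

Lemma ewt_shift2 g X y s t : `|y| <= X ->
  expR (- (g * (y + s))) * expR (- (g * (y + t))) <= expR (2 * (X * `|g|)) * (ewt g s * ewt g t).
Proof.
move=> yX; rewrite /ewt -!expRD ler_expR.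
have h : - (y * g) <= X * `|g|.
  by apply: le_trans (ler_norm _) _; rewrite normrN normrM; exact: ler_wpM2r.
by rewrite !mulrDr (mulrC g y) (mulrC g s) (mulrC g t); lra.
Qed.

Lemma kern_bound (g X : R) : 1 <= g -> 0 <= X -> exists2 M, 0 <= M &
  forall y, `|y| <= X -> kernel_bound half (ewt g) (kern y) M.
Proof.
move=> g1 X0; have [M M0 h] := airy_kernel_bound g1 X0.
exists (M * expR (2 * (X * `|g|))); first by rewrite mulr_ge0 ?expR_ge0.
move=> y yX; split; first exact: cmeas2_kern.
have Xy : - X <= y by move: yX; rewrite ler_norml => /andP[].
move=> s t /halfP s0 /halfP t0; apply: le_trans (h _ _ _ _) _; try by rewrite (le_trans Xy) // lerDl ltW.
by rewrite -mulrA ler_wpM2l // ewt_shift2.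
Qed.

Lemma kern_taylor (g X : R) : 1 <= g -> 0 <= X -> exists2 M, 0 <= M &
  forall y d, `|y| <= X -> `|d| <= 1 -> kernel_bound half (ewt g)
   (fun s t => kern (y + d) s t - kern y s t + d%:C * (AiD 0 (y + s) * AiD 0 (y + t))) (M * d ^+ 2).
Proof.
move=> g1 X0; have [M M0 h] := airy_kernel_taylor g1 X0.
exists (M * expR (2 * (X * `|g|))); first by rewrite mulr_ge0 ?expR_ge0.
move=> y d yX d1; split.
  apply: cmeasD; first by apply: cmeasB; exact: cmeas2_kern.
  apply: cmeasM; first exact: cmeas_cst.
  by apply: cmeasM; [apply: (cmeas_comp (cmeas_shift y (@cmeas_AiD R 0)) (g := fst))
                    |apply: (cmeas_comp (cmeas_shift y (@cmeas_AiD R 0)) (g := snd))].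
have Xy : - X <= y by move: yX; rewrite ler_norml => /andP[].
move=> s t /halfP s0 /halfP t0; rewrite /kern !(addrAC y d).
apply: le_trans (h _ _ _ _ _ d1) _; try by rewrite (le_trans Xy) // lerDl ltW.
have W := ler_wpM2l (mulr_ge0 M0 (sqr_ge0 d)) (ewt_shift2 g s t yX).
by apply: le_trans W _; rewrite le_eqVlt; apply/orP; left; apply/eqP; ring.
Qed.

Variable B : R.
Hypothesis B0 : 0 <= B.
Local Notation aw := (ewt (- B)).
Local Notation bw := (ewt (B + 1)).

Let ge1 : 1 <= B + 1. Proof. by rewrite lerDr. Qed.
Let mhalf : measurable half. Proof. exact: measurable_itv. Qed.
Let aw_gt0 s : half s -> 0 < aw s. Proof. by move=> _; exact: ewt_gt0. Qed.
Let bw_gt0 s : half s -> 0 < bw s. Proof. by move=> _; exact: ewt_gt0. Qed.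
Let bw_le_aw s : half s -> bw s <= aw s.
Proof. by move=> /halfP s0; apply: ewt_le => //; have h := B0; lra. Qed.

(** Invertibility of [1 - A_y] on functions growing like [e^{B s}]. It takes the place of
    [F_0(y) <> 0] because its openness in [y] ([good_near]) comes from the Neumann series instead of
    continuity of [F_0]. *)
Definition good y := exists K, solvable half aw (kern y) K.

(* <(1 - A_y)^{-1} f, Ai^(n)> over (y, oo), translated to (0, oo). *)
Definition pair (f : R -> C) n y :=
  dual half (sol half aw (kern y) (fun s => f (y + s))) (fun s => AiD n (y + s)).

Lemma AiD_bounded n X : 0 <= X -> exists2 M, 0 <= M &
  forall y, `|y| <= X -> bounded_by half bw (fun s => AiD n (y + s)) M.
Proof.
move=> X0; have [M M0 h] := @AiD_bound R n (B + 1) _ X0.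
exists (M * expR (X * `|B + 1|)); first by rewrite mulr_ge0 ?expR_ge0.
by move=> y yX; apply: bounded_shift => //; exact: cmeas_AiD.
Qed.

Lemma kern_diff X : 0 <= X -> exists2 M, 0 <= M &
  forall y d, `|y| <= X -> `|d| <= 1 ->
  kernel_bound half bw (fun s t => kern (y + d) s t - kern y s t) (M * `|d|).
Proof.
move=> X0; have [M M0 hM] := kern_taylor ge1 X0; have [A A0 hA] := AiD_bounded 0 X0.
exists (M + A * A) => [|y d yX d1]; first by rewrite addr_ge0 ?mulr_ge0.
split; first by apply: cmeasB; exact: cmeas2_kern.
move=> s t Ds Dt.
have -> : kern (y + d) s t - kern y s t =
  (kern (y + d) s t - kern y s t + d%:C * (AiD 0 (y + s) * AiD 0 (y + t))) -
   d%:C * (AiD 0 (y + s) * AiD 0 (y + t)) by rewrite addrK.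
apply: le_trans (nrmB _ _) _; rewrite nrmMr mulrDl mulrDl; apply: lerD.
  apply: le_trans ((hM y d yX d1).2 s t Ds Dt) _.
  apply: ler_wpM2r; first by rewrite mulr_ge0 // ltW ?bw_gt0 ?aw_gt0.
  rewrite ler_wpM2l // -(real_normK (num_real d)) expr2 -[leRHS]mulr1; exact: ler_wpM2l.
rewrite (mulrC (A * A)) -[leRHS]mulrA ler_wpM2l // [leRHS]mulrACA; apply: le_trans (nrmM _ _) _.
by apply: ler_pM; rewrite ?nrm_ge0 //; exact: (hA y yX).2.
Qed.

Lemma good_near y : good y -> exists K, exists2 e, 0 < e <= 1 &
  forall d, `|d| <= e -> solvable half aw (kern (y + d)) K.
Proof.
move=> [K sK]; have K0 : 0 <= K by case: sK.
have [M M0 hM] := kern_diff (normr_ge0 y).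
have X1 : 0 <= `|y| + 1 by rewrite addr_ge0.
have [N N0 hN] := kern_bound ge1 X1.
have KM : 0 <= K * M by rewrite mulr_ge0.
have KM1 : 0 < 2 * (K * M + 1) by rewrite mulr_gt0 // ltr_wpDl.
(* [4 * K] is the bound of [solvable_near], and [e] is such that the kernel changes by an amount
   whose product with [K] is at most [2^-1]; [d] stays below 1 for the Taylor estimates. *)
exists (4 * K), (Num.min 1 (2 * (K * M + 1))^-1).
  by rewrite lt_min ltr01 invr_gt0 KM1 /= ge_min lexx.
move=> d; rewrite le_min => /andP[d1 dK].
have yd : `|y + d| <= `|y| + 1 by apply: le_trans (ler_normD _ _) _; rewrite lerD2l.
have yy : `|y| <= `|y| + 1 by rewrite lerDl.
apply: (@solvable_near _ _ _ _ mhalf aw_gt0 bw_gt0 bw_le_aw (rintegrable_wt B) (Rintegral_wt B)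
  _ _ _ _ _ (M * `|d|) (hN _ yy) (hN _ yd) sK (hM _ _ (lexx _) d1)).
rewrite mulrA; apply: (@le_trans _ _ (K * M * (2 * (K * M + 1))^-1)); first exact: ler_wpM2l.
by rewrite ler_pdivrMr //; lra.
Qed.

(** The bound is uniform on each half-line starting at [- X], because the left endpoint [y] of the
    interval moves when a pairing is differentiated. *)
Definition tempered (f : R -> C) := cmeas f /\ forall X, 0 <= X -> exists2 M, 0 <= M &
  forall xi, - X <= xi -> nrm (f xi) <= M * expR (- (xi * - B)).

Definition has_taylor (f f1 : R -> C) := forall X, 0 <= X -> exists2 M, 0 <= M &
  forall xi d, - X <= xi -> `|d| <= 1 ->
  nrm (f (xi + d) - f xi - d%:C * f1 xi) <= M * d ^+ 2 * expR (- (xi * - B)).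

Lemma tempered_bounded f X : tempered f -> 0 <= X -> exists2 M, 0 <= M &
  forall y, `|y| <= X -> bounded_by half aw (fun s => f (y + s)) M.
Proof.
move=> [mf bf] X0; have [M M0 h] := bf X X0.
exists (M * expR (X * `|- B|)); first by rewrite mulr_ge0 ?expR_ge0.
by move=> y yX; apply: bounded_shift.
Qed.

Lemma tempered_AiD n : tempered (AiD n).
Proof. by split; [exact: cmeas_AiD|move=> X X0; exact: AiD_bound]. Qed.

Lemma has_taylor_AiD n : has_taylor (@AiD R n) (@AiD R n.+1).
Proof. by move=> X X0; exact: AiD_taylor. Qed.

(** The vertex of height [- B] leaves a gap of 1 below the pole, and integration along that contour
    gives growth [e^{B xi}]. *)
Lemma tempered_Cfun w : 1 - B <= pole_height w -> tempered (Cfun w).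
Proof.
move=> hw; split=> [|X X0]; first exact: cmeas_Cfun.
have hc v : v \in [:: w] -> - B + 1 <= pole_height v by rewrite inE => /eqP ->; rewrite addrC.
have [M M0 h] := @sfun_bound R [:: w] (- B) X hc X0.
by exists M => // xi Xxi; rewrite CfunE; exact: h.
Qed.

Lemma has_taylor_Cfun w : 1 - B <= pole_height w ->
  has_taylor (Cfun w) (fun xi => AiD 0 xi - w * Cfun w xi).
Proof. by move=> hw X X0; apply: Cfun_taylor => //; rewrite addrC. Qed.

Lemma temperedD f g : tempered f -> tempered g -> tempered (fun xi => f xi + g xi).
Proof.
move=> [mf bf] [mg bg]; split=> [|X X0]; first exact: cmeasD.
have [M M0 hM] := bf X X0; have [N N0 hN] := bg X X0; exists (M + N); first exact: addr_ge0.
move=> xi Xxi; apply: le_trans (nrmD _ _) _; rewrite mulrDl; apply: lerD; [exact: hM|exact: hN].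
Qed.

Lemma temperedZ z f : tempered f -> tempered (fun xi => z * f xi).
Proof.
move=> [mf bf]; split=> [|X X0]; first by apply: cmeasM => //; exact: cmeas_cst.
have [M M0 hM] := bf X X0; exists (nrm z * M); first by rewrite mulr_ge0 ?nrm_ge0.
by move=> xi Xxi; apply: le_trans (nrmM _ _) _; rewrite -mulrA ler_wpM2l ?nrm_ge0 ?hM.
Qed.

Lemma tempered0 : tempered (fun=> 0).
Proof.
split=> [|X X0]; first exact: cmeas_cst.
by exists 0 => // xi _; rewrite nrm0 mul0r.
Qed.

Lemma sol_tempered y f K : solvable half aw (kern y) K -> tempered f ->
  exists2 M, bounded_by half aw (fun s => f (y + s)) M &
  bounded_by half aw (sol half aw (kern y) (fun s => f (y + s))) (K * M) /\
  forall s, half s -> sol half aw (kern y) (fun s => f (y + s)) s -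
    op half (kern y) (sol half aw (kern y) (fun s => f (y + s))) s = f (y + s).
Proof.
move=> sK tf; have [N N0 hN] := kern_bound ge1 (normr_ge0 y).
have [M M0 hM] := tempered_bounded tf (normr_ge0 y); exists M; first exact: hM.
exact: (sol_props mhalf (rintegrable_wt B) (hN _ (lexx _)) sK (hM _ (lexx _))).
Qed.

Lemma pairD y f g n : good y -> tempered f -> tempered g ->
  pair (fun xi => f xi + g xi) n y = pair f n y + pair g n y.
Proof.
move=> [K sK] tf tg; have [N N0 hN] := kern_bound ge1 (normr_ge0 y).
have [A A0 hA] := AiD_bounded n (normr_ge0 y).
have [M hM [hf ef]] := sol_tempered sK tf; have [P hP [hg eg]] := sol_tempered sK tg.
rewrite /pair -(dualDl mhalf (rintegrable_wt B) hf hg (hA _ (lexx _))).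
apply: eq_cint => s Ds; congr (_ * _).
apply: (solE mhalf (rintegrable_wt B) (hN _ (lexx _)) sK (bounded_byD hM hP) (bounded_byD hf hg)) => // t Dt.
by rewrite (opD mhalf (rintegrable_wt B) (hN _ (lexx _)) hf hg Dt) -ef // -eg //; ring.
Qed.

Lemma pairZ y z f n : good y -> tempered f ->
  pair (fun xi => z * f xi) n y = z * pair f n y.
Proof.
move=> [K sK] tf; have [N N0 hN] := kern_bound ge1 (normr_ge0 y).
have [A A0 hA] := AiD_bounded n (normr_ge0 y).
have [M hM [hf ef]] := sol_tempered sK tf.
rewrite /pair -(dualZl mhalf (rintegrable_wt B) _ hf (hA _ (lexx _))).
apply: eq_cint => s Ds; congr (_ * _).
apply: (solE mhalf (rintegrable_wt B) (hN _ (lexx _)) sK (bounded_byZ z hM) (bounded_byZ z hf)) => // t Dt.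
by rewrite (opZ mhalf (rintegrable_wt B) _ (hN _ (lexx _)) hf Dt) -ef // mulrBr.
Qed.

(** After translation the domain is fixed, and [f], [Ai^(n)] and the kernel vary with [y], one term
    each; the rank-one derivative of the kernel makes its term a product of two pairings. *)
Lemma cder_pair y f f1 n : good y -> tempered f -> tempered f1 -> has_taylor f f1 ->
  cder (pair f n) y (pair f1 n y + pair f n.+1 y - pair f 0 y * pair (AiD 0) n y).
Proof.
move=> gy tf tf1 ht; have [K [e /andP[e0 e1] hK]] := good_near gy.
have X1 : 0 <= `|y| + 1 by rewrite addr_ge0.
have yX : `|y| <= `|y| + 1 by rewrite lerDl.
have ydX d : `|d| <= e -> `|y + d| <= `|y| + 1.
  by move=> de; apply: le_trans (ler_normD _ _) _; rewrite lerD2l (le_trans de).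
have [kappa kappa0 hk] := kern_bound ge1 X1.
have [ck ck0 hck] := kern_taylor ge1 X1.
have [ca ca0 hal] := AiD_bounded 0 X1.
have [c1 c10 hf] := tempered_bounded tf X1; have [c2 c20 hf1] := tempered_bounded tf1 X1.
have [c3 c30 hT] := ht _ X1.
have [c4 c40 hA] := AiD_bounded n X1; have [c5 c50 hA1] := AiD_bounded n.+1 X1.
have [c6 c60 hA2] := @AiD_taylor R n (B + 1) _ X1.
have awge s : half s -> 0 <= aw s by move=> Ds; exact: ltW (aw_gt0 Ds).
(* [dual_sol_taylor] takes a single constant for the data, their derivative and the Taylor
   remainder: the sum of the three bounds. The exponential factor comes from the translation by [y]
   in [bounded_shift]. *)
pose cg := c1 + c2 + c3 * expR ((`|y| + 1) * `|- B|).
pose ch := c4 + c5 + c6 * expR ((`|y| + 1) * `|B + 1|).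
have p3 : 0 <= c3 * expR ((`|y| + 1) * `|- B|) by rewrite mulr_ge0 ?expR_ge0.
have p6 : 0 <= c6 * expR ((`|y| + 1) * `|B + 1|) by rewrite mulr_ge0 ?expR_ge0.
have c1g : c1 <= cg by rewrite /cg -addrA lerDl addr_ge0.
have c2g : c2 <= cg by rewrite /cg addrAC lerDr addr_ge0.
have c3g : c3 * expR ((`|y| + 1) * `|- B|) <= cg by rewrite /cg lerDr addr_ge0.
have c4h : c4 <= ch by rewrite /ch -addrA lerDl addr_ge0.
have c5h : c5 <= ch by rewrite /ch addrAC lerDr addr_ge0.
have c6h : c6 * expR ((`|y| + 1) * `|B + 1|) <= ch by rewrite /ch lerDr addr_ge0.
have mf := tf.1; have mf1 := tf1.1; have mA m := @cmeas_AiD R m.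
have mtr (d : R) (h : R -> C) : cmeas h -> cmeas (fun xi : R => h (xi + d)).
  by move=> mh; have := cmeas_shift d mh; under eq_fun do rewrite addrC.
have := @dual_sol_taylor _ half aw bw mhalf aw_gt0 bw_gt0 bw_le_aw (rintegrable_wt B) (Rintegral_wt B)
  (fun d => kern (y + d)) (fun s => AiD 0 (y + s)) (fun d s => f (y + d + s)) (fun d s => AiD n (y + d + s))
  (fun s => f1 (y + s)) (fun s => AiD n.+1 (y + s)) kappa K e cg ch ca ck e0 e1.
rewrite !addr0.
case.
- by move=> s t; exact: kern_sym.
- by move=> d de; apply: hk; exact: ydX.
- exact: hK.
- by move=> d de; apply: hck => //; exact: le_trans de e1.
- exact: hal.
- by move=> d de; apply: bounded_by_le aw_gt0 (hf _ (ydX d de)) c1g.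
- exact: bounded_by_le aw_gt0 (hf1 _ yX) c2g.
- move=> d de.
  have hb := @bounded_shift (fun xi => f (xi + d) - f xi - d%:C * f1 xi) (- B) (c3 * d ^+ 2) _ y _ _ yX
    (fun xi Xxi => hT xi d Xxi (le_trans de e1)).
  have {hb} : bounded_by half aw (fun s => f (y + s + d) - f (y + s) - d%:C * f1 (y + s))
     (c3 * d ^+ 2 * expR ((`|y| + 1) * `|- B|)).
    apply: hb; last by rewrite mulr_ge0 ?sqr_ge0.
    apply: cmeasB; first by apply: cmeasB => //; exact: mtr.
    by apply: cmeasM => //; exact: cmeas_cst.
  rewrite (_ : (fun s => f (y + d + s) - _ - _) = (fun s => f (y + s + d) - f (y + s) - d%:C * f1 (y + s))); last by apply/funext => s; rewrite (addrAC y d).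
  move=> hb; apply: bounded_by_le aw_gt0 hb _.
  by rewrite mulrAC ler_wpM2r ?sqr_ge0.
- by move=> d de; apply: bounded_by_le bw_gt0 (hA _ (ydX d de)) c4h.
- exact: bounded_by_le bw_gt0 (hA1 _ yX) c5h.
- move=> d de.
  have hb := @bounded_shift (fun xi => AiD n (xi + d) - AiD n xi - d%:C * AiD n.+1 xi) (B + 1) (c6 * d ^+ 2) _ y _ _ yX
    (fun xi Xxi => hA2 xi d Xxi (le_trans de e1)).
  have {hb} : bounded_by half bw (fun s => AiD n (y + s + d) - AiD n (y + s) - d%:C * AiD n.+1 (y + s))
     (c6 * d ^+ 2 * expR ((`|y| + 1) * `|B + 1|)).
    apply: hb; last by rewrite mulr_ge0 ?sqr_ge0.
    apply: cmeasB; first by apply: cmeasB => //; exact: mtr.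
    by apply: cmeasM => //; exact: cmeas_cst.
  have -> : (fun s => AiD n (y + s + d) - AiD n (y + s) - d%:C * AiD n.+1 (y + s)) =
      (fun s => AiD n (y + d + s) - AiD n (y + s) - d%:C * AiD n.+1 (y + s)).
    by apply/funext => s; rewrite (addrAC y d).
  move=> hb; apply: bounded_by_le bw_gt0 hb _.
  by rewrite mulrAC ler_wpM2r ?sqr_ge0.
- move=> c c0 hc; by apply: (cder_of_taylor c0); exists e.
Qed.

End AiryResolvent.

(** * Iterates of [w + D_x] *)

Section DerivativeFormula.
Variable R : realType.
Local Notation C := R[i].

Lemma cderive_eq (f : R -> C) (y : R) l : cder f y l -> cderive f y = l.
Proof.
by move=> [h1 h2]; apply: complexP; rewrite /= derive1E derive_val.
Qed.

Lemma cder_near (f g : R -> C) (y : R) l :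
  (exists2 e, 0 < e & forall d, `|d| <= e -> f (y + d) = g (y + d)) ->
  cder f y l -> cder g y l.
Proof.
move=> [e e0 h]; have key (p : C -> R) : \near y, p (f y) = p (g y).
  near=> z; congr p; have E : y + (z - y) = z by rewrite addrC subrK.
  rewrite -E; apply: h; near: z.
  exact: (@cvgr_distC_le _ _ _ _ _ id y (@cvg_id _ (nbhs y)) e e0).
by move=> [h1 h2]; split; apply: near_eq_is_derive (key _) _.
Unshelve. all: by end_near. Qed.

Variable B : R.
Hypothesis B0 : 0 <= B.

(* f_n(y, w), so that fpair w 0 = f(., w). *)
Definition fpair (w : C) n y := w ^+ n - pair B (Cfun w) n y.

Lemma cder_pair_AiD m n y : good B y -> cder (pair B (AiD m) n) y
  (pair B (AiD m.+1) n y + pair B (AiD m) n.+1 y - pair B (AiD m) 0 y * pair B (AiD 0) n y).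
Proof.
move=> gy; apply: (cder_pair B0 n gy); [exact: tempered_AiD|exact: tempered_AiD|exact: has_taylor_AiD].
Qed.

Lemma cder_fpair w n y : 1 - B <= pole_height w -> good B y -> cder (fpair w n) y
  (fpair w n.+1 y - w * fpair w n y - pair B (AiD 0) n y * fpair w 0 y).
Proof.
move=> hw gy; have tC := tempered_Cfun hw; have tA := @tempered_AiD R B 0.
have tC1 : tempered B (fun xi => AiD 0 xi - w * Cfun w xi).
  have := temperedD tA (temperedZ (- w) tC).
  by under eq_fun do rewrite mulNr.
have := cderB (cder_cst (w ^+ n) y) (cder_pair B0 n gy tC tC1 (has_taylor_Cfun hw)).
move=> h; apply: cder_eq h _; rewrite /fpair exprS expr0.
have -> : pair B (fun xi => AiD 0 xi - w * Cfun w xi) n y =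
    pair B (AiD 0) n y + - w * pair B (Cfun w) n y.
  by rewrite -(pairZ B0 _ _ gy tC) -(pairD B0 _ gy tA (temperedZ (- w) tC)); under eq_fun do rewrite -mulNr.
move: (pair B (AiD 0) n y) (pair B (Cfun w) n y) (pair B (Cfun w) n.+1 y) (pair B (Cfun w) 0 y) => *.
ring.
Qed.

(* Polynomials in the functions <(1 - A_y)^{-1} Ai^(m), Ai^(n)>, a class closed
   under d/dy. *)
Inductive qexpr := Qatom of nat & nat | Qconst of C | Qadd of qexpr & qexpr | Qmul of qexpr & qexpr.

Fixpoint qeval (e : qexpr) (y : R) : C :=
  match e with
  | Qatom m n => pair B (AiD m) n y
  | Qconst z => z
  | Qadd e1 e2 => qeval e1 y + qeval e2 y
  | Qmul e1 e2 => qeval e1 y * qeval e2 y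
  end.

Fixpoint qder (e : qexpr) : qexpr :=
  match e with
  | Qatom m n => Qadd (Qadd (Qatom m.+1 n) (Qatom m n.+1)) (Qmul (Qconst (-1)) (Qmul (Qatom m 0) (Qatom 0 n)))
  | Qconst z => Qconst 0
  | Qadd e1 e2 => Qadd (qder e1) (qder e2)
  | Qmul e1 e2 => Qadd (Qmul (qder e1) e2) (Qmul e1 (qder e2))
  end.

Lemma cder_qeval e y : good B y -> cder (qeval e) y (qeval (qder e) y).
Proof.
move=> gy; elim: e => [m n|z|e1 h1 e2 h2|e1 h1 e2 h2] /=.
- by apply: cder_eq (cder_pair_AiD m n gy) _; rewrite mulN1r.
- exact: cder_cst.
- exact: cderD.
- exact: cderM.
Qed.

Fixpoint qsum (n : nat) (F : nat -> qexpr) : qexpr :=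
  if n is n'.+1 then Qadd (qsum n' F) (F n') else Qconst 0.

Lemma qsumE n F y : qeval (qsum n F) y = \sum_(i < n) qeval (F i) y.
Proof. by elim: n => [|n IH] /=; rewrite ?big_ord0 // big_ord_recr IH. Qed.

(* Coefficients of (w + D)^n f_0 - f_n on f_0, ..., f_(n-1), read off from
   (w + D) f_j = f_(j+1) - q_j f_0. *)
Fixpoint itercoef (n : nat) (j : nat) : qexpr :=
  if n is n'.+1 then
    Qadd (if (j < n')%N then qder (itercoef n' j) else Qconst 0)
      (if j is j'.+1 then itercoef n' j'
       else Qmul (Qconst (-1)) (Qadd (Qatom 0 n') (qsum n' (fun i => Qmul (itercoef n' i) (Qatom 0 i)))))
  else Qconst 0.

Lemma itercoefS n (j : nat) y : qeval (itercoef n.+1 j) y =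
  (if (j < n)%N then qeval (qder (itercoef n j)) y else 0) +
  (if j is i.+1 then qeval (itercoef n i) y
   else - (pair B (AiD 0) n y + \sum_(i < n) qeval (itercoef n i) y * pair B (AiD 0) i y)).
Proof.
case: j => [|j] /=; rewrite ?qsumE ?mulN1r; congr (_ + _); by case: ifP.
Qed.

(** One application of [w + D] when [f_j' = f_{j+1} - w f_j - q_j f_0]: the terms containing [w]
    cancel, so the new coefficients are again free of [w]. *)
Lemma itercoef_step n (w : C) (f q c c' : nat -> C) :
  w * (f n + \sum_(j < n) c j * f j) +
  (f n.+1 - w * f n - q n * f 0 +
   \sum_(i < n) (c' i * f i + c i * (f i.+1 - w * f i - q i * f 0))) =
  f n.+1 + \sum_(j < n.+1) ((if (j < n)%N then c' j else 0) +
     (if j : nat is i.+1 then c i else - (q n + \sum_(i < n) c i * q i))) * f j.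
Proof.
rewrite big_ord_recl /=.
have -> : \sum_(i < n) ((if (bump 0 i < n)%N then c' (bump 0 i) else 0) + c (0 + i)%N) * f (bump 0 i) =
  \sum_(i < n) (if (i.+1 < n)%N then c' i.+1 * f i.+1 else 0) + \sum_(i < n) c i * f i.+1.
  rewrite -big_split /=; apply: eq_bigr => i _; rewrite /bump /= add1n mulrDl; congr (_ + _).
  by case: ifP => //=; rewrite mul0r.
have -> : \sum_(i < n) (c' i * f i + c i * (f i.+1 - w * f i - q i * f 0)) =
  \sum_(i < n) c' i * f i + \sum_(i < n) c i * f i.+1 - w * (\sum_(i < n) c i * f i) -
  (\sum_(i < n) c i * q i) * f 0.
  by rewrite mulr_sumr mulr_suml -!big_split -!sumrB /=; apply: eq_bigr => i _; ring.
have -> : \sum_(i < n) c' i * f i = (if (0 < n)%N then c' 0 else 0) * f 0 +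
  \sum_(i < n) (if (i.+1 < n)%N then c' i.+1 * f i.+1 else 0).
  clear; case: n => [|n]; first by rewrite !big_ord0 mul0r addr0.
  rewrite big_ord_recl /=; congr (_ + _); rewrite big_ord_recr /= ltnn addr0.
  by apply: eq_bigr => i _; rewrite /bump /= add1n ltnS ltn_ord.
move: (\sum_(i < n) c i * q i) (\sum_(i < n) c i * f i) (\sum_(i < n) c i * f i.+1)
  (\sum_(i < n) _) (if (0 < n)%N then _ else _) => S1 S2 S3 S4 S5.
ring.
Qed.

Lemma cder_sum n (F : nat -> R -> C) (l : nat -> C) y : (forall i, cder (F i) y (l i)) ->
  cder (fun z => \sum_(i < n) F i z) y (\sum_(i < n) l i).
Proof.
move=> h; elim: n => [|n IH].
  by under eq_fun do rewrite big_ord0; rewrite big_ord0; exact: cder_cst.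
by under eq_fun do rewrite big_ord_recr; rewrite big_ord_recr; exact: cderD.
Qed.

Lemma iter_w_plus_D w (g : R -> C) n y : 1 - B <= pole_height w ->
  (forall z, good B z -> g z = fpair w 0 z) -> good B y ->
  iter n (w_plus_D w) g y = fpair w n y + \sum_(j < n) qeval (itercoef n j) y * fpair w j y.
Proof.
move=> hw hg; elim: n y => [|n IH] y gy; first by rewrite /= big_ord0 addr0 hg.
rewrite iterS /w_plus_D IH //.
pose G z := fpair w n z + \sum_(j < n) qeval (itercoef n j) z * fpair w j z.
have dG := cderD (cder_fpair n hw gy) (cder_sum n (fun j => cderM (cder_qeval (itercoef n j) gy) (cder_fpair j hw gy))).
have dI : cder (iter n (w_plus_D w) g) y
    (fpair w n.+1 y - w * fpair w n y - pair B (AiD 0) n y * fpair w 0 y +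
     \sum_(i < n) (qeval (qder (itercoef n i)) y * fpair w i y +
       qeval (itercoef n i) y * (fpair w i.+1 y - w * fpair w i y - pair B (AiD 0) i y * fpair w 0 y))).
  (* Goodness is an open condition, so the induction hypothesis holds on a neighbourhood of [y] and
     may be differentiated. *)
  apply: cder_near dG; have [K [e /andP[e0 _] hK]] := good_near B0 gy.
  exists e; first exact: e0.
  by move=> d de; apply/esym/IH; exists K; exact: hK.
rewrite (cderive_eq dI).
rewrite (itercoef_step n w (fun i => fpair w i y) (fun i => pair B (AiD 0) i y)
  (fun i => qeval (itercoef n i) y) (fun i => qeval (qder (itercoef n i)) y)).
by congr (_ + _); apply: eq_bigr => i _; rewrite itercoefS.
Qed.

End DerivativeFormula.

(** * Invertibility from the Fredholm determinant *)

Section FredholmLink.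
Variable R : realType.
Local Notation C := R[i].
Local Notation mu := (@lebesgue_measure R).
Local Notation half := (`]0%R, +oo[%classic : set R).

Lemma norm_le_nrm (z : C) : `|z| <= (nrm z)%:C.
Proof.
rewrite normc_def lecR -[nrm z]ger0_norm ?nrm_ge0 // -sqrtr_sqr; apply: ler_wsqrtr.
rewrite /nrm sqrrD !real_normK ?num_real // -addrA lerD2l addrC lerDl.
by rewrite mulrn_wge0 // mulr_ge0.
Qed.

Lemma cvg_nrm (T : Type) (F : set_system T) (f : T -> C) (l : C) : Filter F ->
  (forall e : R, 0 < e -> \forall t \near F, nrm (l - f t) <= e) -> f @ F --> l.
Proof.
move=> FF h; apply/cvgrPdist_le => e e0.
have Re0 : 0 < complex.Re e by move: e0; rewrite ltcE => /andP[].
have -> : e = (complex.Re e)%:C.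
  by move: e0; rewrite ltcE => /andP[/eqP ie _]; apply: complexP => /=.
by apply: filterS (h _ Re0) => t ht; apply: le_trans (norm_le_nrm _) _; rewrite lecR.
Qed.

Lemma lim_series_nrm (z : nat -> C) F c : 0 <= c ->
  (forall n, nrm (F - \sum_(0 <= i < n) z i) <= c * 2^-1 ^+ n) -> limn (series z) = F.
Proof.
move=> c0 h; apply/cvg_lim; first exact: norm_hausdorff.
apply: cvg_nrm => e e0.
have h2 : `|2^-1 : R| < 1 by rewrite ger0_norm // invf_lt1 ?ltr1n.
by apply: filterS (cvgr_le 0 (cvg_geometric c h2) e e0) => n; apply: le_trans; exact: h.
Qed.

Variables (B x : R).
Hypothesis B0 : 0 <= B.
Local Notation D := (`]x, +oo[%classic : set R).
Local Notation aw := (ewt (- B)).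
Local Notation ax := (fun xi => ewt (- B) (xi - x)).
Local Notation bx := (fun xi => ewt (B + 1) (xi - x)).

Let mD : measurable D. Proof. exact: measurable_itv. Qed.

Lemma rayP (xi : R) : D xi <-> half (xi - x).
Proof. by rewrite /= !in_itv /= !andbT subr_gt0. Qed.

Lemma measurable_wt_shift : measurable_fun setT (fun xi : R => ewt (- B) (xi - x) * ewt (B + 1) (xi - x)).
Proof.
rewrite (_ : (fun xi => _) = (fun s : R => expR (- s)) \o (fun xi => xi - x)); last first.
  by apply/funext => xi; rewrite /= ewtM addKr mulr1.
apply: measurableT_comp; last exact: measurable_funB.
by apply: measurableT_comp => //; exact: measurable_funN.
Qed.

Lemma rintegrable_wt_shift : rintegrable D (fun xi => ewt (- B) (xi - x) * ewt (B + 1) (xi - x)).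
Proof.
apply/integrableP; split.
  by apply/measurable_EFinP; apply: measurable_funTS; exact: measurable_wt_shift.
have := rintegrable_wt B => /integrableP[_].
rewrite ge0_integral_shift => [|//|u //].
  suff -> : (fun s => `|(ewt (- B) (x + s - x) * ewt (B + 1) (x + s - x))%:E|)%E =
    (fun s => `|(ewt (- B) s * ewt (B + 1) s)%:E|)%E by [].
  by apply/funext => s; rewrite (addrAC x s) subrr add0r.
apply: measurable_funTS; apply: measurableT_comp => //.
by apply/measurable_EFinP; exact: measurable_wt_shift.
Qed.

Lemma Rintegral_wt_shift : \int[mu]_(xi in D) (ewt (- B) (xi - x) * ewt (B + 1) (xi - x)) = 1.
Proof.
rewrite Rintegral_shift; last by apply: measurable_funTS; exact: measurable_wt_shift.
rewrite -[RHS](Rintegral_wt B); apply: eq_Rintegral => s _.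
by rewrite (addrAC x s) subrr add0r.
Qed.

Lemma airy_kernel_ray_bound : exists2 M, 0 <= M & kernel_bound D bx (@airy_kernel R) M.
Proof.
have g1 : 1 <= B + 1 by rewrite lerDr.
have [M M0 hk] := kern_bound g1 (normr_ge0 x).
exists M => //; split; first exact: cmeas_airy_kernel.
move=> s t /rayP Ds /rayP Dt; have := (hk x (lexx _)).2 _ _ Ds Dt.
by rewrite /kern !subrKC.
Qed.

(** [F0] is a series of integrals over [(x, oo)] whose terms unfold to [fredholm_coef], so
    Fredholm's minors are used there, with weights recentred at [x]. [good_of_F0] carries the result
    over to [(0, oo)]. *)
Lemma fredholm_solvable : F0 x != 0 -> exists K, solvable D ax (@airy_kernel R) K.
Proof.
move=> Fx; have [M M0 hM] := airy_kernel_ray_bound.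
have ax0 s : D s -> 0 < ax s by move=> _; exact: ewt_gt0.
have bx0 s : D s -> 0 < bx s by move=> _; exact: ewt_gt0.
have ba s : D s -> bx s <= ax s.
  by move=> /rayP /halfP s0; apply: ewt_le => //; have := B0; lra.
have ne : exists s, D s by exists (x + 1); rewrite /= in_itv /= andbT ltrDl.
have [P P0 hP] := fredholm_coef_bound mD ax0 bx0 ba rintegrable_wt_shift Rintegral_wt_shift M0 hM.
have [F hF] := cseries_limit P0 hP.
have P40 : 0 <= 4 * P by rewrite mulr_ge0.
have F0E : F0 x = F by exact: (lim_series_nrm P40 hF).
apply: (fredholm_invertible mD ax0 bx0 ba rintegrable_wt_shift Rintegral_wt_shift M0 hM _ ne (F := F)).
  by rewrite -F0E.
by exists (4 * P).
Qed.

Lemma airy_op_shift u s : cmeas u -> half s ->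
  airy_op x u (x + s) = op half (kern x) (fun s => u (x + s)) s.
Proof.
move=> mu1 hs.
have mf : cmeas (fun t => airy_kernel (x + s) t * u t).
  apply: cmeasM => //; apply: (cmeas_comp (@cmeas_airy_kernel R) (g := fun t => (x + s, t))).
  exact: pair1_measurable.
rewrite /airy_op cint_shift //; first by apply: measurable_funTS; exact: mf.1.
by apply: measurable_funTS; exact: mf.2.
Qed.

Lemma good_of_F0 : F0 x != 0 -> good B x.
Proof.
move=> /fredholm_solvable[K [K0 ex U]]; exists K.
have bE u M : bounded_by half aw u M -> bounded_by D ax (fun xi => u (xi - x)) M.
  move=> [mu1 hu]; split.
    have := cmeas_shift (- x) mu1; by under eq_fun do rewrite addrC.
  by move=> xi /rayP; exact: hu.
have Dhalf s : half s -> D (x + s) by rewrite rayP addrAC subrr add0r.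
split=> // [g M hg|u M hu eu s hs].
  have [u [mu1 hu] eu] := ex _ _ (bE _ _ hg).
  exists (fun s => u (x + s)).
    split; first exact: cmeas_shift.
    by move=> s hs; have := hu (x + s) (Dhalf s hs); rewrite addrAC subrr add0r.
  move=> s hs; rewrite -airy_op_shift // -/(op D _ _ _) eu; first by rewrite addrAC subrr add0r.
  exact: Dhalf.
have hb := bE _ _ hu; have := U _ _ hb _ (x + s) (Dhalf s hs).
rewrite addrAC subrr add0r; apply=> xi Dxi.
have hxi : half (xi - x) by apply/rayP.
rewrite (eu _ hxi); have := airy_op_shift (u := fun eta => u (eta - x)) hb.1 hxi.
rewrite subrKC => E.
transitivity (op half (kern x) (fun s0 => u (x + s0 - x)) (xi - x)); last exact: esym E.
by apply: eq_cint => t _; rewrite addrAC subrr add0r.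
Qed.

End FredholmLink.

(** * The L^2 resolvent and the weighted solution *)

Section ResolventLink.
Variable R : realType.
Local Notation C := R[i].
Local Notation Re := (@complex.Re R).
Local Notation Im := (@complex.Im R).
Local Notation mu := (@lebesgue_measure R).
Local Notation half := (`]0%R, +oo[%classic : set R).

Lemma ae_imp (P Q : R -> Prop) : (forall xi, P xi -> Q xi) ->
  {ae mu, forall xi, P xi} -> {ae mu, forall xi, Q xi}.
Proof.
by move=> PQ; apply: filterS; [exact: (ae_filter_ringOfSetsType mu)|exact: PQ].
Qed.

Lemma eq_cint_ae (D : set R) (f g : R -> C) : measurable D -> cmeas f -> cmeas g ->
  {ae mu, forall xi, D xi -> f xi = g xi} -> cint D f = cint D g.
Proof.
move=> mD [f1 f2] [g1 g2] h; apply: complexP; rewrite /= /Rintegral; congr fine.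
  apply: ae_eq_integral => //; try by apply: measurable_funTS; exact/measurable_EFinP.
  by apply: ae_imp h => xi e Dxi /=; rewrite e.
apply: ae_eq_integral => //; try by apply: measurable_funTS; exact/measurable_EFinP.
by apply: ae_imp h => xi e Dxi /=; rewrite e.
Qed.

Lemma measurable_nrm (f : R -> C) : cmeas f -> measurable_fun setT (fun xi => nrm (f xi)).
Proof. by move=> [f1 f2]; apply: measurable_funD; apply: measurableT_comp. Qed.

(** Elements of [L2 x] are measurable on [(x, oo)]; extension by 0 makes them measurable on the
    whole line, as [cmeas] asks. *)
Definition cut (x : R) (h : R -> C) (xi : R) : C := if x < xi then h xi else 0.

Lemma cutE x h xi : x < xi -> cut x h xi = h xi.
Proof. by rewrite /cut => ->. Qed.

Lemma cmeas_cut (x : R) (h : R -> C) : measurable_fun `]x, +oo[ (Re \o h : R -> R) -> measurable_fun `]x, +oo[ (Im \o h : R -> R) ->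
  cmeas (cut x h).
Proof.
have key (p : C -> R) : p 0 = 0 -> measurable_fun `]x, +oo[ (p \o h) -> measurable_fun setT (p \o cut x h).
  move=> p0 mp; rewrite (_ : p \o cut x h = fun xi => if x < xi then (p \o h) xi else 0); last first.
    by apply/funext => xi; rewrite /= /cut; case: ifP.
  apply: measurable_fun_if => //.
    by apply: measurable_fun_ltr.
  rewrite setTI (_ : _ @^-1` _ = `]x, +oo[%classic) //.
  by apply/seteqP; split => xi /=; rewrite in_itv /= andbT.
by move=> h1 h2; split; apply: key.
Qed.

Variables (B x : R).
Hypothesis B0 : 0 <= B.
Local Notation D := (`]x, +oo[%classic : set R).
Local Notation aw := (ewt (- B)).
Local Notation ax := (fun xi : R => ewt (- B) (xi - x)).
Local Notation bx := (fun xi : R => ewt (B + 1) (xi - x)).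

Let mD : measurable D. Proof. exact: measurable_itv. Qed.

(** Wide enough for L^2 functions and for functions bounded by [bx], and still mapped by [A_x] to
    functions bounded by [bx]: here an L^2 solution can be compared with a weighted one. *)
Definition weighted_L1 (f : R -> C) := cmeas f /\ rintegrable D (fun xi => bx xi * nrm (f xi)).

Lemma bx_le_ax xi : D xi -> bx xi <= ax xi.
Proof. by move=> /rayP /halfP s0; apply: ewt_le => //; have := B0; lra. Qed.

Lemma measurable_bx : measurable_fun setT (bx : R -> R).
Proof.
rewrite (_ : (bx : R -> R) = expR \o (fun xi : R => - ((xi - x) * (B + 1)))) //.
apply: measurableT_comp => //; apply: measurable_funN; apply: measurable_funM => //.
exact: measurable_funB.
Qed.

Lemma measurable_bx_nrm f : cmeas f -> measurable_fun setT (fun xi => bx xi * nrm (f xi)).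
Proof. by move=> mf; apply: measurable_funM; [exact: measurable_bx|exact: measurable_nrm]. Qed.

Lemma weighted_L1_bounded f M : bounded_by D bx f M -> weighted_L1 f.
Proof.
move=> [mf hf]; split=> //.
apply: (rintegrable_le mD _ (rintegrableZ M mD (rintegrable_wt_shift B x))).
  by apply: measurable_funTS; exact: measurable_bx_nrm.
move=> xi Dxi; have b0 : 0 <= bx xi := ltW (ewt_gt0 _ _).
rewrite ger0_norm ?mulr_ge0 ?nrm_ge0 //.
apply: le_trans (ler_wpM2l b0 (hf xi Dxi)) _.
have M0 : 0 <= M * bx xi by apply: le_trans (hf xi Dxi); exact: nrm_ge0.
by have := ler_wpM2r M0 (bx_le_ax Dxi); lra.
Qed.

(** Instead of Cauchy-Schwarz, the pointwise inequality [2 b |h| <= b^2 + |h|^2], where [b^2 <= a b]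
    is integrable. *)
Lemma weighted_L1_cut h : L2 x h -> weighted_L1 (cut x h).
Proof.
move=> [h1 h2 hoo]; have mh := cmeas_cut h1 h2; split=> //.
pose S xi := Re (h xi) ^+ 2 + Im (h xi) ^+ 2.
have S0 xi : 0 <= S xi by rewrite addr_ge0 ?sqr_ge0.
have iS : rintegrable D S.
  apply/integrableP; split.
    by apply/measurable_EFinP; apply: measurable_funD; exact: measurable_funX.
  by under eq_integral do rewrite gee0_abs ?lee_fin ?S0 //.
apply: (rintegrable_le mD _ (rintegrableD mD (rintegrable_wt_shift B x) (rintegrableZ 2 mD iS))).
  by apply: measurable_funTS; exact: measurable_bx_nrm.
move=> xi Dxi; rewrite cutE; last by move: Dxi; rewrite /= in_itv /= andbT.
have b0 : 0 <= bx xi := ltW (ewt_gt0 _ _).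
rewrite ger0_norm ?mulr_ge0 ?nrm_ge0 //.
have q1 := nrm_sqr_le (h xi); have q2 := ler_wpM2r b0 (bx_le_ax Dxi).
have q3 := sqr_ge0 (bx xi - nrm (h xi)); rewrite sqrrB in q3.
have n0 := mulr_ge0 b0 (nrm_ge0 (h xi)).
rewrite -/(S xi) in q1.
rewrite expr2 in q3.
lra.
Qed.

Lemma weighted_L1B f g : weighted_L1 f -> weighted_L1 g -> weighted_L1 (fun xi => f xi - g xi).
Proof.
move=> [mf hf] [mg hg]; split; first exact: cmeasB.
apply: (rintegrable_le mD _ (rintegrableD mD hf hg)).
  by apply: measurable_funTS; apply: measurable_bx_nrm; exact: cmeasB.
move=> xi Dxi; have b0 : 0 <= bx xi := ltW (ewt_gt0 _ _).
rewrite ger0_norm ?mulr_ge0 ?nrm_ge0 //.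
by rewrite -mulrDr ler_wpM2l // nrmB.
Qed.

Lemma airy_op_integrable f : weighted_L1 f -> exists2 M, 0 <= M & forall xi, D xi ->
  cintegrable D (fun eta => airy_kernel xi eta * f eta) /\ nrm (airy_op x f xi) <= M * bx xi.
Proof.
move=> [mf hf]; have [M M0 [mk hk]] := airy_kernel_ray_bound x B0.
have I0 : 0 <= \int[mu]_(eta in D) (bx eta * nrm (f eta)).
  by apply: Rintegral_ge0 => eta _; rewrite mulr_ge0 ?nrm_ge0 ?ltW ?ewt_gt0.
exists (M * \int[mu]_(eta in D) (bx eta * nrm (f eta))); first exact: mulr_ge0.
move=> xi Dxi.
have hZ := rintegrableZ (M * bx xi) mD hf.
have hb eta : D eta -> nrm (airy_kernel xi eta * f eta) <= M * bx xi * (bx eta * nrm (f eta)).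
  move=> De; apply: le_trans (nrmM _ _) _; rewrite mulrA ler_wpM2r ?nrm_ge0 //.
  by rewrite -mulrA; exact: hk.
have ic : cintegrable D (fun eta => airy_kernel xi eta * f eta).
  apply: (dom_cintegrable mD _ hZ hb).
  apply: cmeasM mf; apply: (cmeas_comp (@cmeas_airy_kernel R) (g := fun t => (xi, t))).
  exact: pair1_measurable.
split=> //; apply: le_trans (nrm_cint_le mD ic hZ hb) _.
by rewrite RintegralZl // mulrAC.
Qed.

Lemma cmeas_airy_op f : cmeas f -> cmeas (airy_op x f).
Proof. by move=> mf; apply: cmeas_op => //; exact: cmeas_airy_kernel. Qed.

Lemma airy_op_cut h xi : airy_op x (cut x h) xi = airy_op x h xi.
Proof. by apply: eq_cint => eta /=; rewrite in_itv /= andbT => De; rewrite cutE. Qed.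

Hypothesis gx : good B x.

(** As [f = A f] almost everywhere, [A f = A (A f)] holds at every point of the domain. Since [A f]
    is bounded by the weight, uniqueness in the weighted space makes it 0, and then [f] is 0 almost
    everywhere. *)
Lemma weighted_L1_fixed f : weighted_L1 f ->
  {ae mu, forall xi, D xi -> f xi = airy_op x f xi} -> {ae mu, forall xi, D xi -> f xi = 0}.
Proof.
move=> Lf hf; have [M M0 hM] := airy_op_integrable Lf.
have [mf _] := Lf; have me := cmeas_airy_op mf.
suff e0 xi : D xi -> airy_op x f xi = 0.
  by apply: ae_imp hf => xi e Dxi; rewrite e // e0.
have eA eta : airy_op x f eta = airy_op x (airy_op x f) eta.
  have mk : cmeas (fun t => airy_kernel eta t).
    by apply: (cmeas_comp (@cmeas_airy_kernel R) (g := fun t => (eta, t))); exact: pair1_measurable.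
  apply: eq_cint_ae => //; try exact: cmeasM.
  by apply: ae_imp hf => t + Dt => /(_ Dt) {1}->.
have [K [K0 _ U]] := gx.
have hb : bounded_by half aw (fun s => airy_op x f (x + s)) M.
  split=> [|s hs]; first exact: cmeas_shift.
  have Ds : D (x + s) by rewrite rayP addrAC subrr add0r.
  apply: le_trans (hM _ Ds).2 _; rewrite addrAC subrr add0r ler_wpM2l //.
  by have := bx_le_ax Ds; rewrite addrAC subrr add0r.
move=> /rayP hxi; rewrite -(subrKC x xi); apply: (U _ _ hb _ _ hxi) => s hs.
by rewrite {1}eA airy_op_shift.
Qed.

(** With [v] the weighted solution for [f], the function [v - f = A v] is bounded by [bx], lies in
    L^2 and solves [h - A h = A f]. So [inv_1A] does find a solution, and the one it picks differs
    from [v - f] by a fixed point of [A], which is 0 almost everywhere. *)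
Lemma inv_1A_airy_op f : tempered B f -> exists2 h, weighted_L1 h &
  [/\ L2 x (inv_1A x (airy_op x f)), forall s, half s -> f (x + s) + h (x + s) = sol half aw (kern x) (fun s => f (x + s)) s &
   {ae mu, forall xi, D xi -> inv_1A x (airy_op x f) xi = h xi}].
Proof.
move=> tf; have [K sK] := gx; have [mf _] := tf.
have g1 : 1 <= B + 1 by rewrite lerDr.
have [N N0 hN] := kern_bound g1 (normr_ge0 x); have {}hN := hN x (lexx _).
have [M hM [hv ev]] := sol_tempered B0 sK tf.
set v := sol _ _ _ _ in hv ev *.
pose h xi := v (xi - x) - f xi.
have mh : cmeas h.
  by apply: cmeasB => //; have := cmeas_shift (- x) hv.1; under eq_fun do rewrite addrC.
have hE s : half s -> h (x + s) = op half (kern x) v s.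
  by move=> hs; rewrite /h (addrAC x) subrr add0r -ev //; ring.
have mhalf : measurable half by exact: measurable_itv.
have bh := bounded_op mhalf (rintegrable_wt B) (Rintegral_wt B) hN hv.
have bhD : bounded_by D bx h (N * (K * M)).
  split=> // xi /rayP hxi; rewrite -(subrKC x xi) hE // addrAC subrr add0r; exact: bh.2.
have Lh := weighted_L1_bounded bhD.
have eh xi : D xi -> h xi - airy_op x h xi = airy_op x f xi.
  move=> /rayP; move: (xi - x) (subrKC x xi) => s <- hs.
  rewrite !airy_op_shift // (@eq_op _ _ _ _ (fun s => v s - f (x + s))); last first.
    by move=> t ht; rewrite /h (addrAC x) subrr add0r.
  by rewrite (opB mhalf (rintegrable_wt B) hN hv hM hs) hE //; ring.
have L2h : L2 x h.
  split; [by apply: measurable_funTS; exact: mh.1|by apply: measurable_funTS; exact: mh.2|].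
  have W : (\int[mu]_(xi in D) (((N * (K * M)) ^+ 2) * (ax xi * bx xi))%:E < +oo)%E.
    rewrite rintegralE ?ltry //; apply: rintegrableZ => //; exact: rintegrable_wt_shift.
  apply: le_lt_trans W; apply: ge0_le_integral => //.
  - by move=> xi _; rewrite lee_fin addr_ge0 // sqr_ge0.
  - by apply/measurable_EFinP; apply: measurable_funTS; apply: measurable_funD; apply: measurable_funX; [exact: mh.1|exact: mh.2].
  - by apply/measurable_EFinP; apply: measurable_funTS; apply: measurable_funM => //; exact: measurable_wt_shift.
  move=> xi Dxi; rewrite lee_fin.
  have b0 : 0 <= bx xi := ltW (ewt_gt0 _ _).
  apply: (@le_trans _ _ (nrm (h xi) ^+ 2)).
    rewrite /nrm sqrrD !real_normK ?num_real // addrAC lerDl mulrn_wge0 // mulr_ge0 //.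
  apply: (@le_trans _ _ ((N * (K * M) * bx xi) ^+ 2)).
    by rewrite ler_pXn2r ?nnegrE ?nrm_ge0 ?(le_trans (nrm_ge0 _) (bhD.2 _ Dxi)) ?bhD.2.
  rewrite exprMn; apply: ler_wpM2l; first exact: sqr_ge0.
  by rewrite expr2; apply: ler_wpM2r => //; exact: bx_le_ax.
have eh' : {ae mu, forall xi, x < xi -> h xi - airy_op x h xi = airy_op x f xi}.
  by apply: aeW => xi xxi; apply: eh; rewrite /= in_itv /= andbT.
rewrite /inv_1A; case: xgetP => [h' _ [L2h' e']|/(_ h) []]; last by split.
exists h => //; split=> //.
  by move=> s hs; rewrite /h (addrAC x) subrr add0r addrC subrK.
have Lh' := weighted_L1_cut L2h'.
have : {ae mu, forall xi, D xi -> cut x h' xi - h xi = 0}.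
  apply: weighted_L1_fixed (weighted_L1B Lh' Lh) _.
  apply: ae_imp e' => xi e' Dxi.
  have xxi : x < xi by move: Dxi; rewrite /= in_itv /= andbT.
  have [M1 _ h1] := airy_op_integrable Lh'; have [M2 _ h2] := airy_op_integrable Lh.
  have -> : airy_op x (fun xi => cut x h' xi - h xi) xi = airy_op x (cut x h') xi - airy_op x h xi.
    rewrite /airy_op -cintB //; [|exact: (h1 xi Dxi).1|exact: (h2 xi Dxi).1].
    by apply: eq_cint => eta _; rewrite mulrBr.
  rewrite airy_op_cut cutE //; move: (e' xxi); rewrite -(eh xi Dxi).
  by move=> e1; rewrite -[h' xi](subrK (airy_op x h' xi)) e1; ring.
apply: ae_imp => xi + Dxi; rewrite cutE; last by move: Dxi; rewrite /= in_itv /= andbT.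
by move=> /(_ Dxi)/eqP; rewrite subr_eq0 => /eqP.
Qed.

Lemma pairing_resolvent f g : tempered B f -> cmeas g ->
  pairing x (resolvent x f) g =
  dual half (sol half aw (kern x) (fun s => f (x + s))) (fun s => g (x + s)).
Proof.
move=> tf mg; have [h [mh _] [[i1 i2 _] he ae]] := inv_1A_airy_op tf; have [mf _] := tf.
have mi := cmeas_cut i1 i2; set i := inv_1A x (airy_op x f) in mi ae.
have Dx xi : D xi -> x < xi by rewrite /= in_itv /= andbT.
have -> : pairing x (resolvent x f) g = cint D (fun xi => (f xi + cut x i xi) * g xi).
  by apply: eq_cint => xi Dxi; rewrite (cutE _ (Dx _ Dxi)).
have mfh : cmeas (fun xi => (f xi + h xi) * g xi) by apply: cmeasM => //; exact: cmeasD.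
rewrite (@eq_cint_ae _ _ (fun xi => (f xi + h xi) * g xi)) //; first last.
- by apply: ae_imp ae => xi e Dxi; rewrite (cutE _ (Dx _ Dxi)) e.
- by apply: cmeasM => //; exact: cmeasD.
rewrite cint_shift; [|by apply: measurable_funTS; exact: mfh.1|by apply: measurable_funTS; exact: mfh.2].
by apply: eq_cint => s hs; rewrite he.
Qed.

End ResolventLink.

(** * Determinants *)

Section Interpolation.
Variable R : realType.
Local Notation C := R[i].

Lemma airy_int_sum (a b c : R) (I : Type) (l : seq I) (k : I -> C) (F : I -> C -> C) (xi : R) :
  a < c -> c < b -> (forall i, cmfun (F i)) -> (forall i, polybounded a b (F i)) ->
  airy_int c (fun z => \sum_(i <- l) k i * F i z) xi = \sum_(i <- l) k i * airy_int c (F i) xi.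
Proof.
move=> ac cb mF hF.
have m1 : cmfun (fun=> 1 : C) by exact: cmfun_cst.
have h1 : polybounded a b (fun=> 1 : C) by exact: polybounded_cst.
have mZ i : cmfun (fun z => k i * F i z) by apply: cmfunM => //; exact: cmfun_cst.
have hZ i : polybounded a b (fun z => k i * F i z) by apply: polyboundedM => //; exact: polybounded_cst.
suff [_ [_ ->]] : cmfun (fun z => \sum_(i <- l) k i * F i z) /\
    polybounded a b (fun z => \sum_(i <- l) k i * F i z) /\
    airy_int c (fun z => \sum_(i <- l) k i * F i z) xi = \sum_(i <- l) k i * airy_int c (F i) xi by [].
elim: l => [|i l [IH1 [IH2 IH3]]].
  under eq_fun do rewrite big_nil; rewrite big_nil; split; first exact: cmfun_cst.
  split; first exact: polybounded_cst.
  rewrite -[RHS](mul0r (airy_int c (fun=> 1) xi)) -(airy_intZ 0 xi m1 h1 ac cb).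
  by apply: eq_airy_int => *; rewrite mul0r.
under eq_fun do rewrite big_cons; rewrite big_cons; split; first exact: cmfunD.
split; first exact: polyboundedD.
by rewrite (airy_intD xi (mZ i) (hZ i) IH1 IH2 ac cb) IH3 (airy_intZ _ _ (mF i) (hF i) ac cb).
Qed.

(** With ['X] for ['i * z], that is for [d/dxi], this is the amplitude of [t^(n)]; evaluated at [v],
    it is also the Newton coefficient of an [s^(r)] in [C_v]. *)
Definition tpoly (ws : seq C) : {poly C} := \prod_(w <- ws) (w%:P - 'X).

Lemma horner_tpoly ws (z : C) : (tpoly ws).[z] = \prod_(w <- ws) (w - z).
Proof. by rewrite horner_prod; apply: eq_bigr => w _; rewrite !hornerE. Qed.

Lemma tpoly_cons w ws i : (tpoly (w :: ws))`_i =
  w * (tpoly ws)`_i - (if i is j.+1 then (tpoly ws)`_j else 0).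
Proof. by rewrite /tpoly big_cons mulrBl coefB coefCM coefXM; case: i. Qed.

Lemma coef_tpoly_gt ws i : (size ws < i)%N -> (tpoly ws)`_i = 0.
Proof.
elim: ws i => [|w ws IH] [|i] //= h.
  by rewrite /tpoly big_nil coef1.
rewrite tpoly_cons !IH ?mulr0 ?subr0 //; exact: ltnW.
Qed.

Lemma coef_tpoly_size ws : (tpoly ws)`_(size ws) = (-1) ^+ size ws.
Proof.
elim: ws => [|w ws IH]; first by rewrite /tpoly big_nil coef1.
by rewrite tpoly_cons /= coef_tpoly_gt ?ltnS // mulr0 sub0r IH exprS mulN1r.
Qed.

Lemma size_tpoly ws : (size (tpoly ws) <= (size ws).+1)%N.
Proof. by apply/leq_sizeP => i; exact: coef_tpoly_gt. Qed.

(** Every [n] above the degree is allowed, further coefficients being 0: with [n = k] all columns of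
    the determinant expand over the same index range. *)
Lemma tfun_tpoly ws n xi : (size ws < n)%N ->
  tfun ws xi = \sum_(j < n) (tpoly ws)`_j * AiD j xi.
Proof.
move=> hn; have ad (j : 'I_n) := @admissible_izX R (0 - 1) (0 + 1) j.
have [l1 l2] := strip (0 : R).
rewrite tfunE -(airy_int_sum _ _ _ l1 l2).
- apply: eq_airy_int => s u _ _; rewrite -horner_tpoly.
  by rewrite (horner_coef_wide _ (leq_trans (size_tpoly ws) hn)).
- by move=> j; exact: admissible_meas (ad j).
- by move=> j; exact: admissible_bounded (ad j).
Qed.

(** Newton interpolation of [v |-> (v + t)^-1] at the nodes, with explicit remainder: up to sign the
    divided differences are the products of the [(w + t)^-1]. *)
Lemma newton_inverse ws (v t : C) : (forall w, w \in ws -> w + t != 0) -> v + t != 0 ->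
  (v + t)^-1 = \sum_(r < size ws) (\prod_(w <- take r ws) (w - v)) * (\prod_(w <- take r.+1 ws) (w + t)^-1) +
    (\prod_(w <- ws) ((w - v) / (w + t))) / (v + t).
Proof.
move=> + v0; elim: ws => [|w ws IH] h; first by rewrite big_ord0 big_nil mul1r add0r.
have w0 : w + t != 0 by apply: h; rewrite mem_head.
rewrite big_ord_recl /= !big_cons take0 !big_nil mul1r mulr1.
have -> : \sum_(i < size ws) (\prod_(j <- w :: take i ws) (j - v)) *
    (\prod_(j <- take (bump 0 i).+1 (w :: ws)) (j + t)^-1) =
  (w - v) / (w + t) * \sum_(i < size ws) (\prod_(j <- take i ws) (j - v)) * (\prod_(j <- take i.+1 ws) (j + t)^-1).
  rewrite mulr_sumr; apply: eq_bigr => i _; rewrite /bump add1n /= !big_cons; ring.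
rewrite -(mulrA ((w - v) / (w + t)) (\prod_(j <- ws) _)) -addrA -mulrDr -IH.
  by field; rewrite v0 w0.
by move=> u hu; apply: h; rewrite inE hu orbT.
Qed.

(* The remainder of newton_inverse vanishes when v is one of the nodes. *)
Lemma Cfun_newton (ws : seq C) (c : R) (v : C) (xi : R) : (forall w, w \in ws -> c + 1 <= pole_height w) -> v \in ws ->
  Cfun v xi = \sum_(r < size ws) (\prod_(w <- take r ws) (w - v)) * Defs.sfun (take r.+1 ws) xi.
Proof.
move=> hc vws.
have hc' r w : w \in take r ws -> c + 1 <= pole_height w by move=> /mem_take; exact: hc.
have hv w : w \in [:: v] -> c + 1 <= pole_height w by rewrite inE => /eqP ->; exact: hc.
rewrite CfunE (sfunE _ hv).
have -> : \sum_(r < size ws) (\prod_(w <- take r ws) (w - v)) * Defs.sfun (take r.+1 ws) xi =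
    \sum_(r < size ws) (\prod_(w <- take r ws) (w - v)) *
      airy_int c (fun z => \prod_(w <- take r.+1 ws) inv_lin w z) xi.
  by apply: eq_bigr => r _; rewrite (sfunE _ (hc' r.+1)).
have ad (r : 'I_(size ws)) : admissible (c - 1) (c + 2^-1) (fun z => \prod_(w <- take r.+1 ws) inv_lin w z).
  by apply: admissible_inv_prod => w ww; rewrite -addrA addr_halves; exact: hc' ww.
have l2 : c < c + 2^-1 by rewrite ltrDl.
rewrite -(airy_int_sum _ _ _ (strip c).1 l2); first last.
- by move=> r; exact: admissible_bounded (ad r).
- by move=> r; exact: admissible_meas (ad r).
apply: eq_airy_int => s u s2 u0.
have nz w : w \in ws -> w + 'i * ray s c u != 0.
  move=> ww; have := pole_gap (hc w ww) ler01 s2 u0.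
  by apply: contraTneq => ->; rewrite nrm0 -ltNge.
rewrite big_seq1 [LHS](newton_inverse nz (nz _ vws)).
by rewrite (big_rem v) //= subrr mul0r !mul0r addr0.
Qed.

Lemma pair_sum (B y : R) (I : Type) (l : seq I) (k : I -> C) (f : I -> R -> C) n :
  0 <= B -> good B y -> (forall i, tempered B (f i)) ->
  pair B (fun xi => \sum_(i <- l) k i * f i xi) n y = \sum_(i <- l) k i * pair B (f i) n y.
Proof.
move=> B0 gy tf.
suff [_ ->] : tempered B (fun xi => \sum_(i <- l) k i * f i xi) /\
  pair B (fun xi => \sum_(i <- l) k i * f i xi) n y = \sum_(i <- l) k i * pair B (f i) n y by [].
elim: l => [|i l [IH1 IH2]].
  under eq_fun do rewrite big_nil; rewrite big_nil; split; first exact: tempered0.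
  transitivity (0 * pair B (fun=> 0) n y); last exact: mul0r.
  rewrite -(pairZ B0 0 n gy (tempered0 B)).
  apply: (congr1 (fun f => pair B f n y)); apply/funext => xi; exact: esym (mulr0 _).
under eq_fun do rewrite big_cons; rewrite big_cons; split.
  by apply: temperedD => //; exact: temperedZ.
by rewrite (pairD B0 n gy (temperedZ _ (tf i)) IH1) IH2 (pairZ B0 _ _ gy (tf i)).
Qed.

Lemma pairing_tfun (B x : R) f ws n : 0 <= B -> good B x -> tempered B f -> (size ws < n)%N ->
  pairing x (resolvent x f) (tfun ws) = \sum_(j < n) (tpoly ws)`_j * pair B f j x.
Proof.
move=> B0 gx tf hn; have [K sK] := gx.
have -> : tfun ws = (fun xi => \sum_(j < n) (tpoly ws)`_j * AiD j xi).
  by apply/funext => xi; exact: tfun_tpoly.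
rewrite (pairing_resolvent B0 gx tf); last first.
  by apply: cmeas_sum => j; apply: cmeasM; [exact: cmeas_cst|exact: cmeas_AiD].
have [M _ [hv _]] := sol_tempered B0 sK tf.
set v := sol _ _ _ _ in hv *.
have mhalf : measurable (`]0%R, +oo[%classic : set R) by exact: measurable_itv.
have iv (j : nat) : cintegrable `]0, +oo[ (fun s => v s * AiD j (x + s)).
  have [A _ hA] := AiD_bounded B j (normr_ge0 x).
  exact: (dual_integrable mhalf (rintegrable_wt B) hv (hA x (lexx _))).
transitivity (cint `]0, +oo[ (fun s => \sum_(j < n) (tpoly ws)`_j * (v s * AiD j (x + s)))).
  by apply: eq_cint => s _; rewrite mulr_sumr; apply: eq_bigr => j _; rewrite mulrCA.
rewrite cint_sum //; last by move=> j; exact: cintegrableZ.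
by apply: eq_bigr => j _; rewrite cintZ.
Qed.

Lemma f_airy_fpair (B x : R) w : 0 <= B -> 1 - B <= pole_height w -> good B x ->
  f_airy x w = fpair B w 0 x.
Proof.
move=> B0 hw gx; rewrite /f_airy /fpair expr0 /pair; apply: (congr1 (fun z => 1 - z)).
rewrite -(pairing_resolvent B0 gx (tempered_Cfun hw) (@cmeas_AiD R 0)).
by apply: eq_cint => xi _; rewrite AiE.
Qed.

End Interpolation.

(** * The determinant identity *)

Section Determinants.
Variable R : realType.
Local Notation C := R[i].

(** Right multiplication by a unitriangular matrix; this works because [c] does not depend on the
    row [m], that is on the node. *)
Lemma det_triangular_comb k (f : 'I_k -> nat -> C) (c : nat -> nat -> C) :
  \det (\matrix_(m < k, n < k) (f m n + \sum_(j < n) c n j * f m j)) = \det (\matrix_(m < k, n < k) f m n).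
Proof.
pose F : 'M[C]_k := \matrix_(m < k, n < k) f m n.
pose U : 'M[C]_k := \matrix_(j, n) ((j == n)%:R + if (j < n)%N then c n j else 0).
have detU : \det U = 1.
  rewrite -det_tr det_trig; first by rewrite big1 // => i _; rewrite !mxE eqxx ltnn addr0.
  apply/is_trig_mxP => i j ij; rewrite !mxE ltnNge (ltnW ij) /= addr0.
  by rewrite (_ : (j == i) = false) // -val_eqE gtn_eqF.
rewrite (_ : (\matrix_(m, n) (f m n + _)) = F *m U); first by rewrite det_mulmx detU mulr1.
apply/matrixP => m n; rewrite !mxE.
have E j : F m j * U j n = f m j * (j == n)%:R + f m j * (if (j < n)%N then c n j else 0).
  by rewrite mxE [U j n]mxE mulrDr.
rewrite [RHS](eq_bigr _ (fun j _ => E j)) big_split /=; congr (_ + _).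
  by rewrite (bigD1 n) //= eqxx mulr1 big1 ?addr0 // => j /negPf ->; rewrite mulr0.
rewrite (big_ord_widen k (fun j => c n j * f m j)); last exact: ltnW.
by rewrite big_mkcond /=; apply: eq_bigr => j _; case: ifP => _; rewrite ?mulr0 // mulrC.
Qed.

Lemma mul_cross (d f e v : C) : e != 0 -> e * v * d = f * e -> d * v = f.
Proof. by move=> e0 h; apply: (mulfI e0); rewrite (mulrC e f) -h; ring. Qed.

Variables (B x : R) (k : nat) (w : 'rV[C]_k).
Hypothesis B0 : 0 <= B.
Hypothesis hB : forall m, 1 - B <= pole_height (w 0 m).
Hypothesis gx : good B x.

Local Notation ws := [seq w 0 j | j <- enum 'I_k].

Definition fmx : 'M[C]_k := \matrix_(m, j) fpair B (w 0 m) j x.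

Definition itermx : 'M[C]_k :=
  \matrix_(m, n) iter n (w_plus_D (w 0 m)) (fun y => f_airy y (w 0 m)) x.

Lemma det_itermx : \det itermx = \det fmx.
Proof.
rewrite -(det_triangular_comb (fun m => fun n => fpair B (w 0 m) n x) (fun n j => qeval B (itercoef R n j) x)).
congr determinant; apply/matrixP => m n; rewrite !mxE.
by apply: (iter_w_plus_D B0 n (hB m) _ gx) => z gz; exact: f_airy_fpair.
Qed.

Lemma size_nodes : size ws = k.
Proof. by rewrite size_map size_enum_ord. Qed.

Lemma nodes_mem m : w 0 m \in ws.
Proof. by apply/mapP; exists m; rewrite // mem_enum. Qed.

Lemma node_height v : v \in ws -> - B + 1 <= pole_height v.
Proof. by move=> /mapP[j _ ->]; rewrite addrC. Qed.

Lemma big_take_nodes (F : C -> C) (n : 'I_k) :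
  \prod_(v <- take n ws) F v = \prod_(j < k | (j < n)%N) F (w 0 j).
Proof.
rewrite (big_nth 0) size_takel ?size_nodes 1?ltnW // big_mkord.
rewrite (big_ord_widen k (fun i => F (take n ws)`_i)); last exact: ltnW.
apply: eq_bigr => j jn; rewrite nth_take // (nth_map j) ?size_enum_ord //.
by rewrite nth_ord_enum.
Qed.

Lemma prod_sign (G : 'I_k -> C) (m : 'I_k) :
  \prod_(j < k | (j < m)%N) - G j = (-1) ^+ m * \prod_(j < k | (j < m)%N) G j.
Proof.
rewrite prodrN; congr ((-1) ^+ _ * _).
rewrite -sum1_card -(big_ord_widen k (fun=> 1%N)); last exact: ltnW.
by rewrite sum1_card card_ord.
Qed.

Definition smx : 'M[C]_k :=
  \matrix_(m, n) ((m == n)%:R - pairing x (resolvent x (Defs.sfun (take m.+1 ws))) (tfun (take n ws))).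

Definition lmx : 'M[C]_k := \matrix_(m, n) (tpoly (take n ws)).[w 0 m].

(** The rows of [smx] are recombined by Newton's formula and its columns expanded over the [Ai^(j)].
    The identity part of [smx] then contributes [tpoly] evaluated at [w_m], a combination of powers
    of [w_m]: this is the origin of the term [w ^+ n] in [fpair]. *)
Lemma lmx_smx : lmx *m smx = fmx *m (\matrix_(n, j) (tpoly (take n ws))`_j)^T.
Proof.
have st n : tempered B (Defs.sfun (take n ws)).
  split=> [|X X0]; first exact: cmeas_sfun.
  by apply: sfun_bound => // v /mem_take; exact: node_height.
have sz (n : 'I_k) : size (take n ws) = n by rewrite size_takel // size_nodes ltnW.
have pt (m n : 'I_k) : pairing x (resolvent x (Defs.sfun (take m.+1 ws))) (tfun (take n ws)) =
    \sum_(j < k) (tpoly (take n ws))`_j * pair B (Defs.sfun (take m.+1 ws)) j x.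
  by apply: pairing_tfun; rewrite ?sz.
apply/matrixP => m n; rewrite !mxE.
have pC (j : nat) : pair B (Cfun (w 0 m)) j x =
    \sum_(r < k) lmx m r * pair B (Defs.sfun (take r.+1 ws)) j x.
  rewrite -(pair_sum _ _ _ B0 gx) //; apply: (congr1 (fun f => pair B f j x)); apply/funext => xi.
  rewrite (Cfun_newton _ node_height (nodes_mem m)) size_nodes.
  by apply: eq_bigr => r _; rewrite mxE horner_tpoly.
transitivity ((tpoly (take n ws)).[w 0 m] - \sum_(j < k) (tpoly (take n ws))`_j * pair B (Cfun (w 0 m)) j x).
  under eq_bigr => r _ do rewrite [smx r n]mxE mulrBr pt.
  rewrite sumrB (bigD1 n) //= eqxx mulr1 big1 ?addr0; last first.
    by move=> j /negPf ->; rewrite mulr0.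
  rewrite [in LHS]mxE; congr (_ - _).
  under eq_bigr do rewrite mulr_sumr.
  rewrite exchange_big /=; apply: eq_bigr => j _; rewrite pC mulr_sumr.
  by apply: eq_bigr => r _; rewrite mulrCA.
have hs : (size (tpoly (take n ws)) <= k)%N.
  by apply: leq_trans (size_tpoly _) _; rewrite sz.
rewrite (horner_coef_wide _ hs) -sumrB; apply: eq_bigr => j _.
by rewrite !mxE /fpair mulrBl mulrC (mulrC (pair _ _ _ _)).
Qed.

(** Both outer factors in [lmx_smx] are triangular: [lmx] because [tpoly] vanishes at its own nodes,
    with the Vandermonde product on its diagonal up to sign, and the coefficient matrix with
    diagonal entries [(-1) ^+ n]. The signs cancel. *)
Lemma det_smx : distinct w ->
  \det smx = \det itermx / \prod_(m < k) \prod_(n < k | (m < n)%N) (w 0 n - w 0 m).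
Proof.
move=> dw.
have sz (n : 'I_k) : size (take n ws) = n by rewrite size_takel // size_nodes ltnW.
have vne : \prod_(m < k) \prod_(n < k | (m < n)%N) (w 0 n - w 0 m) != 0.
  apply/prodf_neq0 => m _; apply/prodf_neq0 => n mn; rewrite subr_eq0.
  by apply/eqP => /dw nm; rewrite nm ltnn in mn.
apply: (canRL (mulfK vne)).
have /(congr1 determinant) := lmx_smx; rewrite !det_mulmx det_tr det_itermx.
have -> : \det (\matrix_(n < k, j < k) (tpoly (take n ws))`_j) = \prod_(n < k) (-1) ^+ n.
  rewrite det_trig.
    by apply: eq_bigr => n _; rewrite mxE -{2}(sz n) coef_tpoly_size sz.
  by apply/is_trig_mxP => i j ij; rewrite mxE coef_tpoly_gt // sz.
have -> : \det lmx = (\prod_(n < k) (-1) ^+ n) *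
    \prod_(m < k) \prod_(n < k | (m < n)%N) (w 0 n - w 0 m).
  rewrite (exchange_big_dep xpredT) //= det_trig; last first.
    apply/is_trig_mxP => i j ij; rewrite mxE horner_tpoly big_take_nodes (bigD1 i) //=.
    by rewrite subrr mul0r.
  rewrite -big_split /=; apply: eq_bigr => m _; rewrite mxE horner_tpoly big_take_nodes.
  by rewrite -prod_sign; apply: eq_bigr => j _; rewrite opprB.
have sg : (\prod_(n < k) (-1) ^+ n : C) != 0.
  by apply/prodf_neq0 => i _; rewrite expf_neq0 // oppr_eq0 oner_eq0.
exact: mul_cross.
Qed.

End Determinants.

(** * Continuity in the nodes *)

Section NrmConvergence.
Variable R : realType.
Local Notation C := R[i].
Variables (T : Type) (F : set_system T).
Hypothesis FF : Filter F.
Implicit Types (f g : T -> C) (a b : C).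

Definition ccvg f a := forall e : R, 0 < e -> \forall v \near F, nrm (f v - a) <= e.

Lemma ccvg_cst a : ccvg (fun=> a) a.
Proof. by move=> e e0; apply: filterE => v; rewrite subrr nrm0 ltW. Qed.

Lemma ccvgD f g a b : ccvg f a -> ccvg g b -> ccvg (fun v => f v + g v) (a + b).
Proof.
move=> hf hg e e0; have e2 : 0 < e / 2 by rewrite divr_gt0.
apply: filterS2 (hf _ e2) (hg _ e2) => v h1 h2.
have -> : f v + g v - (a + b) = (f v - a) + (g v - b) by ring.
by apply: le_trans (nrmD _ _) _; rewrite (splitr e) lerD.
Qed.

Lemma ccvgM f g a b : ccvg f a -> ccvg g b -> ccvg (fun v => f v * g v) (a * b).
Proof.
move=> hf hg e e0; have N0 : 0 < 1 + nrm a + nrm b.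
  by rewrite -addrA ltr_pwDl // addr_ge0 // nrm_ge0.
pose d := Num.min 1 (e / (1 + nrm a + nrm b)).
have d0 : 0 < d by rewrite lt_min ltr01 divr_gt0.
have d1 : d <= 1 by rewrite ge_min lexx.
have de : d * (1 + nrm a + nrm b) <= e by rewrite -ler_pdivlMr // ge_min lexx orbT.
apply: filterS2 (hf _ d0) (hg _ d0) => v h1 h2.
have -> : f v * g v - a * b = (f v - a) * (g v - b) + (a * (g v - b) + (f v - a) * b) by ring.
have q1 : nrm ((f v - a) * (g v - b)) <= d * 1.
  by apply: le_trans (nrmM _ _) _; apply: ler_pM; rewrite ?nrm_ge0 // (le_trans h2).
have q2 : nrm (a * (g v - b)) <= d * nrm a.
  by apply: le_trans (nrmM _ _) _; rewrite mulrC ler_wpM2r ?nrm_ge0.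
have q3 : nrm ((f v - a) * b) <= d * nrm b.
  by apply: le_trans (nrmM _ _) _; rewrite ler_wpM2r ?nrm_ge0.
apply: le_trans (nrmD _ _) (le_trans (lerD q1 (le_trans (nrmD _ _) (lerD q2 q3))) _).
by apply: le_trans de; rewrite !mulrDr addrA.
Qed.

Lemma ccvgN f a : ccvg f a -> ccvg (fun v => - f v) (- a).
Proof. by move=> h e /h; apply: filterS => v; rewrite -opprD nrmN. Qed.

Lemma ccvgB f g a b : ccvg f a -> ccvg g b -> ccvg (fun v => f v - g v) (a - b).
Proof. by move=> hf hg; apply: ccvgD => //; exact: ccvgN. Qed.

Lemma ccvg_sum (I : Type) (l : seq I) (f : I -> T -> C) (a : I -> C) :
  (forall i, ccvg (f i) (a i)) -> ccvg (fun v => \sum_(i <- l) f i v) (\sum_(i <- l) a i).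
Proof.
move=> h; elim: l => [|i l IH].
  by under eq_fun do rewrite big_nil; rewrite big_nil; exact: ccvg_cst.
by under eq_fun do rewrite big_cons; rewrite big_cons; exact: ccvgD.
Qed.

Lemma ccvg_prod (I : Type) (l : seq I) (f : I -> T -> C) (a : I -> C) :
  (forall i, ccvg (f i) (a i)) -> ccvg (fun v => \prod_(i <- l) f i v) (\prod_(i <- l) a i).
Proof.
move=> h; elim: l => [|i l IH].
  by under eq_fun do rewrite big_nil; rewrite big_nil; exact: ccvg_cst.
by under eq_fun do rewrite big_cons; rewrite big_cons; exact: ccvgM.
Qed.

Lemma ccvg_det k (M : T -> 'M[C]_k) (A : 'M[C]_k) :
  (forall i j, ccvg (fun v => M v i j) (A i j)) -> ccvg (fun v => \det (M v)) (\det A).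
Proof.
move=> h; apply: ccvg_sum => s; apply: ccvgM; first exact: ccvg_cst.
by apply: ccvg_prod => i; exact: h.
Qed.

Lemma ccvg_tpoly (I : Type) (l : seq I) (g : I -> T -> C) (w : I -> C) (i : nat) :
  (forall j, ccvg (g j) (w j)) ->
  ccvg (fun v => (tpoly [seq g j v | j <- l])`_i) (tpoly [seq w j | j <- l])`_i.
Proof.
move=> h; elim: l i => [|j l IH] i /=; first exact: ccvg_cst.
under eq_fun do rewrite tpoly_cons; rewrite tpoly_cons.
apply: ccvgB; first exact: ccvgM.
by case: i => [|i]; [exact: ccvg_cst|exact: IH].
Qed.

End NrmConvergence.

(** * Dependence of [s^(m)] on the nodes *)

Section NodeContinuity.
Variable R : realType.
Local Notation C := R[i].
Local Notation Re := (@complex.Re R).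
Local Notation Im := (@complex.Im R).
Variables (k : nat) (w : 'rV[C]_k).

Lemma nrm_le_norm (z : C) (e : R) : `|z| <= (e / 2)%:C -> nrm z <= e.
Proof.
move=> h; have hRe : `|Re z| <= e / 2 by rewrite -lecR (le_trans (normc_ge_Re z)).
have hIm : `|Im z| <= e / 2.
  rewrite -lecR; apply: le_trans h; rewrite normc_def lecR -sqrtr_sqr ler_wsqrtr //.
  by rewrite lerDr sqr_ge0.
by rewrite /nrm (splitr e) lerD.
Qed.

Lemma ccvg_coord j : ccvg (nbhs w) (fun v => v 0 j) (w 0 j).
Proof.
move=> e e0; have h : (v 0 j) @[v --> nbhs w] --> w 0 j by exact: coord_continuous.
have e2 : 0 < (e / 2)%:C :> C by rewrite ltcR divr_gt0.
have hn : nbhs w [set v : 'rV[C]_k | `|w 0 j - v 0 j| <= (e / 2)%:C].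
  by move/cvgrPdist_le: h => /(_ _ e2).
by apply: filterS hn => v /=; rewrite distrC; exact: nrm_le_norm.
Qed.

(** The height is 1-Lipschitz for [nrm] because the slope [1 / sqrt 3] of the contour is at most
    1. *)
Lemma pole_height_close (a b : C) : pole_height b - nrm (a - b) <= pole_height a.
Proof.
rewrite /pole_height /nrm !ReImE /=.
have s0 := sqrt3_gt0 R; have s1 : 1 <= Num.sqrt 3 :> R.
  by rewrite -[leLHS]sqrtr1; apply: ler_wsqrtr; rewrite -[leLHS]/(1%:R) ler_nat.
have q : `|Im a| / Num.sqrt 3 <= `|Im b| / Num.sqrt 3 + `|Im a - Im b|.
  rewrite -[X in _ <= _ + X](mulfK (lt0r_neq0 s0)) -mulrDl; apply: ler_wpM2r; first by rewrite invr_ge0 ltW.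
  have := ler_normD (Im a - Im b) (Im b); rewrite subrK => /le_trans; apply.
  by rewrite addrC lerD2l -[leLHS]mulr1 ler_wpM2l.
have := ler_norm (Re b - Re a); rewrite distrC; lra.
Qed.

Variable c : R.
Hypothesis hc : forall j, c + 2 <= pole_height (w 0 j).

Lemma pole_height_near : nbhs w [set v : 'rV[C]_k | forall j, c + 1 <= pole_height (v 0 j)].
Proof.
have h j : nbhs w [set v : 'rV[C]_k | c + 1 <= pole_height (v 0 j)].
  apply: filterS (ccvg_coord j ltr01) => v /= h.
  by have := pole_height_close (v 0 j) (w 0 j); have := hc j; lra.
by apply: filterS (filter_forall _ h) => v.
Qed.

Lemma prod_inv_close (l : seq 'I_k) (e : R) : 0 < e ->
  nbhs w [set v : 'rV[C]_k | forall s u, s ^+ 2 = 1 -> 0 <= u ->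
    nrm (\prod_(j <- l) inv_lin (v 0 j) (ray s c u) - \prod_(j <- l) inv_lin (w 0 j) (ray s c u)) <= e].
Proof.
elim: l e => [|j l IH] e e0.
  by apply: filterE => v s u _ _; rewrite !big_nil subrr nrm0 ltW.
pose Q : R := 2 ^+ size l.
have Q0 : 0 <= Q by rewrite exprn_ge0.
have Q1 : 0 < 8 * (1 + Q) by rewrite mulr_gt0 // ltr_pwDl.
(* With poles at distance 1 each inverse is at most 2, so [Q] bounds the product over [l], and
   moving a node by [delta] changes its factor by at most [4 * delta]. This [delta] makes the first
   error [e / 2]; the error [e / 4] of the tail, doubled, is the other half. *)
have eQ : 0 < e / (8 * (1 + Q)) by rewrite divr_gt0.
have e4 : 0 < Num.min 1 (e / 4) by rewrite lt_min ltr01 divr_gt0.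
have c1 i : c + 1 <= pole_height (w 0 i) by have := hc i; lra.
apply: filterS3 (IH _ e4) (ccvg_coord j eQ) pole_height_near => v h1 h2 h3 s u s2 u0.
rewrite !big_cons; have {h1} := h1 s u s2 u0; set z := ray s c u.
set A := \prod_(i <- l) _; set A' := \prod_(i <- l) _ => h1.
have h11 : nrm (A - A') <= 1 by apply: le_trans h1 _; rewrite ge_min lexx.
have h14 : nrm (A - A') <= e / 4 by apply: le_trans h1 _; rewrite ge_min lexx orbT.
have bi i : nrm (inv_lin (w 0 i) z) <= 2.
  by have := nrm_inv_lin (c1 i) ltr01 s2 u0; rewrite divr1.
have bv : nrm (inv_lin (v 0 j) z) <= 2.
  by have := nrm_inv_lin (h3 j) ltr01 s2 u0; rewrite divr1.
have bA' : nrm A' <= Q.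
  rewrite /A' /Q; elim: (l) => [|i l' IHl]; first by rewrite big_nil nrm1.
  by rewrite big_cons exprS; apply: le_trans (nrmM _ _) _; apply: ler_pM; rewrite ?nrm_ge0.
have nz (a : C) : c + 1 <= pole_height a -> a + 'i * z != 0.
  by move=> ca; have := pole_gap ca ler01 s2 u0; apply: contraTneq => ->; rewrite nrm0 -ltNge.
have dif : nrm (inv_lin (v 0 j) z - inv_lin (w 0 j) z) <= 4 * (e / (8 * (1 + Q))).
  have -> : inv_lin (v 0 j) z - inv_lin (w 0 j) z =
      - (inv_lin (v 0 j) z * inv_lin (w 0 j) z * (v 0 j - w 0 j)).
    by rewrite /inv_lin; field; rewrite !nz.
  rewrite nrmN; apply: le_trans (nrmM _ _) _; apply: ler_pM; rewrite ?nrm_ge0 //.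
  apply: le_trans (nrmM _ _) _; rewrite (_ : 4 = 2 * 2 :> R); last by ring.
  by apply: ler_pM; rewrite ?nrm_ge0.
have -> : inv_lin (v 0 j) z * A - inv_lin (w 0 j) z * A' =
  (inv_lin (v 0 j) z - inv_lin (w 0 j) z) * (A - A' + A') + inv_lin (w 0 j) z * (A - A') by ring.
apply: le_trans (nrmD _ _) _.
have q1 : nrm ((inv_lin (v 0 j) z - inv_lin (w 0 j) z) * (A - A' + A')) <= 4 * (e / (8 * (1 + Q))) * (1 + Q).
  apply: le_trans (nrmM _ _) _; apply: ler_pM; rewrite ?nrm_ge0 //.
  by apply: le_trans (nrmD _ _) _; apply: lerD.
have q2 : nrm (inv_lin (w 0 j) z * (A - A')) <= 2 * (e / 4).
  by apply: le_trans (nrmM _ _) _; apply: ler_pM; rewrite ?nrm_ge0.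
apply: le_trans (lerD q1 q2) _.
have -> : 4 * (e / (8 * (1 + Q))) * (1 + Q) = e / 2.
  by field; have := Q0; lra.
lra.
Qed.

(** The difference of the amplitudes is at most the constant [e], so the decay of the exponential
    with amplitude 1 suffices, and [M] is independent of [r] and [q]. *)
Lemma airy_int_close (X : R) : 0 <= X -> exists2 M, 0 <= M & forall a b r q e xi,
  a < c -> c < b -> cmfun r -> cmfun q -> polybounded a b r -> polybounded a b q ->
  - X <= xi ->
  (forall s u, s ^+ 2 = 1 -> 0 <= u -> nrm (r (ray s c u) - q (ray s c u)) <= e) ->
  nrm (airy_int c r xi - airy_int c q xi) <= M * e * expR (- (xi * c)).
Proof.
move=> X0; have [l1 l2] := strip c.
have [M M0 hM] := polybounded_decays (polybounded_cst (c - 1) (c + 1) 1) X0.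
exists (`|(2 * pi)^-1 : R| * 4 * M) => [|a b r q e xi ac cb mr mq hr hq Xxi h].
  by rewrite !mulr_ge0.
pose d z := r z + -1 * q z.
have md : cmfun d by apply: cmfunD => //; apply: cmfunM => //; exact: cmfun_cst.
have hd : polybounded a b d by apply: polyboundedD => //; apply: polyboundedM => //; exact: polybounded_cst.
have -> : airy_int c r xi - airy_int c q xi = airy_int c d xi.
  have := airy_intD xi md hd mq hq ac cb.
  rewrite (_ : (fun z => d z + q z) = r) => [->|]; first by rewrite addrK.
  by apply/funext => z; rewrite /d mulN1r subrK.
rewrite /airy_int nrmMr -!mulrA ler_wpM2l //.
have -> : 4 * (M * (e * expR (- (xi * c)))) = 4 * (M * expR (- (xi * c)) * e) by ring.
apply: nrm_ray_int; first exact: cmfunM (@cmfun_airy_exp _ _) md.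
move=> s u s2 u0; apply: le_trans (nrmM _ _) _.
have := hM xi c Xxi l1 l2 s u s2 u0; rewrite mulr1 => h1.
rewrite mulrAC; apply: ler_pM; rewrite ?nrm_ge0 //.
by rewrite /d mulN1r; exact: h.
Qed.

Lemma sfun_close (l : seq 'I_k) (X e : R) : 0 <= X -> 0 < e ->
  nbhs w [set v : 'rV[C]_k | forall xi, - X <= xi ->
    nrm (Defs.sfun [seq v 0 j | j <- l] xi - Defs.sfun [seq w 0 j | j <- l] xi) <= e * expR (- (xi * c))].
Proof.
move=> X0 e0; have [M M0 hM] := airy_int_close X0.
have M1 : 0 < M + 1 by rewrite ltr_wpDl.
have eM : 0 < e / (M + 1) by rewrite divr_gt0.
apply: filterS2 (prod_inv_close l eM) pole_height_near => v h1 h2 xi Xxi.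
have ad (a : 'rV[C]_k) : (forall j, c + 1 <= pole_height (a 0 j)) ->
    (forall u, u \in [seq a 0 j | j <- l] -> c + 1 <= pole_height u) /\
    admissible (c - 1) (c + 2^-1) (fun z => \prod_(u <- [seq a 0 j | j <- l]) inv_lin u z).
  move=> ha; have hu u : u \in [seq a 0 j | j <- l] -> c + 1 <= pole_height u.
    by move=> /mapP[j _ ->].
  by split=> //; apply: admissible_inv_prod => u ul; rewrite -addrA addr_halves hu.
have [hv av] := ad v h2.
have [hw aw] : _ /\ _ := ad w (fun j => le_trans (lerD (lexx c) (ler1n _ 2)) (hc j)).
rewrite (sfunE _ hv) (sfunE _ hw).
have l2 : c < c + 2^-1 by rewrite ltrDl.
apply: le_trans (hM _ _ _ _ (e / (M + 1)) xi (strip c).1 l2 (admissible_meas av) (admissible_meas aw)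
  (admissible_bounded av) (admissible_bounded aw) Xxi _) _.
  by move=> s u s2 u0; rewrite !big_map; exact: h1.
rewrite ler_wpM2r ?expR_ge0 // mulrA ler_pdivrMr // mulrC ler_wpM2l ?ltW //; lra.
Qed.

End NodeContinuity.

(** * Continuity of the determinant *)

Section Continuity.
Variable R : realType.
Local Notation C := R[i].
Local Notation half := (`]0%R, +oo[%classic : set R).
Variables (B x : R) (k : nat) (w : 'rV[C]_k).
Hypothesis B0 : 0 <= B.
Hypothesis hB : forall j, - B + 2 <= pole_height (w 0 j).
Hypothesis gx : good B x.

Lemma nrm_pair n : exists2 K, 0 <= K & forall f M, tempered B f ->
  bounded_by half (ewt (- B)) (fun s => f (x + s)) M -> nrm (pair B f n x) <= K * M.
Proof.
have [K sK] := gx; have K0 : 0 <= K by case: sK.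
have g1 : 1 <= B + 1 by rewrite lerDr.
have [N N0 hN] := kern_bound g1 (normr_ge0 x).
have [A A0 hA] := AiD_bounded B n (normr_ge0 x).
have mhalf : measurable half by exact: measurable_itv.
exists (K * A) => [|f M tf hf]; first exact: mulr_ge0.
have [hv _] := sol_props mhalf (rintegrable_wt B) (hN x (lexx _)) sK hf.
have := nrm_dual mhalf (rintegrable_wt B) (Rintegral_wt B) hv (hA x (lexx _)).
by rewrite mulrAC.
Qed.

Lemma tempered_sfun ws : (forall u, u \in ws -> - B + 1 <= pole_height u) ->
  tempered B (Defs.sfun ws).
Proof. by move=> h; split=> [|X X0]; [exact: cmeas_sfun|exact: sfun_bound]. Qed.

(** The pairing is linear and bounded ([nrm_pair]), and [sfun_close] gives closeness in the weight
    [e^{B xi}] uniformly in [xi]; the contour with vertex of height [- B] serves all tuples near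
    [w]. *)
Lemma ccvg_pair (l : seq 'I_k) n : ccvg (nbhs w)
  (fun v => pair B (Defs.sfun [seq v 0 j | j <- l]) n x) (pair B (Defs.sfun [seq w 0 j | j <- l]) n x).
Proof.
move=> e e0; have [K K0 hK] := nrm_pair n.
pose E := expR (`|x| * `|- B|).
have E0 : 0 < E := expR_gt0 _.
have KE : 0 < K * E + 1 by rewrite ltr_wpDl // mulr_ge0 // ltW.
have eK : 0 < e / (K * E + 1) by rewrite divr_gt0.
apply: filterS2 (sfun_close hB l (normr_ge0 x) eK) (pole_height_near hB) => v h1 h2.
have tv : tempered B (Defs.sfun [seq v 0 j | j <- l]).
  by apply: tempered_sfun => u /mapP[j _ ->].
have tw : tempered B (Defs.sfun [seq w 0 j | j <- l]).
  by apply: tempered_sfun => u /mapP[j _ ->]; have := hB j; lra.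
have td : tempered B (fun xi => Defs.sfun [seq v 0 j | j <- l] xi + -1 * Defs.sfun [seq w 0 j | j <- l] xi).
  by apply: temperedD => //; exact: temperedZ.
have -> : pair B (Defs.sfun [seq v 0 j | j <- l]) n x - pair B (Defs.sfun [seq w 0 j | j <- l]) n x =
    pair B (fun xi => Defs.sfun [seq v 0 j | j <- l] xi + -1 * Defs.sfun [seq w 0 j | j <- l] xi) n x.
  by rewrite (pairD B0 n gx tv (temperedZ (-1) tw)) (pairZ B0 _ n gx tw) mulN1r.
have hb := bounded_shift td.1 (ltW eK) (lexx `|x|) _.
apply: le_trans (hK _ _ td (hb (- B) _)) _.
  by move=> xi Xxi; rewrite mulN1r; exact: h1.
have -> : K * (e / (K * E + 1) * E) = e * (K * E) / (K * E + 1) by ring.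
rewrite ler_pdivrMr // ler_wpM2l ?ltW //; lra.
Qed.

Lemma ccvg_det_smx : ccvg (nbhs w) (fun v => \det (smx x v)) (\det (smx x w)).
Proof.
(* The condition on pole heights holds for all tuples near [w], which is enough for a limit at
   [w]. *)
have E (v : 'rV[C]_k) (m n : 'I_k) : (forall j, - B + 1 <= pole_height (v 0 j)) ->
  smx x v m n = (m == n)%:R - \sum_(j < k) (tpoly [seq v 0 j | j <- take n (enum 'I_k)])`_j *
    pair B (Defs.sfun [seq v 0 j | j <- take m.+1 (enum 'I_k)]) j x.
  move=> hv; have tk r : take r [seq v 0 j | j <- enum 'I_k] = [seq v 0 j | j <- take r (enum 'I_k)].
    by rewrite map_take.
  rewrite mxE !tk; congr (_ - _); apply: pairing_tfun => //.
    by apply: tempered_sfun => u /mapP[j _ ->].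
  by rewrite size_map size_takel // size_enum_ord ltnW.
apply: ccvg_det => m n.
have hw j : - B + 1 <= pole_height (w 0 j) by have := hB j; lra.
move=> e e0.
have h : ccvg (nbhs w) (fun v => (m == n)%:R - \sum_(j < k) (tpoly [seq v 0 j | j <- take n (enum 'I_k)])`_j *
    pair B (Defs.sfun [seq v 0 j | j <- take m.+1 (enum 'I_k)]) j x)
  ((m == n)%:R - \sum_(j < k) (tpoly [seq w 0 j | j <- take n (enum 'I_k)])`_j *
    pair B (Defs.sfun [seq w 0 j | j <- take m.+1 (enum 'I_k)]) j x).
  apply: ccvgB; first exact: ccvg_cst.
  apply: ccvg_sum => j; apply: ccvgM; last exact: ccvg_pair.
  exact: (@ccvg_tpoly R _ (nbhs w) _ _ _ (fun i (v : 'rV[C]_k) => v 0 i) (fun i => w 0 i) j (ccvg_coord w)).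
apply: filterS2 (h e e0) (pole_height_near hB) => v h1 h2.
apply: le_trans h1; rewrite le_eqVlt; apply/orP; left; apply/eqP.
exact: (congr2 (fun a b : C => nrm (a - b)) (E v m n h2) (E w m n hw)).
Qed.

End Continuity.

(** The margin is 2 so that tuples near [w] keep a margin of 1 with the same [B]
    ([pole_height_near]); the sum over all nodes dominates what each of them requires. *)
Lemma exists_weight (R : realType) k (w : 'rV[R[i]]_k) :
  exists2 B, 0 <= B & forall j, - B + 2 <= pole_height (w 0 j).
Proof.
exists (\sum_(j < k) (2 + `|pole_height (w 0 j)|)).
  by apply: sumr_ge0 => j _; rewrite addr_ge0.
move=> j; rewrite (bigD1 j) //=.
have s0 : 0 <= \sum_(i < k | i != j) (2 + `|pole_height (w 0 i)|).
  by apply: sumr_ge0 => i _; rewrite addr_ge0.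
have := ler_norm (- pole_height (w 0 j)); rewrite normrN; lra.
Qed.

Lemma Fk_smx (R : realType) k (x : R) (w : 'rV[R[i]]_k) : Fk x w = F0 x * \det (smx x w).
Proof. by []. Qed.

Lemma Fk_distinct (R : realType) k (x : R) (w : 'rV[R[i]]_k) : distinct w -> Fk x w = Fk_formula x w.
Proof.
move=> dw; rewrite Fk_smx /Fk_formula; have [->|F0x] := eqVneq (F0 x) 0; first by rewrite !mul0r.
have [B B0 hB] := exists_weight w.
have hB1 m : 1 - B <= pole_height (w 0 m) by have := hB m; lra.
by rewrite (det_smx B0 hB1 (good_of_F0 B0 F0x) dw).
Qed.

Theorem theorem1p1 (R : realType) (k : nat) (hk : (1 <= k)%N) (x : R)
    (w : 'rV[R[i]]_k) :
  (distinct w -> Fk x w = Fk_formula x w) /\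
  (~ distinct w ->
     Fk_formula x v @[v --> within [set v | distinct v] (nbhs w)]
       --> Fk x w).
Proof.
split=> [|_]; first exact: Fk_distinct.
have h : ccvg (nbhs w) (Fk x) (Fk x w).
  have [F00|F0x] := eqVneq (F0 x) 0.
    rewrite Fk_smx F00 mul0r => e e0; apply: filterE => v.
    by rewrite Fk_smx F00 mul0r subrr nrm0 ltW.
  have [B B0 hB] := exists_weight w.
  have := ccvgM _ (ccvg_cst _ (F0 x)) (ccvg_det_smx B0 hB (good_of_F0 B0 F0x)).
  exact.
(* [Fk] and the formula agree at distinct tuples, so continuity of [Fk] at [w] gives the limit along
   them. *)
apply: cvg_nrm => e e0.
apply: filterS (h e e0) => v; rewrite -nrmN opprB => hv dv.
by rewrite -Fk_distinct.
Qed.
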